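(* There exist absolute constants $a,b>0$ such that for all $n\ge2$ $$a\sqrt n\le\sup_L d_{\rm vr}(L,\Pi)\le b\sqrt n,$$ where the supremum is over all origin-symmetric convex bodies $L$ in $\mathbb{R}^n$ and $\Pi$ is the class of projection bodies in $\mathbb{R}^n$.
   Context: $|\cdot|$ denotes volume (Lebesgue measure) of the appropriate dimension. A convex body is a compact convex set with non-empty interior; origin-symmetric means $K=-K$. For $\xi\in S^{n-1}$, $K\vert\xi^\perp$ is the orthogonal projection of $K$ onto the hyperplane through the origin perpendicular to $\xi$. The support function of a convex body $K$ is $h_K(x)=\max\{\langle x,y\rangle: y\in K\}$. The projection body $\Pi K$ of an origin-symmetric convex body $K$ is the origin-symmetric convex body with $h_{\Pi K}(\xi)=|K\vert\xi^\perp|$ for all $\xi\in S^{n-1}$. A body is called a projection body if it is the projection body of some convex body; $\Pi$ denotes the class of projection bodies in $\mathbb{R}^n$. The volume ratio distance is $d_{\rm vr}(L,\Pi)=\inf\{(|L|/|D|)^{1/n}: D\subset L,\ D\in\Pi\}$. *)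

(* Defs.v *)
From HB Require Import structures.
From mathcomp Require Import all_boot all_order all_algebra.
From mathcomp Require Import all_classical all_reals all_analysis.
From mathcomp Require Import ring.

Set Implicit Arguments.
Unset Strict Implicit.
Unset Printing Implicit Defensive.

Import Order.TTheory GRing.Theory Num.Theory.
Import numFieldNormedType.Exports.

Local Open Scope classical_set_scope.
Local Open Scope ring_scope.

(* The product of the Lebesgue measure on R and of a measure on n-tuples,
   transported to n.+1-tuples by (x, t) |-> x :: t. *)
Section lebesgue_cons.
Context (R : realType) (n : nat).
Local Notation T := (measurableTypeR R).
Variable mu : {sigma_finite_measure set (n.-tuple T) -> \bar R}.

Let cons_pair (x : T * n.-tuple T) : n.+1.-tuple T :=
  [the n.+1.-tuple T of x.1 :: x.2].

Let measurable_cons_pair : measurable_fun setT cons_pair.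
Proof. exact: measurable_cons. Qed.

Definition lebesgue_cons : set (n.+1.-tuple T) -> \bar R :=
  pushforward (lebesgue_measure \x mu)%E cons_pair.

Let lebesgue_cons0 : lebesgue_cons set0 = 0%E.
Proof. exact: measure0. Qed.

Let lebesgue_cons_ge0 A : (0 <= lebesgue_cons A)%E.
Proof. exact: measure_ge0. Qed.

Let lebesgue_cons_sigma_additive : semi_sigma_additive lebesgue_cons.
Proof.
exact: (@measure_semi_sigma_additive _ _ _
  (Measure.clone _ _ _
    (pushforward (lebesgue_measure \x mu)%E cons_pair)
    (measure_function_pushforward__canonical__measure_function_Measure
      (lebesgue_measure \x mu)%E measurable_cons_pair))).
Qed.

HB.instance Definition _ := isMeasure.Build _ _ _ lebesgue_cons
  lebesgue_cons0 lebesgue_cons_ge0 lebesgue_cons_sigma_additive.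

Let lebesgue_cons_sigma_finite : sigma_finite setT lebesgue_cons.
Proof.
pose uncons (t : n.+1.-tuple T) : T * n.-tuple T :=
  (thead t, [tuple of behead t]).
have muncons : measurable_fun setT uncons.
  by apply/measurable_fun_pairP; split;
    [exact: measurable_tnth|exact: measurable_behead].
have consK : cancel cons_pair uncons.
  by move=> [x t]; congr pair => //; apply/val_inj.
have /sigma_finiteP[F [FT ndF Foo]] :=
  sigma_finiteT (@lebesgue_measure R).
have /sigma_finiteP[G [GT ndG Goo]] := sigma_finiteT mu.
exists (fun k => uncons @^-1` (F k `*` G k)).
  rewrite -preimage_bigcup (_ : \bigcup_k (F k `*` G k) = setT) ?preimage_setT//.
  rewrite -subTset => -[x y] _.
  have [k _ Fkx] : (\bigcup_k F k) x by rewrite -FT.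
  have [l _ Gly] : (\bigcup_k G k) y by rewrite -GT.
  exists (maxn k l) => //; split => /=.
    by move: x Fkx; exact/subsetPset/ndF/leq_maxl.
  by move: y Gly; exact/subsetPset/ndG/leq_maxr.
move=> k; have [mFk Fkoo] := Foo k; have [mGk Gkoo] := Goo k.
split; first by rewrite -[X in measurable X]setTI; apply: muncons => //;
  exact: measurableX.
rewrite /lebesgue_cons /pushforward -comp_preimage.
rewrite (_ : uncons \o cons_pair = id); last exact/funext.
by rewrite preimage_id product_measure1E// lte_mul_pinfty// ge0_fin_numE.
Qed.

HB.instance Definition _ := Measure_isSigmaFinite.Build _ _ _ lebesgue_cons
  lebesgue_cons_sigma_finite.

End lebesgue_cons.

(* The n-fold product of the Lebesgue measure on R; see lebesgue_tuple_box. *)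
Fixpoint lebesgue_tuple (R : realType) (n : nat) :
    {sigma_finite_measure set (n.-tuple (measurableTypeR R)) -> \bar R} :=
  match n with
  | 0%N => \d_ ([tuple] : 0.-tuple (measurableTypeR R))
  | m.+1 => lebesgue_cons (lebesgue_tuple R m)
  end.

Lemma lebesgue_tuple_box (R : realType) n (A : 'I_n -> set (measurableTypeR R)) :
  (forall i, measurable (A i)) ->
  lebesgue_tuple R n [set t | forall i, A i (tnth t i)] =
  (\prod_(i < n) lebesgue_measure (A i))%E.
Proof.
elim: n A => [A _|n IH A mA].
  by rewrite big_ord0 /= diracE mem_set// => -[m i]; have := i; rewrite ltn0.
rewrite big_ord_recl -IH//= /lebesgue_cons /pushforward.
rewrite -product_measure1E//; last first.
  pose C i : set (n.-tuple (measurableTypeR R)) :=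
    (fun t => tnth t i) @^-1` A (lift ord0 i).
  rewrite (_ : mkset _ = \bigcap_(i in [set: 'I_n]) C i); last first.
    by apply/seteqP; split => t /= tA i; [move=> _; exact: tA|exact: (tA i)].
  apply: fin_bigcap_measurable => [|i _]; first exact: finite_finset.
  by rewrite /C -[X in measurable X]setTI; exact: measurable_tnth.
congr ((_ \x _)%E _); apply/seteqP; split => -[x t] /= xt.
  split; first exact: (xt ord0).
  by move=> i; rewrite -(tnthS x); exact: (xt (lift ord0 i)).
case: xt => xA tA i; case: (unliftP ord0 i) => [j|] ->; last exact: xA.
by rewrite tnthS; exact: tA.
Qed.

Section convex_bodies.
Context (R : realType) (n : nat).
Implicit Types (K L D : set 'rV[R]_n) (x y xi : 'rV[R]_n).

(* The n-dimensional volume. It is finite on bounded sets, so that [fine] loses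
   nothing on convex bodies and on their projections. *)
Definition vol K : R :=
  fine (lebesgue_tuple R n [set t | K (\row_i tnth t i)]).

Definition dotr x y : R := (x *m y^T) 0 0.

Definition sphere : set 'rV[R]_n := [set xi | dotr xi xi = 1].

Definition convex_body K :=
  [/\ compact K, @convex_set R 'rV[R]_n K & K° !=set0].

Definition origin_symmetric K := K = -%R @` K.

(* When K is a convex body the supremum is attained, i.e., it is a maximum. *)
Definition support_fun K x : R := sup [set dotr x y | y in K].

(* The orthogonal projection of K onto the hyperplane orthogonal to xi, for a
   unit vector xi. *)
Definition orth_proj xi K : set 'rV[R]_n :=
  [set x - dotr x xi *: xi | x in K].

End convex_bodies.

Section hyperplane_frames.
Context (R : realType) (n : nat).
Implicit Types (xi : 'rV[R]_n).

(* The rows of U form an orthonormal basis of the hyperplane orthogonal to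
   xi. *)
Definition is_hyperplane_frame xi (U : 'M[R]_(n.-1, n)) :=
  U *m U^T = 1%:M /\ U *m xi^T = 0.

Definition hyperplane_frame xi : 'M[R]_(n.-1, n) :=
  xget 0 (is_hyperplane_frame xi).

End hyperplane_frames.

Lemma hyperplane_frameP (R : realType) n (xi : 'rV[R]_n) : sphere xi ->
  is_hyperplane_frame xi (hyperplane_frame xi).
Proof.
move=> xi1; suff [U HU] : exists U, is_hyperplane_frame xi U.
  by apply: xgetPex; exists U.
case: n xi xi1 => [|n] xi xi1.
  by exists 0; split; apply/matrixP => -[m i]; have := i; rewrite ltn0.
have xiE : xi *m xi^T = 1%:M by apply/matrixP => i j; rewrite !ord1 [RHS]mxE; exact: xi1.
have [H [HH Hxi]] : exists H : 'M[R]_n.+1,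
    H *m H^T = 1%:M /\ row ord0 H = xi.
  pose e : 'rV[R]_n.+1 := delta_mx 0 0.
  have eE : e *m e^T = 1%:M.
    by rewrite /e trmx_delta mul_delta_mx; apply/matrixP => i j; rewrite !ord1 !mxE.
  pose v := e - xi; pose q := (v *m v^T) 0 0.
  have vv : v *m v^T = q%:M by apply/matrixP => i j; rewrite !ord1 [RHS]mxE.
  have [v0|vn0] := eqVneq v 0.
    exists 1%:M; split; first by rewrite trmx1 mulmx1.
    by rewrite row1 -/e; apply/eqP; rewrite -subr_eq0 -/v v0.
  have qn0 : q != 0.
    apply: contra vn0 => /eqP q0; apply/eqP/rowP => i; rewrite [RHS]mxE.
    have : \sum_j v 0 j ^+ 2 = 0.
      by rewrite -[RHS]q0 /q mxE; apply: eq_bigr => j _; rewrite !mxE expr2.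
    move/psumr_eq0P => /(_ (fun j _ => sqr_ge0 _))/(_ i isT)/eqP.
    by rewrite sqrf_eq0 => /eqP.
  pose P := v^T *m v; pose c := 2 / q.
  have PP : P *m P = q *: P.
    by rewrite /P mulmxA -[_ *m v *m _]mulmxA vv mul_mx_scalar -scalemxAl.
  have PT : P^T = P by rewrite /P trmx_mul trmxK.
  exists (1%:M - c *: P); split.
    have -> : (1%:M - c *: P)^T = 1%:M - c *: P.
      by rewrite raddfB /= trmx1 linearZ /= PT.
    rewrite mulmxBl mul1mx mulmxBr mulmx1.
    rewrite -scalemxAl -scalemxAr PP !scalerA.
    have -> : c * c * q = c + c by rewrite /c; field.
    by rewrite scalerDl opprB addrK subrK.
  have ev : e *m v^T *+ 2 = q%:M.
    have exi : xi *m e^T = e *m xi^T.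
      apply/matrixP => i j; rewrite !ord1 !mxE.
      by apply: eq_bigr => k _; rewrite !mxE mulrC.
    rewrite -vv; have -> : v^T = e^T - xi^T by rewrite /v raddfB.
    by rewrite /v mulmxBl !mulmxBr eE xiE exi opprB mulr2n.
  rewrite rowE -/e mulmxBr mulmx1 -scalemxAr /P mulmxA.
  have -> : e *m v^T = (q / 2)%:M.
    move/matrixP/(_ 0 0): ev; rewrite !mxE mulr1n => ev.
    apply/matrixP => i j; rewrite !ord1 !mxE mulr1n -ev; by field.
  rewrite mul_scalar_mx scalerA (_ : c * _ = 1); last by rewrite /c; field.
  by rewrite scale1r /v opprB addrC subrK.
have HHE i j : \sum_k H i k * H j k = (i == j)%:R.
  have := congr1 (fun M : 'M[R]_n.+1 => M i j) HH; rewrite !mxE => <-.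
  by apply: eq_bigr => k _; rewrite mxE.
exists (rowsub (lift ord0) H); split; apply/matrixP => i j; rewrite !mxE.
  under eq_bigr do rewrite !mxE.
  by rewrite HHE (inj_eq lift_inj).
have xiH k : xi j k = H ord0 k by rewrite ord1 -Hxi mxE.
under eq_bigr do rewrite !mxE xiH.
by rewrite HHE eq_sym (negbTE (neq_lift _ _)).
Qed.

Section projection_bodies.
Context (R : realType) (n : nat).
Implicit Types (K L D : set 'rV[R]_n) (xi : 'rV[R]_n).

(* The (n-1)-dimensional volume of a subset of the hyperplane orthogonal to the
   unit vector xi: the volume of its set of coordinates in an orthonormal basis
   of the hyperplane, the choice of which is immaterial. *)
Definition hyperplane_vol xi (A : set 'rV[R]_n) : R :=
  vol [set y : 'rV[R]_n.-1 | A (y *m hyperplane_frame xi)].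

(* D is the projection body of the origin-symmetric convex body K. *)
Definition projection_body_of K D :=
  [/\ convex_body K, origin_symmetric K, convex_body D, origin_symmetric D &
    forall xi, sphere xi ->
      support_fun D xi = hyperplane_vol xi (orth_proj xi K)].

Definition projection_body D := exists K, projection_body_of K D.

(* The volume ratio distance from L to a class C of bodies; it is +oo when no
   member of C is included in L. *)
Definition vr_dist L (C : set (set 'rV[R]_n)) : \bar R :=
  ereal_inf [set ((vol L / vol D) `^ n%:R^-1)%:E |
             D in [set D | D `<=` L /\ C D]].

End projection_bodies.

(* Main.v *)
Require Import Defs.
From mathcomp Require Import all_boot all_order all_algebra.
From mathcomp Require Import all_classical all_reals all_analysis.
From mathcomp Require Import measurable_realfun.
From mathcomp Require Import ring lra zify.

Set Implicit Arguments.
Unset Strict Implicit.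
Unset Printing Implicit Defensive.

Import Order.TTheory GRing.Theory Num.Theory.
Import numFieldNormedType.Exports.

Local Open Scope classical_set_scope.
Local Open Scope ring_scope.

(** Upper bound.  Among the ellipsoids included in L, take one of almost maximal
volume.  If L reached further than 3 sqrt n times this ellipsoid, then the
convex hull of the ellipsoid and of a far point of L would contain a stretched
ellipsoid of substantially larger volume, as in John's theorem ([john_step]);
hence L is included in the dilate by 3 sqrt n.  Moreover an ellipsoid is a
projection body: the shadows of the image of the unit ball by S have a volume
proportional to the norm of [xi *m invmx S] ([vol_shadow_ellipsoid]), which is
a support function of the same type ([ellipsoid_projection_body]).

Lower bound.  Choose N = C n sign vectors e such that the average of
|<x, e>| over the chosen vectors is equivalent to the Euclidean norm of x
([kashin_signs]), and let L be the set of the x such that |<x, e>| <= sqrt n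
for all of them ([slab_body]).
- The cube [-1, 1]^n is covered by 2^(9N) translates of L, so that the volume
  of L is at least c^n ([slab_vol]).
- Let D, included in L, be the projection body of K.  The volume of the shadow
  of K along xi is half the L^1 norm of the derivative along xi of the
  indicator function of K.  Since |g| is dominated by the average of
  |<g, e>| over the chosen vectors, for g the gradient of a smooth substitute
  of this indicator function, the average of the support function of D over
  all the sign vectors is at most a constant times its maximum over the chosen
  ones ([avg_shadow_le]), i.e., a constant times sqrt n.
- An Urysohn inequality for sign vectors ([sign_urysohn]) converts such an
  average h into the bound (2 h)^n / n! on the volume of D.  As n! is at least
  (n / 4)^n, the volume of D is at most (C' / sqrt n)^n. *)

(** * Linear changes of variables *)

Section lebesgue1.
Context (R : realType).
Local Notation T := (measurableTypeR R).
Local Notation leb := (@lebesgue_measure R).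

(** The Lebesgue measure and [`|a|] times its image by x |-> a x + c agree on the
half-open intervals, hence on all measurable sets. *)
Lemma integral_lebesgue_affine (F : T -> \bar R) (a c : R) : a != 0 ->
  measurable_fun setT F -> (forall x, (0 <= F x)%E) ->
  (\int[leb]_x F ((a * x + c)%R : T) = (`|a|^-1)%:E * \int[leb]_x F x)%E.
Proof.
move=> a0 mF F0; pose phi (x : T) : T := a * x + c.
have mphi : measurable_fun setT phi.
  apply: (@continuous_measurable_fun R phi) => x.
  by apply: cvgD; [apply: cvgM; [exact: cvg_cst|exact: cvg_id]|exact: cvg_cst].
have k0 : 0 <= `|a| by [].
pose k := NngNum k0.
have lebE A : measurable A -> leb A = mscale k (pushforward leb phi) A.
  apply: (@lebesgue_measure_unique R (mscale k _)) => _ [[u v]] _ <-.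
  rewrite -[RHS]/(k%:num%:E * leb (phi @^-1` (`]u, v]%classic : set R)))%E.
  have [agt0|alt0|a00] := ltgtP a 0; last by rewrite a00 eqxx in a0.
    rewrite (_ : phi @^-1` _ = `[(v - c) / a, (u - c) / a[%classic); last first.
      apply/seteqP; split => x /=; rewrite !in_itv/= /phi.
        by rewrite ler_ndivrMr// ltr_ndivlMr// => /andP[? ?]; apply/andP; split; lra.
      by rewrite ler_ndivrMr// ltr_ndivlMr// => /andP[? ?]; apply/andP; split; lra.
    rewrite !lebesgue_measure_itv/= !lte_fin ltr_ndivlMr// divfK//.
    rewrite (_ : (u - c < v - c) = (u < v)); last by rewrite ltrD2r.
    case: ifP => uv; last by rewrite mule0.
    by rewrite -EFinD -EFinM; congr EFin; rewrite ltr0_norm//; field.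
  rewrite (_ : phi @^-1` _ = `](u - c) / a, (v - c) / a]%classic); last first.
    apply/seteqP; split => x /=; rewrite !in_itv/= /phi.
      by rewrite ltr_pdivrMr// ler_pdivlMr// => /andP[? ?]; apply/andP; split; lra.
    by rewrite ltr_pdivrMr// ler_pdivlMr// => /andP[? ?]; apply/andP; split; lra.
  rewrite !lebesgue_measure_itv/= !lte_fin ltr_pdivlMr// divfK//.
  rewrite (_ : (u - c < v - c) = (u < v)); last by rewrite ltrD2r.
  case: ifP => uv; last by rewrite mule0.
  by rewrite -EFinD -EFinM; congr EFin; rewrite gtr0_norm//; field.
rewrite [in RHS](eq_measure_integral (mscale k (pushforward leb phi))); last first.
  by move=> A mA _; exact: lebE.
rewrite ge0_integral_mscale// muleA -EFinM mulVf ?normr_eq0// mul1e.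
by rewrite ge0_integral_pushforward.
Qed.
End lebesgue1.

Section tuples.
Context (R : realType).
Local Notation T := (measurableTypeR R).
Local Notation leb := (@lebesgue_measure R).
Local Notation mu := (lebesgue_tuple R).

(** [lebesgue_tuple] lives on tuples while linear algebra is done on row vectors;
[rowt] and [tupr] translate between the two. *)
Definition rowt n (t : n.-tuple T) : 'rV[R]_n := \row_i tnth t i.
Definition tupr n (x : 'rV[R]_n) : n.-tuple T := [tuple x 0 i | i < n].

Lemma rowtK n : cancel (@rowt n) (@tupr n).
Proof. by move=> t; apply: eq_from_tnth => i; rewrite tnth_mktuple mxE. Qed.

Lemma tuprK n : cancel (@tupr n) (@rowt n).
Proof. by move=> x; apply/rowP => i; rewrite mxE tnth_mktuple. Qed.

Lemma measurable_mktuple d (X : measurableType d) n (f : 'I_n -> X -> T) :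
  (forall i, measurable_fun setT (f i)) ->
  measurable_fun setT (fun x => [tuple f i x | i < n] : n.-tuple T).
Proof.
move=> mf; apply/measurable_fun_tnthP => i.
rewrite (_ : _ \o _ = f i)//; apply/funext => x /=.
by rewrite tnth_mktuple.
Qed.

Lemma measurable_row_affine m n (M : 'M[R]_(m, n)) (v : 'rV[R]_n) :
  measurable_fun setT (fun t : m.-tuple T => tupr (rowt t *m M + v)).
Proof.
apply: measurable_mktuple => i.
rewrite (_ : (fun _ => _) = (fun t : m.-tuple T => \sum_j tnth t j * M j i + v 0 i)).
  apply: measurable_funD => //; apply: measurable_sum => j.
  by apply: measurable_funM => //; exact: measurable_tnth.
by apply/funext => t; rewrite !mxE; congr (_ + _); apply: eq_bigr => j _; rewrite mxE.
Qed.

Definition consp n (p : T * n.-tuple T) : n.+1.-tuple T :=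
  [the n.+1.-tuple T of p.1 :: p.2].

Lemma measurable_consp n : measurable_fun setT (@consp n).
Proof. exact: measurable_cons. Qed.

Lemma integral_consp n (F : n.+1.-tuple T -> \bar R) : measurable_fun setT F ->
  (forall t, (0 <= F t)%E) ->
  (\int[mu n.+1]_t F t = \int[leb \x mu n]_p F (consp p))%E.
Proof.
move=> mF F0; rewrite -[RHS]/(\int[leb \x mu n]_p (F \o @consp n) p)%E.
have := ge0_integral_pushforward (@measurable_consp n) (leb \x mu n)%E
  measurableT mF (fun y _ => F0 y).
by rewrite preimage_setT => <-.
Qed.

Lemma integral_cons1 n (F : n.+1.-tuple T -> \bar R) : measurable_fun setT F ->
  (forall t, (0 <= F t)%E) ->
  (\int[mu n.+1]_t F t = \int[leb]_x \int[mu n]_y F (consp (x, y)))%E.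
Proof.
move=> mF F0; rewrite integral_consp// fubini_tonelli1//.
by apply: measurableT_comp => //; exact: measurable_consp.
Qed.

Lemma integral_cons2 n (F : n.+1.-tuple T -> \bar R) : measurable_fun setT F ->
  (forall t, (0 <= F t)%E) ->
  (\int[mu n.+1]_t F t = \int[mu n]_y \int[leb]_x F (consp (x, y)))%E.
Proof.
move=> mF F0; rewrite integral_consp// fubini_tonelli2//.
by apply: measurableT_comp => //; exact: measurable_consp.
Qed.

Lemma rowt_consp n x (t : n.-tuple T) :
  rowt (consp (x, t)) = row_mx x%:M (rowt t) :> 'rV_(1 + n).
Proof.
apply/rowP => i; case: (split_ordP i) => j ->.
  by rewrite row_mxEl ord1 [RHS]mxE mulr1n [LHS]mxE (_ : lshift n 0 = ord0) ?tnth0//; apply/val_inj.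
rewrite row_mxEr !mxE (_ : rshift 1 j = lift ord0 j) ?tnthS//.
exact/val_inj.
Qed.

Lemma tupr_row_mx n x (r : 'rV[R]_n) :
  tupr (row_mx x%:M r : 'rV_(1 + n)) = consp (x, tupr r).
Proof. by rewrite -[in LHS](tuprK r) -rowt_consp rowtK. Qed.

Lemma measurable_row_mul m n (M : 'M[R]_(m, n)) :
  measurable_fun setT (fun t : m.-tuple T => tupr (rowt t *m M)).
Proof.
have := measurable_row_affine M 0.
by under eq_fun do rewrite addr0.
Qed.

Lemma measurable_row_shift n (v : 'rV[R]_n) :
  measurable_fun setT (fun t : n.-tuple T => tupr (rowt t + v)).
Proof.
have := measurable_row_affine 1%:M v.
by under eq_fun do rewrite mulmx1.
Qed.

Lemma measurable_comp_consp n (F : n.+1.-tuple T -> \bar R) :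
  measurable_fun setT F -> measurable_fun setT (F \o @consp n).
Proof. by move=> mF; apply: measurableT_comp => //; exact: measurable_consp. Qed.

Lemma measurable_integral_tail n (F : n.+1.-tuple T -> \bar R) :
  measurable_fun setT F -> (forall t, (0 <= F t)%E) ->
  measurable_fun setT (fun x : T => \int[mu n]_y F (consp (x, y)))%E.
Proof.
by move=> mF F0; apply: (measurable_fun_fubini_tonelli_F (F \o @consp n)) => [|p];
  [exact: measurable_comp_consp|exact: F0].
Qed.

Lemma measurable_integral_head n (F : n.+1.-tuple T -> \bar R) :
  measurable_fun setT F -> (forall t, (0 <= F t)%E) ->
  measurable_fun setT (fun y : n.-tuple T => \int[leb]_x F (consp (x, y)))%E.
Proof.
by move=> mF F0; apply: (measurable_fun_fubini_tonelli_G (F \o @consp n)) => [|p];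
  [exact: measurable_comp_consp|exact: F0].
Qed.

Lemma measurable_consp2 n x : measurable_fun setT (fun y : n.-tuple T => consp (x, y)).
Proof. exact: (measurable_cons (measurable_cst x) (@measurable_id _ _ setT)). Qed.

Lemma measurable_consp1 n (y : n.-tuple T) : measurable_fun setT (fun x : T => consp (x, y)).
Proof. exact: (measurable_cons (@measurable_id _ _ setT) (measurable_cst y)). Qed.

(** By Fubini, one coordinate at a time. *)
Lemma integral_shift n (F : n.-tuple T -> \bar R) v : measurable_fun setT F ->
  (forall t, (0 <= F t)%E) ->
  (\int[mu n]_t F (tupr (rowt t + v)) = \int[mu n]_t F t)%E.
Proof.
elim: n F v => [|n IH] F v mF F0.
  by apply: eq_integral => t _; rewrite (tuple0 t) (tuple0 (tupr _)).
rewrite integral_cons1//; last first.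
  by apply: (measurableT_comp mF); exact: measurable_row_shift.
pose w : 'rV_n := rsubmx (v : 'rV_(1 + n)).
pose a : R := lsubmx (v : 'rV_(1 + n)) 0 0.
have vE : v = row_mx a%:M w :> 'rV_(1 + n).
  by rewrite -{1}(@hsubmxK R 1 1 n v); congr row_mx; rewrite [LHS]mx11_scalar.
transitivity (\int[leb]_x \int[mu n]_y F (consp ((1 * x + a)%R : T, y)))%E.
  apply: eq_integral => x _.
  rewrite -[RHS](IH _ w)//; last by apply: (measurableT_comp mF); exact: measurable_consp2.
  apply: eq_integral => y _; congr F.
  rewrite rowt_consp vE (_ : _ + _ = row_mx (x + a)%:M (rowt y + w) :> 'rV_(1 + n)).
    by rewrite tupr_row_mx mul1r.
  by rewrite [LHS](@add_row_mx R 1 1 n) raddfD.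
rewrite (integral_lebesgue_affine (F := fun x => \int[mu n]_y F (consp (x, y)))%E)//.
- by rewrite normr1 invr1 mul1e -integral_cons1.
- exact: measurable_integral_tail.
- by move=> x; apply: integral_ge0.
Qed.

Definition change_of_var n (M : 'M[R]_n) := forall F : n.-tuple T -> \bar R,
  measurable_fun setT F -> (forall t, (0 <= F t)%E) ->
  (\int[mu n]_t F (tupr (rowt t *m M)) = (`|\det M|^-1)%:E * \int[mu n]_t F t)%E.

Lemma change_of_varM n (M N : 'M[R]_n) :
  change_of_var M -> change_of_var N -> change_of_var (M *m N).
Proof.
move=> PM PN F mF F0.
pose G t := F (tupr (rowt t *m N)).
rewrite (_ : (fun t => F _) = (fun t => G (tupr (rowt t *m M)))); last first.
  by apply/funext => t; rewrite /G tuprK mulmxA.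
rewrite PM; last 2 first.
- by rewrite /G; apply: (measurableT_comp mF); exact: measurable_row_mul.
- by move=> t; exact: F0.
by rewrite PN// det_mulmx normrM invfM muleA EFinM.
Qed.

(** The matrix rescales the first coordinate, and acts on the remaining ones by D
followed by a translation; Fubini in this order gives the factor. *)
Lemma change_of_var_ublock n (a : R) (b : 'rV[R]_n) (D : 'M[R]_n) : a != 0 ->
  change_of_var D -> change_of_var (block_mx a%:M b 0 D : 'M[R]_(1 + n)).
Proof.
move=> a0 PD F mF F0.
rewrite integral_cons1//; last by apply: (measurableT_comp mF); exact: measurable_row_mul.
transitivity (\int[leb]_x ((`|\det D|^-1)%:E *
    \int[mu n]_y F (consp ((a * x + 0)%R : T, y))))%E.
  apply: eq_integral => x _.
  have mG : measurable_fun setT (fun y : n.-tuple T => F (consp ((a * x + 0)%R : T, y))).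
    by apply: (measurableT_comp mF); exact: measurable_consp2.
  rewrite -(integral_shift (x *: b) mG)//.
  rewrite -PD//; last by apply: (measurableT_comp mG); exact: measurable_row_shift.
  apply: eq_integral => y _; congr F.
  rewrite rowt_consp [X in tupr X](@mul_row_block R 1 1 n 1 n).
  rewrite mulmx0 addr0 [X in row_mx X _](_ : _ = (a * x)%:M).
    by rewrite tupr_row_mx tuprK mul_scalar_mx addrC addr0.
  by rewrite -scalar_mxM mulrC.
rewrite ge0_integralZl//; last 2 first.
- apply: (measurableT_comp (measurable_integral_tail mF F0)).
  apply: continuous_measurable_fun => x.
  by apply: cvgD; [apply: cvgM; [exact: cvg_cst|exact: cvg_id]|exact: cvg_cst].
- by move=> x _; apply: integral_ge0.
rewrite (integral_lebesgue_affine (F := fun x => \int[mu n]_y F (consp (x, y)))%E)//; last 2 first.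
- exact: measurable_integral_tail.
- by move=> x; apply: integral_ge0.
rewrite -integral_cons1// muleA -EFinM -invfM -normrM.
by rewrite (@det_ublock R 1 n) det_scalar1 mulrC.
Qed.

(** As in [change_of_var_ublock], with the order of integration exchanged. *)
Lemma change_of_var_lblock n (a : R) (c : 'cV[R]_n) (D : 'M[R]_n) : a != 0 ->
  change_of_var D -> change_of_var (block_mx a%:M 0 c D : 'M[R]_(1 + n)).
Proof.
move=> a0 PD F mF F0.
rewrite integral_cons2//; last by apply: (measurableT_comp mF); exact: measurable_row_mul.
transitivity (\int[mu n]_y ((`|a|^-1)%:E *
    \int[leb]_x F (consp (x, tupr (rowt y *m D)))))%E.
  apply: eq_integral => y _.
  have mG : measurable_fun setT (fun x : T => F (consp (x, tupr (rowt y *m D)))).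
    by apply: (measurableT_comp mF); exact: measurable_consp1.
  rewrite -(integral_lebesgue_affine ((rowt y *m c) 0 0) a0 mG)//.
  apply: eq_integral => x _; congr F.
  rewrite rowt_consp [X in tupr X](@mul_row_block R 1 1 n 1 n).
  rewrite mulmx0 add0r [X in row_mx X _](_ : _ = (a * x + (rowt y *m c) 0 0)%:M).
    by rewrite tupr_row_mx.
  by rewrite raddfD /= -mx11_scalar -scalar_mxM mulrC.
have mH : measurable_fun setT (fun y : n.-tuple T => \int[leb]_x F (consp (x, y)))%E.
  exact: measurable_integral_head.
have H0 (y : n.-tuple T) : (0 <= \int[leb]_x F (consp (x, y)))%E by apply: integral_ge0.
rewrite ge0_integralZl//; last first.
  by apply: (measurableT_comp mH); exact: measurable_row_mul.
rewrite (PD (fun y => \int[leb]_x F (consp (x, y)))%E)//.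
rewrite -integral_cons2// muleA -EFinM -invfM -normrM.
by rewrite (@det_lblock R 1 n) det_scalar1.
Qed.

(** Gaussian elimination: if the top left entry is nonzero, the matrix is the
product of a lower and of an upper block triangular matrix; otherwise adding a
suitable row to the first one makes it nonzero. *)
Lemma change_of_var_unit n (M : 'M[R]_n) : M \in unitmx -> change_of_var M.
Proof.
elim: n M => [|n IH] M Mu.
  move=> F mF F0; rewrite det_mx00 normr1 invr1 mul1e.
  by apply: eq_integral => t _; rewrite (tuple0 t) (tuple0 (tupr _)).
have nz (N : 'M[R]_(1 + n)) : N \in unitmx -> ulsubmx N 0 0 != 0 -> change_of_var N.
  move=> Nu; set a := ulsubmx N 0 0 => a0.
  pose b := ursubmx N; pose c := a^-1 *: dlsubmx N; pose D := drsubmx N - c *m b.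
  have NE : N = block_mx 1%:M 0 c 1%:M *m block_mx a%:M b 0 D.
    rewrite (@mulmx_block R 1 n 1 n 1 n) !mul0mx !mulmx0 !mul1mx !addr0 /D addrC subrK.
    rewrite -[LHS]submxK; congr block_mx; first by rewrite [LHS]mx11_scalar.
    by rewrite mul_mx_scalar /c scalerA mulfV// scale1r.
  have Du : D \in unitmx.
    move: Nu; rewrite unitmxE NE det_mulmx (@det_ublock R 1) unitrM => /andP[_].
    by rewrite unitrM => /andP[_].
  rewrite NE; apply: change_of_varM.
    apply: (change_of_var_lblock (a := 1)); first exact: oner_neq0.
    by apply: IH; exact: unitmx1.
  by apply: change_of_var_ublock => //; exact: IH.
move: Mu; rewrite -[n.+1]/(1 + n)%N in M * => Mu.
have [M0|] := eqVneq (ulsubmx M 0 0) 0; last exact: nz.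
have [i Mi] : exists i, dlsubmx M i 0 != 0.
  apply/existsP; apply: contraTT Mu; rewrite negb_exists => /forallP Mi.
  rewrite unitmxE -[M]submxK (_ : dlsubmx M = 0).
    by rewrite (@det_ublock R 1) det_mx11 M0 mul0r unitr0.
  by apply/colP => j; rewrite [RHS]mxE; apply/eqP; move: (Mi j); rewrite negbK.
(* M i 0 is nonzero for some i > 0: add the row i to the first one. *)
pose S (s : R) : 'M[R]_(1 + n) := block_mx 1%:M (s *: delta_mx 0 i) 0 1%:M.
have SK : S (-1) *m S 1 = 1%:M.
  rewrite /S (@mulmx_block R 1 n 1 n 1 n) !mul0mx !mulmx0 !mul1mx !mulmx1 !addr0 add0r.
  by rewrite -scalerDl subrr scale0r -scalar_mx_block.
have S1u : S 1 \in unitmx by case: (mulmx1_unit SK).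
rewrite -(mul1mx M) -SK -mulmxA; apply: change_of_varM.
  apply: (change_of_var_ublock (a := 1)); first exact: oner_neq0.
  by apply: IH; exact: unitmx1.
apply: nz; first by rewrite unitmx_mul S1u.
rewrite -[M]submxK /S (@mulmx_block R 1 n 1 n 1 n) block_mxKul mul1mx mxE M0 add0r.
by rewrite scale1r -rowE mxE.
Qed.

End tuples.

(** * Euclidean geometry of row vectors *)

Section vectors.
Context (R : realType).
Implicit Types (n : nat).

Lemma mx_coord_le m n (x : 'M[R]_(m, n)) i j : `|x i j| <= `|x|.
Proof.
rewrite [leRHS]/Num.norm /= mx_normrE; apply/bigmax_geP; right.
by exists (i, j).
Qed.

Lemma mx_norm_leP m n (x : 'M[R]_(m, n)) (r : R) : 0 <= r ->
  (forall i j, `|x i j| <= r) -> `|x| <= r.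
Proof.
move=> r0 xr; rewrite [leLHS]/Num.norm /= mx_normrE; apply/bigmax_leP; split => // -[i j].
Qed.

Lemma lipschitz_continuous (V W : normedModType R) (f : V -> W) (C : R) :
  (forall x y, `|f x - f y| <= C * `|x - y|) -> continuous f.
Proof.
move=> fC x; apply/cvgrPdist_le => /= e e0.
have C0 : 0 < `|C| + 1 by rewrite ltr_wpDl.
near=> y.
apply: (le_trans (fC x y)).
apply: (@le_trans _ _ ((`|C| + 1) * `|x - y|)).
  by rewrite ler_wpM2r// (le_trans (ler_norm _))// lerDl.
rewrite -ler_pdivlMl//; near: y.
apply: (@cvgr_dist_le _ _ _ _ _ id x); first exact: cvg_id.
by rewrite mulr_gt0// invr_gt0.
Unshelve. all: by end_near. Qed.

Lemma continuous_bigsum (V : topologicalType) (I : Type) (s : seq I) (f : I -> V -> R) :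
  (forall i, continuous (f i)) -> continuous (fun x => \sum_(i <- s) f i x).
Proof.
move=> cf x; elim: s => [|i s IH].
  rewrite (_ : (fun _ => _) = (fun=> 0)); first exact: cvg_cst.
  by apply/funext => y; rewrite big_nil.
rewrite (_ : (fun _ => _) = (fun x => f i x + \sum_(j <- s) f j x)).
  by apply: cvgD => //; exact: cf.
by apply/funext => y; rewrite big_cons.
Qed.

Lemma dotrE n (x y : 'rV[R]_n) : dotr x y = \sum_i x 0 i * y 0 i.
Proof. by rewrite /dotr mxE; apply: eq_bigr => i _; rewrite mxE. Qed.

Lemma dotrC n (x y : 'rV[R]_n) : dotr x y = dotr y x.
Proof. by rewrite !dotrE; apply: eq_bigr => i _; rewrite mulrC. Qed.

Lemma dotrDl n (x y z : 'rV[R]_n) : dotr (x + y) z = dotr x z + dotr y z.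
Proof. by rewrite /dotr mulmxDl mxE. Qed.

Lemma dotrDr n (x y z : 'rV[R]_n) : dotr x (y + z) = dotr x y + dotr x z.
Proof. by rewrite dotrC dotrDl !(dotrC x). Qed.

Lemma dotrZl n a (x z : 'rV[R]_n) : dotr (a *: x) z = a * dotr x z.
Proof. by rewrite /dotr -scalemxAl mxE. Qed.

Lemma dotrZr n a (x z : 'rV[R]_n) : dotr x (a *: z) = a * dotr x z.
Proof. by rewrite dotrC dotrZl dotrC. Qed.

Lemma dotrNl n (x z : 'rV[R]_n) : dotr (- x) z = - dotr x z.
Proof. by rewrite -scaleN1r dotrZl mulN1r. Qed.

Lemma dotrNr n (x z : 'rV[R]_n) : dotr x (- z) = - dotr x z.
Proof. by rewrite dotrC dotrNl dotrC. Qed.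

Lemma dotrBl n (x y z : 'rV[R]_n) : dotr (x - y) z = dotr x z - dotr y z.
Proof. by rewrite dotrDl dotrNl. Qed.

Lemma dotrBr n (x y z : 'rV[R]_n) : dotr x (y - z) = dotr x y - dotr x z.
Proof. by rewrite dotrDr dotrNr. Qed.

Lemma dotr0l n (z : 'rV[R]_n) : dotr 0 z = 0.
Proof. by rewrite /dotr mul0mx mxE. Qed.

Lemma dotr0r n (z : 'rV[R]_n) : dotr z 0 = 0.
Proof. by rewrite dotrC dotr0l. Qed.

Lemma dotr_mull m n (x : 'rV[R]_m) (M : 'M[R]_(m, n)) y : dotr (x *m M) y = dotr x (y *m M^T).
Proof. by rewrite /dotr trmx_mul trmxK mulmxA. Qed.

Lemma dotr_ge0 n (x : 'rV[R]_n) : 0 <= dotr x x.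
Proof. by rewrite dotrE; apply: sumr_ge0 => i _; rewrite -expr2 sqr_ge0. Qed.

Lemma dotr_eq0 n (x : 'rV[R]_n) : dotr x x = 0 -> x = 0.
Proof.
rewrite dotrE => /psumr_eq0P x0; apply/rowP => i; rewrite mxE.
have /(_ (fun j _ => _))/(_ i isT)/eqP := x0.
by rewrite mulf_eq0 orbb => /(_ (fun j => ltac:(by rewrite -expr2 sqr_ge0)))/eqP.
Qed.

Lemma dotr_gt0 n (x : 'rV[R]_n) : x != 0 -> 0 < dotr x x.
Proof.
by move=> x0; rewrite lt_neqAle dotr_ge0 andbT eq_sym; apply: contra x0 => /eqP/dotr_eq0 ->.
Qed.

(** The Euclidean norm; the norm of the library on matrices is the maximum of the
absolute values of the entries. *)
Definition nrm n (x : 'rV[R]_n) : R := Num.sqrt (dotr x x).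

Lemma nrm_ge0 n (x : 'rV[R]_n) : 0 <= nrm x.
Proof. exact: sqrtr_ge0. Qed.

Lemma sqr_nrm n (x : 'rV[R]_n) : nrm x ^+ 2 = dotr x x.
Proof. by rewrite sqr_sqrtr// dotr_ge0. Qed.

Lemma nrm_le n (x : 'rV[R]_n) r : 0 <= r -> (nrm x <= r) = (dotr x x <= r ^+ 2).
Proof. by move=> r0; rewrite -sqr_nrm ler_sqr// nnegrE nrm_ge0. Qed.

Lemma nrmZ n a (x : 'rV[R]_n) : nrm (a *: x) = `|a| * nrm x.
Proof.
by rewrite /nrm dotrZl dotrZr mulrA -expr2 sqrtrM ?sqr_ge0// sqrtr_sqr.
Qed.

Lemma nrm0 n : nrm (0 : 'rV[R]_n) = 0.
Proof. by rewrite /nrm dotr0l sqrtr0. Qed.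

Lemma nrm_gt0 n (x : 'rV[R]_n) : x != 0 -> 0 < nrm x.
Proof. by move=> x0; rewrite sqrtr_gt0 dotr_gt0. Qed.

Lemma dotr_le_nrm n (x y : 'rV[R]_n) : `|dotr x y| <= nrm x * nrm y.
Proof.
have [->|x0] := eqVneq x 0; first by rewrite dotr0l normr0 mulr_ge0 ?nrm_ge0.
rewrite -ler_sqr ?nnegrE ?mulr_ge0 ?nrm_ge0//.
rewrite exprMn !sqr_nrm real_normK ?num_real//.
have := dotr_ge0 (dotr x x *: y - dotr x y *: x).
rewrite dotrBl !dotrBr !dotrZl !dotrZr (dotrC y x).
rewrite (_ : _ - _ = dotr x x * (dotr x x * dotr y y - dotr x y ^+ 2)); last by ring.
by rewrite pmulr_rge0 ?dotr_gt0// subr_ge0.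
Qed.

Lemma nrmN n (x : 'rV[R]_n) : nrm (- x) = nrm x.
Proof. by rewrite -scaleN1r nrmZ normrN1 mul1r. Qed.

Lemma nrmD n (x y : 'rV[R]_n) : nrm (x + y) <= nrm x + nrm y.
Proof.
rewrite nrm_le ?addr_ge0 ?nrm_ge0// sqrrD !sqr_nrm dotrDl !dotrDr (dotrC y x).
have := le_trans (ler_norm _) (dotr_le_nrm x y).
by move=> h; lra.
Qed.

Lemma nrmB n (x y : 'rV[R]_n) : nrm (x - y) <= nrm x + nrm y.
Proof. by rewrite -(nrmN y) nrmD. Qed.

Lemma coord_le_nrm n (x : 'rV[R]_n) i : `|x 0 i| <= nrm x.
Proof.
rewrite -ler_sqr ?nnegrE ?nrm_ge0// sqr_nrm real_normK ?num_real//.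
rewrite dotrE (bigD1 i)//= -expr2 lerDl.
by apply: sumr_ge0 => j _; rewrite -expr2 sqr_ge0.
Qed.

Lemma mxnorm_le_nrm n (x : 'rV[R]_n) : `|x| <= nrm x.
Proof.
by apply: mx_norm_leP; [exact: nrm_ge0|move=> i j; rewrite (ord1 i) coord_le_nrm].
Qed.

Lemma dotr_le_mxnorm n (x : 'rV[R]_n) : dotr x x <= n%:R * `|x| ^+ 2.
Proof.
rewrite dotrE mulr_natl -[X in _ *+ X](card_ord n) -sumr_const.
apply: ler_sum => i _; rewrite -expr2 -real_normK ?num_real//.
by rewrite ler_sqr ?nnegrE// mx_coord_le.
Qed.

Lemma nrm_le_mxnorm n (x : 'rV[R]_n) : nrm x <= Num.sqrt n%:R * `|x|.
Proof.
rewrite nrm_le ?mulr_ge0 ?sqrtr_ge0// exprMn sqr_sqrtr ?ler0n//.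
exact: dotr_le_mxnorm.
Qed.

Lemma continuous_dotr (V : topologicalType) n (f g : V -> 'rV[R]_n) :
  continuous f -> continuous g -> continuous (fun x => dotr (f x) (g x)).
Proof.
move=> cf cg; under eq_fun do rewrite dotrE.
apply: continuous_bigsum => i x.
apply: cvgM.
  by apply: (cvg_comp _ (fun M : 'rV[R]_n => M 0 i) (cf x)); exact: coord_continuous.
by apply: (cvg_comp _ (fun M : 'rV[R]_n => M 0 i) (cg x)); exact: coord_continuous.
Qed.

Lemma continuous_mulmx m n (M : 'M[R]_(m, n)) :
  continuous (fun x : 'rV[R]_m => x *m M).
Proof.
apply: (@lipschitz_continuous _ _ _ (m%:R * `|M|)) => x y.
rewrite -mulmxBl; set z := x - y.
apply: mx_norm_leP; first by rewrite !mulr_ge0.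
move=> i j; rewrite mxE (le_trans (ler_norm_sum _ _ _))//.
rewrite -mulrA mulr_natl -[X in _ *+ X](card_ord m) -sumr_const.
apply: ler_sum => k _; rewrite normrM mulrC ler_pM//; exact: mx_coord_le.
Qed.
End vectors.

(** * Volumes of sets of row vectors *)

Section volume.
Context (R : realType).
Local Notation T := (measurableTypeR R).
Local Notation leb := (@lebesgue_measure R).
Local Notation mu := (lebesgue_tuple R).
Implicit Types (n : nat).

Definition mset n (K : set 'rV[R]_n) := measurable [set t : n.-tuple T | K (rowt t)].
Definition lvol n (K : set 'rV[R]_n) : \bar R := mu n [set t : n.-tuple T | K (rowt t)].
Definition box n (r : R) : set 'rV[R]_n := [set x | forall i, `|x 0 i| <= r].

Lemma volE n (K : set 'rV[R]_n) : vol K = fine (lvol K).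
Proof. by []. Qed.

Lemma measurable_boxes n (A : 'I_n -> set T) : (forall i, measurable (A i)) ->
  measurable [set t : n.-tuple T | forall i, A i (tnth t i)].
Proof.
move=> mA; pose C i : set (n.-tuple T) := (fun t => tnth t i) @^-1` A i.
rewrite (_ : mkset _ = \bigcap_(i in [set: 'I_n]) C i); last first.
  by apply/seteqP; split => t /= tA i; [move=> _; exact: tA|exact: (tA i)].
apply: fin_bigcap_measurable => [|i _]; first exact: finite_finset.
by rewrite /C -[X in measurable X]setTI; exact: measurable_tnth.
Qed.

(** An open set is a countable union of cubes with rational centers. *)
Lemma mset_open n (U : set 'rV[R]_n) : open U -> mset U.
Proof.
move=> oU.
pose B (p : n.-tuple rat * nat) : set (n.-tuple T) :=
  [set t | forall i, (`]ratr (tnth p.1 i) - p.2.+1%:R^-1,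
                       ratr (tnth p.1 i) + p.2.+1%:R^-1[%classic : set T) (tnth t i)].
pose F p := if `[< B p `<=` [set t | U (rowt t)] >] then B p else set0.
rewrite /mset (_ : mkset _ = \bigcup_p F p); last first.
  apply/seteqP; split => t /=; last first.
    by move=> [p _]; rewrite /F; case: asboolP => // h Bt; exact: h.
  move=> Ut; have /nbhs_ballP[e /= e0 eU] : nbhs (rowt t) U by apply: open_nbhs_nbhs.
  have [k _ ke] : exists2 k : nat, True & k.+1%:R^-1 < e / 2.
    have [k ke] := @ltr_add_invr R 0 (e / 2) (divr_gt0 e0 (ltr0n _ 2)).
    by exists k => //; rewrite add0r in ke.
  have k0 : 0 < k.+1%:R^-1 :> R by rewrite invr_gt0.
  have q_ i : exists q : rat, ratr q \in `]tnth t i - k.+1%:R^-1, tnth t i + k.+1%:R^-1[.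
    by apply: rat_in_itvoo; rewrite ltrBlDr -addrA ltrDl addr_gt0.
  have [q Hq] := choice q_.
  exists ([tuple q i | i < n], k) => //; rewrite /F asboolT.
    by move=> i /=; have := Hq i; rewrite tnth_mktuple !in_itv/= -!ltr_distl distrC.
  move=> s Bs /=; apply: eU; split => // i j; rewrite !mxE /ball/=.
  have := Bs j; have := Hq j; rewrite /= tnth_mktuple !in_itv/= -!ltr_distl => h1 h2.
  rewrite (le_lt_trans (ler_distD (ratr (q j)) _ _))// [e]splitr ltrD//.
    by rewrite distrC (lt_trans h1).
  by rewrite distrC (lt_trans h2).
apply: countable_bigcupT_measurable; first exact: countableP.
move=> p; rewrite /F; case: asboolP => // _.
by apply: (@measurable_boxes n (fun i => `]ratr (tnth p.1 i) - p.2.+1%:R^-1,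
  ratr (tnth p.1 i) + p.2.+1%:R^-1[%classic)) => i; exact: measurable_itv.
Qed.

Lemma mset_closed n (K : set 'rV[R]_n) : closed K -> mset K.
Proof.
move=> /closed_openC/mset_open/measurableC.
rewrite /mset (_ : ~` _ = [set t | K (rowt t)])//.
by apply/seteqP; split => t /=; [move/contrapT|move=> ?; apply].
Qed.

Lemma mset_compact n (K : set 'rV[R]_n) : compact K -> mset K.
Proof. by move=> cK; apply: mset_closed; apply: compact_closed => //; exact: norm_hausdorff. Qed.

Lemma measurable_continuous n (f : 'rV[R]_n -> R) : continuous f ->
  measurable_fun setT (fun t : n.-tuple T => f (rowt t)).
Proof.
move=> cf; apply: (measurability _ (measurable_realfun.RGenOpens.measurableE R)).
move=> _ [_ [a [b ->] <-]]; rewrite setTI.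
apply: (@mset_open n (f @^-1` `]a, b[%classic)).
by move/continuousP : cf; apply; exact: interval_open.
Qed.

Lemma lvol_ge0 n (K : set 'rV[R]_n) : (0 <= lvol K)%E.
Proof. exact: measure_ge0. Qed.

Lemma le_lvol n (K L : set 'rV[R]_n) : mset K -> mset L -> K `<=` L ->
  (lvol K <= lvol L)%E.
Proof. by move=> mK mL KL; apply: le_measure; rewrite ?inE// => t /=; exact: KL. Qed.

Lemma boxE n (r : R) : [set t : n.-tuple T | box r (rowt t)] =
  [set t | forall i, (`[- r, r]%classic : set T) (tnth t i)].
Proof.
by apply/seteqP; split => t /= h i; have := h i; rewrite /= ?mxE in_itv/= ler_norml.
Qed.

Lemma mset_box n r : mset (@box n r).
Proof. by rewrite /mset boxE; apply: (@measurable_boxes n (fun=> `[- r, r]%classic)) => i; exact: measurable_itv. Qed.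

Lemma lvol_box n r : 0 <= r -> lvol (@box n r) = ((r + r) ^+ n)%:E.
Proof.
move=> r0; rewrite /lvol boxE (@lebesgue_tuple_box R n (fun=> `[- r, r]%classic)); last by move=> i; exact: measurable_itv.
rewrite (eq_bigr (fun=> (r + r)%:E)).
  by rewrite prodEFin prodr_const card_ord.
move=> i _; rewrite lebesgue_measure_itv/= lte_fin.
case: ifPn => [_|]; first by rewrite opprK EFinD.
by rewrite -leNgt => h; congr EFin; lra.
Qed.

Lemma bounded_box n (K : set 'rV[R]_n) : bounded_set K -> exists2 r, 0 <= r & K `<=` box r.
Proof.
move=> [M [_ /(_ (M + 1))]]; rewrite ltrDl ltr01 => /(_ isT) KM; exists `|M + 1| => // x Kx i.
by rewrite (le_trans (mx_coord_le _ _ _))// (le_trans (KM _ Kx))// ler_norm.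
Qed.

Lemma compact_box n (K : set 'rV[R]_n) : compact K -> exists2 r, 0 <= r & K `<=` box r.
Proof. by move/compact_bounded/bounded_box. Qed.

Lemma lvol_box_fin n (K : set 'rV[R]_n) r : mset K -> 0 <= r -> K `<=` box r ->
  lvol K \is a fin_num.
Proof.
move=> mK r0 Kr; rewrite ge0_fin_numE ?lvol_ge0//.
by rewrite (le_lt_trans (le_lvol mK (mset_box r) Kr))// lvol_box// ltry.
Qed.

Lemma lvol_fin n (K : set 'rV[R]_n) : compact K -> lvol K \is a fin_num.
Proof.
by move=> cK; have [r r0 Kr] := compact_box cK; exact: lvol_box_fin (mset_compact cK) r0 Kr.
Qed.

Lemma integral_set n (K : set 'rV[R]_n) : mset K ->
  (\int[mu n]_t (\1_K (rowt t))%:E = lvol K)%E.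
Proof.
by move=> mK; rewrite /lvol -[X in mu n X]setIT -integral_indic.
Qed.

Lemma measurable_set_indic n (K : set 'rV[R]_n) : mset K ->
  measurable_fun setT (fun t : n.-tuple T => (\1_K (rowt t))%:E : \bar R).
Proof.
move=> mK; apply/measurable_EFinP.
exact: (@measurable_indic _ _ _ setT [set t | K (rowt t)]).
Qed.

Lemma mset_preim m n (M : 'M[R]_(m, n)) v (K : set 'rV[R]_n) : mset K ->
  mset [set x | K (x *m M + v)].
Proof.
move=> mK; have := measurable_row_affine M v measurableT mK; rewrite setTI.
by congr measurable; apply/seteqP; split => t /=; rewrite tuprK.
Qed.

Lemma lvol_preim_unit n (M : 'M[R]_n) (K : set 'rV[R]_n) : mset K -> M \in unitmx ->
  (lvol [set x | K (x *m M)%R] = (`|\det M|^-1)%:E * lvol K)%E.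
Proof.
move=> mK Mu; rewrite -(integral_set mK).
rewrite -(change_of_var_unit Mu (measurable_set_indic mK)); last first.
  by move=> t; rewrite lee_fin.
rewrite -integral_set; first by apply: eq_integral => t _; rewrite tuprK.
have := mset_preim M 0 mK; congr mset.
by apply/seteqP; split => x /=; rewrite addr0.
Qed.

Lemma lvol_preim_shift n v (K : set 'rV[R]_n) : mset K ->
  lvol [set x | K (x + v)] = lvol K.
Proof.
move=> mK; rewrite -(integral_set mK).
rewrite -(integral_shift v (measurable_set_indic mK)); last first.
  by move=> t; rewrite lee_fin.
rewrite -integral_set; first by apply: eq_integral => t _; rewrite tuprK.
have := mset_preim 1%:M v mK; congr mset.
by apply/seteqP; split => x /=; rewrite mulmx1.
Qed.

Lemma image_mulmx n (M : 'M[R]_n) (K : set 'rV[R]_n) : M \in unitmx ->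
  [set x *m M | x in K] = [set x | K (x *m invmx M)].
Proof.
move=> Mu; apply/seteqP; split => x /=.
  by move=> [y Ky <-]; rewrite mulmxK.
by move=> Kx; exists (x *m invmx M) => //; rewrite mulmxKV.
Qed.

Lemma lvol_image n (M : 'M[R]_n) (K : set 'rV[R]_n) : mset K -> M \in unitmx ->
  (lvol [set x *m M | x in K] = `|\det M|%:E * lvol K)%E.
Proof.
move=> mK Mu; rewrite image_mulmx// lvol_preim_unit ?unitmx_inv//.
by rewrite det_inv normfV invrK.
Qed.

Lemma lvol_scale n (r : R) (K : set 'rV[R]_n) : mset K -> 0 < r ->
  (lvol [set r *: x | x in K] = (r ^+ n)%:E * lvol K)%E.
Proof.
move=> mK r0; rewrite (_ : [set _ | _ in _] = [set x *m r%:M | x in K]); last first.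
  by congr image; apply/funext => x; rewrite mul_mx_scalar.
rewrite lvol_image// ?det_scalar ?ger0_norm ?exprn_ge0 ?ltW//.
by rewrite unitmxE det_scalar unitrX// unitfE gt_eqF.
Qed.

Lemma lvol_gt0 n (K : set 'rV[R]_n) : mset K -> K° !=set0 -> (0 < lvol K)%E.
Proof.
move=> mK [x /nbhs_ballP[e /= e0 eK]].
pose B := [set y : 'rV[R]_n | box (e / 2) (y - x)].
have mB : mset B.
  have := mset_preim 1%:M (- x) (@mset_box n (e / 2)); congr mset.
  by apply/seteqP; split => y /=; rewrite mulmx1.
apply: (@lt_le_trans _ _ (lvol B)).
  rewrite /B (lvol_preim_shift (- x) (@mset_box n (e / 2))) lvol_box ?lte_fin ?exprn_gt0//; lra.
apply: le_lvol => // y By; apply: eK; split => // i j; rewrite (ord1 i).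
have := By j; rewrite !mxE /ball/= distrC; lra.
Qed.

Lemma vol_gt0 n (K : set 'rV[R]_n) : compact K -> K° !=set0 -> 0 < vol K.
Proof.
by move=> cK K0; rewrite -lte_fin volE fineK ?lvol_fin// lvol_gt0//; exact: mset_compact.
Qed.

End volume.

(** * Averages over sign vectors *)

Section signs.
Context (R : realType).
Implicit Types (n : nat).

(** A vector given by its first coordinate and by the other ones, to match the
recursive structure of [lebesgue_tuple]. *)
Definition row1 n (a : R) (x : 'rV[R]_n) : 'rV[R]_n.+1 := (row_mx a%:M x : 'rV_(1 + n)).

Lemma row1P n (x : 'rV[R]_n.+1) : exists a y, x = row1 a y.
Proof.
exists (lsubmx (x : 'rV_(1 + n)) 0 0), (rsubmx (x : 'rV_(1 + n))).
by rewrite /row1 -mx11_scalar (@hsubmxK R 1 1 n x).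
Qed.

Lemma row1_0 n a (x : 'rV[R]_n) : row1 a x 0 ord0 = a.
Proof.
rewrite /row1 (_ : ord0 = lshift n (0 : 'I_1)); last exact/val_inj.
by rewrite (@row_mxEl R 1 1 n) mxE mulr1n.
Qed.

Lemma row1_lift n a (x : 'rV[R]_n) i : row1 a x 0 (lift ord0 i) = x 0 i.
Proof.
rewrite /row1 (_ : lift ord0 i = rshift 1 i); last exact/val_inj.
by rewrite (@row_mxEr R 1 1 n).
Qed.

Lemma dotr_row1 n a b (x y : 'rV[R]_n) : dotr (row1 a x) (row1 b y) = a * b + dotr x y.
Proof.
rewrite !dotrE big_ord_recl !row1_0; congr (_ + _).
by apply: eq_bigr => i _; rewrite !row1_lift.
Qed.

Fixpoint signs n : seq 'rV[R]_n :=
  if n is m.+1 then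
    [seq row1 1 e | e <- signs m] ++ [seq row1 (- 1) e | e <- signs m]
  else [:: 0].

Lemma signs_coord n (e : 'rV[R]_n) : e \in signs n -> forall i, `|e 0 i| = 1.
Proof.
elim: n e => [|n IH] e; first by move=> _ [].
rewrite mem_cat => /orP[] /mapP[x /IH h ->] i;
  by case: (unliftP ord0 i) => [j|] ->; rewrite ?row1_lift ?row1_0 ?normrN ?normr1 ?h.
Qed.

Lemma signs_nrm n (e : 'rV[R]_n) : e \in signs n -> nrm e = Num.sqrt n%:R.
Proof.
move=> /signs_coord e1; rewrite /nrm dotrE (eq_bigr (fun=> 1)).
  by rewrite sumr_const card_ord.
by move=> i _; rewrite -expr2 -real_normK ?num_real// e1 expr1n.
Qed.

Lemma sphere_sign n (e : 'rV[R]_n) : (0 < n)%N -> e \in signs n ->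
  sphere ((Num.sqrt n%:R)^-1 *: e).
Proof.
move=> n0 /signs_nrm he; have q0 : 0 < Num.sqrt n%:R :> R by rewrite sqrtr_gt0 ltr0n.
rewrite /sphere/= -sqr_nrm nrmZ he ger0_norm ?invr_ge0 ?(ltW q0)//.
by rewrite mulVf ?expr1n// gt_eqF.
Qed.

(** The expectation over a uniformly random sign vector. *)
Definition Es n (F : 'rV[R]_n -> R) : R := 2 ^- n * \sum_(e <- signs n) F e.

Lemma EsS n (F : 'rV[R]_n.+1 -> R) :
  Es F = (Es (F \o row1 1) + Es (F \o row1 (-1))) / 2.
Proof.
rewrite /Es /= big_cat !big_map /= exprS invfM -mulrDr.
by rewrite -!mulrA mulrCA; congr (_ * _); rewrite mulrC.
Qed.

Lemma Es0 (F : 'rV[R]_0 -> R) : Es F = F 0.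
Proof. by rewrite /Es /= big_seq1 expr0 invr1 mul1r. Qed.

Lemma Es_le n (F G : 'rV[R]_n -> R) : (forall e, e \in signs n -> F e <= G e) -> Es F <= Es G.
Proof.
move=> FG; rewrite /Es ler_wpM2l ?invr_ge0 ?exprn_ge0//.
by rewrite big_seq [leRHS]big_seq; apply: ler_sum.
Qed.

Lemma Es_ext n (F G : 'rV[R]_n -> R) : (forall e, e \in signs n -> F e = G e) -> Es F = Es G.
Proof.
by move=> FG; apply/eqP; rewrite eq_le !Es_le// => e /FG ->.
Qed.

Lemma Es_cst n c : Es (fun _ : 'rV[R]_n => c) = c.
Proof.
elim: n c => [|n IH] c; first exact: Es0.
by rewrite EsS !IH -mulr2n -[c *+ 2]mulr_natr mulfK.
Qed.

Lemma EsD n (F G : 'rV[R]_n -> R) : Es (fun e => F e + G e) = Es F + Es G.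
Proof. by rewrite /Es big_split mulrDr. Qed.

Lemma EsZ n c (F : 'rV[R]_n -> R) : Es (fun e => c * F e) = c * Es F.
Proof. by rewrite /Es -mulr_sumr mulrCA. Qed.

Lemma EsB n (F G : 'rV[R]_n -> R) : Es (fun e => F e - G e) = Es F - Es G.
Proof.
rewrite EsD; congr (_ + _); rewrite -mulN1r -EsZ.
by apply: Es_ext => e _; rewrite mulN1r.
Qed.

Lemma Es_sum n I (s : seq I) (F : I -> 'rV[R]_n -> R) :
  Es (fun e => \sum_(i <- s) F i e) = \sum_(i <- s) Es (F i).
Proof. by rewrite /Es -mulr_sumr exchange_big. Qed.

Lemma Es_exists n (F : 'rV[R]_n -> R) q : Es F <= q -> exists2 e, e \in signs n & F e <= q.
Proof.
elim: n F => [|n IH] F; first by rewrite Es0 => h; exists 0; rewrite ?inE.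
rewrite EsS => h.
have [h1|h1] := leP (Es (F \o row1 1)) q.
  have [e es he] := IH _ h1; exists (row1 1 e) => //=.
  by rewrite mem_cat map_f.
have /IH[e es he] : Es (F \o row1 (- 1)) <= q by lra.
by exists (row1 (- 1) e) => //=; rewrite mem_cat (map_f (row1 (-1)))// orbT.
Qed.

Lemma Es_dotr n (x : 'rV[R]_n) : Es (dotr x) = 0.
Proof.
elim: n x => [|n IH] x; first by rewrite Es0 dotr0r.
have [a [y ->]] := row1P x.
rewrite EsS (_ : _ \o _ = fun e => a + dotr y e); last first.
  by apply/funext => e /=; rewrite dotr_row1 mulr1.
rewrite (_ : _ \o _ = fun e => - a + dotr y e); last first.
  by apply/funext => e /=; rewrite dotr_row1 mulrN1.
by rewrite !EsD !Es_cst IH; lra.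
Qed.

Lemma Es_dotr2 n (x : 'rV[R]_n) : Es (fun e => dotr x e ^+ 2) = dotr x x.
Proof.
elim: n x => [|n IH] x; first by rewrite Es0 (thinmx0 x) dotr0r expr0n.
have [a [y ->]] := row1P x.
rewrite EsS -EsD dotr_row1 -IH -[a * a](Es_cst n) -EsD mulrC -EsZ.
apply: Es_ext => e _ /=; rewrite !dotr_row1.
by field.
Qed.

(** The fourth moment in the Khinchine inequality: it makes it impossible for
<x, e> to be small for most e. *)
Lemma Es_dotr4 n (x : 'rV[R]_n) : Es (fun e => dotr x e ^+ 4) <= 3 * dotr x x ^+ 2.
Proof.
elim: n x => [|n IH] x.
  by rewrite Es0 (thinmx0 x) dotr0r !expr0n mulr0.
have [a [y ->]] := row1P x.
rewrite EsS -EsD (_ : (fun _ => _) =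
    (fun e => 2 * (dotr y e ^+ 4 + 6 * a ^+ 2 * dotr y e ^+ 2 + a ^+ 4))); last first.
  by apply/funext => e /=; rewrite !dotr_row1; ring.
rewrite EsZ !EsD EsZ Es_dotr2 Es_cst dotr_row1.
have := IH y; set d := dotr y y => h.
have := sqr_ge0 (a ^+ 2).
have -> : (a ^+ 2) ^+ 2 = a ^+ 4 by ring.
have -> : (a * a + d) ^+ 2 = a ^+ 4 + 2 * a ^+ 2 * d + d ^+ 2 by ring.
lra.
Qed.

Lemma cosh_le (a : R) : `|a| <= 1 / 2 -> expR a + expR (- a) <= 2 * expR (2 * a ^+ 2).
Proof.
have up (b : R) : `|b| <= 1 / 2 -> expR b <= 1 + b + 2 * b ^+ 2.
  rewrite ler_norml => /andP[b1 b2].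
  rewrite -[b in expR b]opprK expRN invf_ple ?posrE ?expR_gt0//; last by nra.
  apply: le_trans (expR_ge1Dx _).
  rewrite -[leLHS]mul1r ler_pdivrMr; last by nra.
  have -> : (1 - b) * (1 + b + 2 * b ^+ 2) = 1 + b ^+ 2 * (1 - 2 * b) by ring.
  by rewrite lerDl mulr_ge0 ?sqr_ge0//; lra.
move=> ha; have := up _ ha; have := up (- a); rewrite normrN sqrrN => /(_ ha).
have := expR_ge1Dx (2 * a ^+ 2); lra.
Qed.

(** Independence of the coordinates reduces the exponential moment to [cosh_le]. *)
Lemma Es_expR n (x : 'rV[R]_n) : (forall i, `|x 0 i| <= 1 / 2) ->
  Es (fun e => expR (dotr x e)) <= expR (2 * dotr x x).
Proof.
elim: n x => [|n IH] x.
  by rewrite Es0 (thinmx0 x) dotr0r mulr0.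
have [a [y ->]] := row1P x => ha.
have ha0 : `|a| <= 1 / 2 by have := ha ord0; rewrite row1_0.
have hy i : `|y 0 i| <= 1 / 2 by have := ha (lift ord0 i); rewrite row1_lift.
rewrite EsS -EsD (_ : (fun _ => _) =
    (fun e => (expR a + expR (- a)) * expR (dotr y e))); last first.
  by apply/funext => e /=; rewrite !dotr_row1 mulr1 mulrN1 !expRD mulrDl.
rewrite EsZ dotr_row1 mulrDr expRD.
rewrite -expr2 ler_pdivrMr// [leRHS]mulrAC [X in _ <= X * _]mulrC.
rewrite ler_pM ?addr_ge0 ?expR_ge0 ?cosh_le ?IH//.
by rewrite -(Es_cst n 0); apply: Es_le => e _; exact: expR_ge0.
Qed.

(** The method of conditional expectations: the vectors are chosen one at a time,
each at a point where the current weighted sum is at most its average.  This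
replaces a union bound for N independent random sign vectors, without any
product probability space. *)
Lemma greedy n I (Z : seq I) (w : I -> R) (g : I -> 'rV[R]_n -> R) (q : R) :
  (forall z, 0 <= w z) -> (forall z e, 0 <= g z e) -> (forall z, Es (g z) <= q) -> 0 <= q ->
  forall N, exists E : seq 'rV[R]_n, [/\ size E = N, {subset E <= signs n} &
    \sum_(z <- Z) w z * \prod_(e <- E) g z e <= q ^+ N * \sum_(z <- Z) w z].
Proof.
move=> w0 g0 gq q0; elim=> [|N [E [sE Es_ IH]]].
  exists [::]; split => //; rewrite expr0 mul1r.
  by apply: ler_sum => z _; rewrite big_nil mulr1.
pose w' z := w z * \prod_(e <- E) g z e.
have w'0 z : 0 <= w' z by rewrite mulr_ge0// prodr_ge0.
have : Es (fun e => \sum_(z <- Z) w' z * g z e) <= q * \sum_(z <- Z) w' z.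
  rewrite Es_sum mulr_sumr; apply: ler_sum => z _.
  by rewrite EsZ mulrC ler_wpM2r.
move=> /Es_exists[e es he]; exists (e :: E); split => /=; first by rewrite sE.
  by move=> x; rewrite inE => /predU1P[->//|/Es_].
rewrite (eq_bigr (fun z => w' z * g z e)); last first.
  by move=> z _; rewrite big_cons mulrA /w' mulrAC.
by rewrite (le_trans he)// exprS -mulrA ler_wpM2l.
Qed.

End signs.

(** * Counting cells *)

Section counting.
Context (R : realType).

Lemma sum_half m : \sum_(k < m) (2 ^- k : R) <= 2.
Proof.
suff -> : \sum_(k < m) (2 ^- k : R) = 2 - 2 * 2 ^- m.
  by rewrite gerDl oppr_le0 mulr_ge0// invr_ge0 exprn_ge0.
elim: m => [|m IH]; first by rewrite big_ord0 expr0 invr1 mulr1 subrr.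
by rewrite big_ord_recr /= IH exprS invfM; lra.
Qed.

(** A cell gives a sign and a nonnegative integer to each index; it encodes either
a lattice point or the approximate values of finitely many linear forms. *)
Definition cells n m := {ffun 'I_n -> bool * 'I_m}.
Definition height n m (f : cells n m) := (\sum_i (f i).2)%N.

(** Give to f the weight 2^-(height f): the total weight is a product over the
indices, in which each factor is at most 4, and each f of height at most K has
a weight of at least 2^-K. *)
Lemma card_cells n m K : #|[pred f : cells n m | (height f <= K)%N]|%:R <= 2 ^+ K * 4 ^+ n :> R.
Proof.
rewrite -sum1_card natr_sum.
apply: (@le_trans _ _ (\sum_(f : cells n m) 2 ^+ K * \prod_i 2 ^- (f i).2)).
  rewrite [leRHS](bigID (fun f => (height f <= K)%N)) /=.
  rewrite ler_wpDr//.
    apply: sumr_ge0 => f _; rewrite mulr_ge0 ?exprn_ge0//.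
    by apply: prodr_ge0 => i _; rewrite invr_ge0 exprn_ge0.
  apply: ler_sum => f hf.
  under eq_bigr do rewrite -exprVn.
  rewrite prodrXr -/(height f) exprVn ler_pdivlMr ?exprn_gt0// mul1r.
  by rewrite ler_weXn2l ?ler1n.
rewrite -mulr_sumr ler_wpM2l ?exprn_ge0//.
rewrite -(bigA_distr_bigA (fun _ (p : bool * 'I_m) => 2 ^- p.2)).
rewrite -[n in leRHS]card_ord -prodr_const; apply: ler_prod => i _.
apply/andP; split; first by apply: sumr_ge0 => p _; rewrite invr_ge0 exprn_ge0.
rewrite (_ : \sum_j _ = \sum_(b : bool) \sum_(k < m) 2 ^- k).
  by rewrite big_bool /= (_ : 4 = 2 + 2 :> R) ?lerD ?sum_half// -natrD.
by rewrite pair_big; apply: eq_bigr.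
Qed.

End counting.

(** * A few sign vectors that control the Euclidean norm *)

Section kashin.
Context (R : realType).
Implicit Types (n : nat).

(** The point of the lattice d Z^n whose coordinates have the signs and the
magnitudes given by f. *)
Definition lattice n m (d : R) (f : cells n m) : 'rV[R]_n :=
  \row_i (d * ((-1) ^+ (f i).1 * (f i).2%:R)).

(** Round the coordinates towards zero.  The norm does not increase, and since
the l1 norm of x is at most sqrt n, the magnitudes sum up to at most k n: the
net obtained in this way has an exponential cardinality by [card_cells]. *)
Lemma lattice_approx n (k m : nat) (x : 'rV[R]_n) : (0 < n)%N -> (0 < k)%N ->
  (k * n < m)%N -> nrm x = 1 ->
  exists f : cells n m, let y := lattice ((k%:R * Num.sqrt n%:R)^-1) f in
    [/\ (height f <= k * n)%N, nrm (x - y) <= k%:R^-1 & nrm y <= 1].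
Proof.
move=> n0 k0 km x1; set d := _^-1.
have sn0 : 0 < Num.sqrt n%:R :> R by rewrite sqrtr_gt0 ltr0n.
have kR0 : 0 < k%:R :> R by rewrite ltr0n.
have d0 : 0 < d by rewrite invr_gt0 mulr_gt0.
pose h i := Num.trunc (`|x 0 i| / d).
have hle i : (h i)%:R <= `|x 0 i| / d by rewrite truncn_le divr_ge0// ltW.
have hgt i : `|x 0 i| / d < (h i)%:R + 1.
  by rewrite natr1; exact: truncnS_gt.
have sum_x : \sum_i `|x 0 i| <= Num.sqrt n%:R.
  have := dotr_le_nrm (\row_i `|x 0 i|) (const_mx 1 : 'rV[R]_n).
  rewrite (_ : nrm (\row_i _) = 1); last first.
    rewrite -x1 /nrm !dotrE; congr Num.sqrt; apply: eq_bigr => i _.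
    by rewrite mxE -!expr2 real_normK ?num_real.
  rewrite (_ : nrm _ = Num.sqrt n%:R); last first.
    rewrite /nrm dotrE (eq_bigr (fun=> 1)) ?sumr_const ?card_ord// => i _.
    by rewrite mxE mulr1.
  rewrite mul1r dotrE; apply: le_trans; apply: le_trans (ler_norm _).
  by rewrite le_eqVlt; apply/orP; left; apply/eqP; apply: eq_bigr => i _; rewrite !mxE mulr1.
have hsum : (\sum_i h i <= k * n)%N.
  rewrite -(ler_nat R) natr_sum.
  apply: (@le_trans _ _ (\sum_i `|x 0 i| / d)); first by apply: ler_sum.
  rewrite -mulr_suml ler_pdivrMr// /d ler_pdivlMr ?mulr_gt0//.
  rewrite mulrCA natrM; apply: ler_wpM2l; first exact: ltW.
  apply: (le_trans (ler_wpM2r (ltW sn0) sum_x)).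
  by rewrite -expr2 sqr_sqrtr.
have hm i : (h i < m)%N.
  by apply: leq_ltn_trans km; apply: leq_trans hsum; rewrite (bigD1 i)//= leq_addr.
pose f : cells n m := [ffun i => (x 0 i < 0, Ordinal (hm i))].
have yE i : lattice d f 0 i = d * ((-1) ^+ (x 0 i < 0)%R * (h i)%:R) by rewrite mxE ffunE.
have xE i : x 0 i = (-1) ^+ (x 0 i < 0)%R * `|x 0 i|.
  have [h0|h0] := ltP (x 0 i) 0.
    by rewrite expr1 mulN1r ltr0_norm// opprK.
  by rewrite expr0 mul1r ger0_norm.
have le_sq (z : 'rV[R]_n) c : 0 <= c -> (forall i, `|z 0 i| <= c) -> nrm z <= c * Num.sqrt n%:R.
  move=> c0 zc; rewrite nrm_le; last by rewrite mulr_ge0// ltW.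
  rewrite exprMn sqr_sqrtr ?ler0n// dotrE mulr_natr -[X in _ *+ X](card_ord n) -sumr_const.
  by apply: ler_sum => i _; rewrite -expr2 -real_normK ?num_real// ler_sqr ?nnegrE.
exists f => /=; split.
- by rewrite /height; under eq_bigr do rewrite ffunE.
- have -> : k%:R^-1 = d * Num.sqrt n%:R.
    by rewrite /d invfM -mulrA mulVf ?mulr1// gt_eqF.
  apply: le_sq; first exact: ltW.
  move=> i; rewrite mxE [X in _ + X]mxE yE {1}xE mulrCA -mulrBr normrMsign.
  have := hle i; have := hgt i; rewrite ltr_pdivrMr// ler_pdivlMr// => h1 h2.
  by rewrite ler_norml; apply/andP; split; lra.
- rewrite -x1 nrm_le ?nrm_ge0// sqr_nrm !dotrE; apply: ler_sum => i _.
  rewrite -!expr2 -[leLHS]real_normK ?num_real// -[leRHS]real_normK ?num_real//.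
  rewrite ler_sqr ?nnegrE// yE normrM normrMsign gtr0_norm// normr_nat.
  by have := hle i; rewrite ler_pdivlMr// mulrC.
Qed.

Lemma expR_le_inv (x : R) : x < 1 -> expR x <= (1 - x)^-1.
Proof.
move=> x1; rewrite -[x in expR x]opprK expRN lef_pV2 ?posrE ?expR_gt0 ?subr_gt0//.
exact: expR_ge1Dx.
Qed.

(** As |s| >= 3/4 s^2 - s^4/16, the second and fourth moments bound the average
of |<y, e>| from below; the exponential form is the one to be used with
[greedy]. *)
Lemma Es_expRN n (y : 'rV[R]_n) : nrm y <= 1 -> 9 / 10 <= dotr y y ->
  Es (fun e => expR (1 / 40 - `|dotr y e| / 4)) <= 24 / 25.
Proof.
rewrite nrm_le// expr1n => y1 y9.
have low u : 0 <= u -> expR (- u) <= 1 - u + u ^+ 2 :> R.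
  move=> u0; rewrite expRN invf_ple ?posrE ?expR_gt0//; last by nra.
  apply: le_trans (expR_ge1Dx _); rewrite -[leLHS]mul1r ler_pdivrMr; last by nra.
  have -> : (1 + u) * (1 - u + u ^+ 2) = 1 + u ^+ 3 by ring.
  by rewrite lerDl exprn_ge0.
have low1 s : 3 / 4 * s ^+ 2 - s ^+ 4 / 16 <= `|s| :> R.
  have key (u : R) : 0 <= u -> 3 / 4 * u ^+ 2 - (u ^+ 2) ^+ 2 / 16 <= u.
    move=> u0; rewrite -subr_ge0.
    have -> : u - (3 / 4 * u ^+ 2 - (u ^+ 2) ^+ 2 / 16) = u * ((u - 2) ^+ 2 * (u + 4)) / 16 by field.
    by rewrite divr_ge0// mulr_ge0// mulr_ge0 ?sqr_ge0//; lra.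
  by have := key `|s| (normr_ge0 s); rewrite real_normK ?num_real// -exprM.
have e40 : expR (1 / 40) <= 40 / 39 :> R.
  rewrite (_ : 40 / 39 = (1 - 1 / 40)^-1 :> R); last by field.
  by apply: expR_le_inv; lra.
have : Es (fun e => 1 - `|dotr y e| / 4 + (`|dotr y e| / 4) ^+ 2) <= 187 / 200.
  apply: (@le_trans _ _ (Es (fun e => 1 + (- (1 / 8) * dotr y e ^+ 2 + (1 / 64) * dotr y e ^+ 4)))).
    apply: Es_le => e _; rewrite exprMn real_normK ?num_real//.
    have := low1 (dotr y e); lra.
  rewrite !EsD !EsZ Es_cst Es_dotr2.
  have := Es_dotr4 y; have : dotr y y ^+ 2 <= dotr y y by rewrite expr2 ler_piMr ?dotr_ge0.
  lra.
move=> h; apply: (@le_trans _ _ (40 / 39 * (187 / 200))); last by lra.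
apply: le_trans (ler_pM _ _ e40 h); rewrite ?expR_ge0//; last first.
  by rewrite -(Es_cst n 0); apply: Es_le => e _; have := sqr_ge0 (`|dotr y e| / 4 - 1/2); lra.
rewrite -EsZ; apply: Es_le => e _; rewrite expRD ler_wpM2l ?expR_ge0//.
by apply: low; rewrite divr_ge0.
Qed.

(** The counterpart of [Es_expRN] for large values of |<y, e>|, which are
controlled by the subgaussian bound [Es_expR]. *)
Lemma Es_expR_abs n (y : 'rV[R]_n) : nrm y <= 1 ->
  Es (fun e => expR (`|dotr y e| / 2 - 3)) <= 24 / 25.
Proof.
move=> y1.
have e3 : expR (-3) <= 1 / 8 :> R.
  rewrite expRN div1r lef_pV2 ?posrE ?expR_gt0//.
  have e1 : 2 <= expR 1 :> R by apply: le_trans (expR_ge1Dx _); lra.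
  rewrite (_ : 3 = 1 + 1 + 1 :> R); last by lra.
  rewrite !expRD; set e := expR 1 in e1 *.
  have : 2 * 2 <= e * e by rewrite ler_pM.
  nra.
have e12 : expR (1 / 2) <= 2 :> R.
  have h : expR (1 / 2) <= (1 - 1 / 2)^-1 :> R by apply: expR_le_inv; lra.
  by apply: (le_trans h); rewrite (_ : 1 - 1 / 2 = 2^-1) ?invrK//; field.
have half (z : 'rV[R]_n) : nrm z <= 1 -> Es (fun e => expR (dotr z e / 2)) <= 2.
  move=> z1; rewrite (_ : (fun _ => _) = (fun e => expR (dotr (2^-1 *: z) e))); last first.
    by apply/funext => e; rewrite dotrZl mulrC.
  apply: (le_trans (Es_expR _)).
    move=> i; rewrite mxE normrM gtr0_norm ?invr_gt0// mulrC ler_pM2r ?invr_gt0//.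
    by rewrite (le_trans (coord_le_nrm _ _)).
  apply: le_trans e12; rewrite ler_expR dotrZl dotrZr.
  by move: z1; rewrite nrm_le// expr1n; lra.
have hN := half (- y); rewrite nrmN in hN; have {hN} := hN y1; have := half _ y1 => h1 h2.
apply: (@le_trans _ _ (1 / 8 * Es (fun e => expR (dotr y e / 2) + expR (dotr (- y) e / 2)))).
  rewrite -EsZ; apply: Es_le => e _; rewrite expRD mulrC ler_pM ?expR_ge0//.
  rewrite dotrNl; case: (ler0P (dotr y e)) => _.
    by rewrite lerDr expR_ge0.
  by rewrite lerDl expR_ge0.
by rewrite EsD; lra.
Qed.

(** The exponential moments [Es_expRN] and [Es_expR_abs] and the selection
[greedy] give the two bounds simultaneously at all the points of the net of
[lattice_approx].  They extend to the whole sphere because the sum is a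
seminorm: its supremum is bounded in terms of its values on the net, and then
the error of the approximation is small compared with the lower bound. *)
Lemma kashin_signs : exists2 C : nat, (0 < C)%N & forall n, (0 < n)%N ->
  exists E : seq 'rV[R]_n, [/\ size E = (C * n)%N, {subset E <= signs R n} &
    forall x, 3 / 100 * (size E)%:R * nrm x <= \sum_(e <- E) `|dotr x e| <= 7 * (size E)%:R * nrm x].
Proof.
(* The net has at most 2 * 2^(100 n) * 4^n <= 2^(104 n - 1) marked points, and
   (24/25)^25 <= 1/2; hence N = 25 * 104 n vectors suffice. *)
exists 2600%N => // n n0; set N := (2600 * n)%N.
pose m := (100 * n).+1; pose d : R := (100%:R * Num.sqrt n%:R)^-1.
pose P (f : cells n m) := (height f <= 100 * n)%N && (nrm (lattice d f) <= 1).
(* The boolean tells which of the two bounds is considered at the point; the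
   lower one is only needed at points of norm close to 1. *)
pose Q (z : bool * cells n m) := P z.2 && (z.1 || (9 / 10 <= dotr (lattice d z.2) (lattice d z.2))).
pose Z := [seq z <- enum {: bool * cells n m} | Q z].
pose g (z : bool * cells n m) (e : 'rV[R]_n) : R :=
  if ~~ Q z then 0 else
  if z.1 then expR (`|dotr (lattice d z.2) e| / 2 - 3)
  else expR (1 / 40 - `|dotr (lattice d z.2) e| / 4).
have g0 z e : 0 <= g z e by rewrite /g; do 2 case: ifP => _ //; exact: expR_ge0.
have gq z : Es (g z) <= 24 / 25.
  case Qz: (Q z); last first.
    rewrite (_ : g z = fun=> 0) ?Es_cst; last by apply/funext => e; rewrite /g Qz.
    by lra.
  case z1: z.1.
    rewrite (_ : g z = fun e => expR (`|dotr (lattice d z.2) e| / 2 - 3)).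
      by apply: Es_expR_abs; case/andP: Qz => /andP[].
    by apply/funext => e; rewrite /g Qz z1.
  rewrite (_ : g z = fun e => expR (1 / 40 - `|dotr (lattice d z.2) e| / 4)).
    by apply: Es_expRN; move: Qz; rewrite /Q z1 => /andP[/andP[]].
  by apply/funext => e; rewrite /g Qz z1.
have q0 : 0 <= 24 / 25 :> R by lra.
have [E [sE sub]] := @greedy R n _ Z (fun=> 1) g _ (fun=> ler01) g0 gq q0 N.
move=> hE; exists E; split => //.
have sizeZ : \sum_(z <- Z) (1 : R) <= 2 * (2 ^+ (100 * n) * 4 ^+ n).
  rewrite big_filter big_enum_cond /=.
  apply: (@le_trans _ _ (\sum_(b : bool) \sum_(f : cells n m | (height f <= 100 * n)%N) 1)).
    rewrite pair_big_dep /= [leRHS]big_mkcond [leLHS]big_mkcond /=; apply: ler_sum => -[b f] _.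
    rewrite /Q /P /=; case: (height f <= 100 * n)%N => //=.
    by case: ifP.
  rewrite big_bool /= sumr_const -mulr2n mulr_natl lerMn2r /=.
  by have := card_cells R n m (100 * n).
have small : (24 / 25 : R) ^+ N * \sum_(z <- Z) 1 < 1.
  have h25 : (24 / 25 : R) ^+ 25 <= 2^-1.
    rewrite (_ : (24 / 25 : R) = (25 / 24)^-1); last by field.
    rewrite exprVn lef_pV2 ?posrE ?exprn_gt0//; last by lra.
  have hN : (24 / 25 : R) ^+ N <= 2 ^- (104 * n).
    rewrite (_ : N = 25 * (104 * n))%N; last by rewrite mulnA.
    by rewrite exprM -exprVn; apply: lerXn2r; rewrite ?nnegrE ?exprn_ge0 ?invr_ge0.
  apply: (@le_lt_trans _ _ (2 ^- (104 * n) * (2 * (2 ^+ (100 * n) * 4 ^+ n)))).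
    by apply: ler_pM => //; apply: sumr_ge0.
  rewrite mulrC ltr_pdivrMr ?exprn_gt0// mul1r.
  rewrite (_ : 4 = 2 ^+ 2 :> R); last by rewrite expr2 -natrM.
  rewrite -exprM -exprD -exprS ltr_eXn2l ?ltr1n//.
  lia.
have prod_lt z : Q z -> \prod_(e <- E) g z e < 1.
  move=> Qz; apply: le_lt_trans small; apply: le_trans hE.
  under [leRHS]eq_bigr do rewrite mul1r.
  have zZ : z \in Z by rewrite mem_filter Qz mem_enum.
  rewrite (big_rem z)//= lerDl; apply: sumr_ge0 => w _.
  exact: prodr_ge0.
have NR : (size E)%:R = N%:R :> R by rewrite sE.
have sumc (c : R) : \sum_(e <- E) c = (size E)%:R * c.
  by rewrite big_const_seq count_predT iter_addr_0 mulr_natl.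
have net_up f : P f -> \sum_(e <- E) `|dotr (lattice d f) e| <= 6 * (size E)%:R.
  move=> Pf; have Qf : Q (true, f) by rewrite /Q /= Pf.
  have := prod_lt _ Qf; rewrite /g Qf /= -expR_sum -[X in _ < X]expR0 ltr_expR.
  by rewrite big_split /= -mulr_suml sumc; lra.
have net_low f : P f -> 9 / 10 <= dotr (lattice d f) (lattice d f) ->
    1 / 10 * (size E)%:R <= \sum_(e <- E) `|dotr (lattice d f) e|.
  move=> Pf yf; have Qf : Q (false, f) by rewrite /Q /= Pf yf.
  have := prod_lt _ Qf; rewrite /g Qf /= -expR_sum -[X in _ < X]expR0 ltr_expR.
  by rewrite big_split /= sumc sumrN -mulr_suml; lra.
pose S (x : 'rV[R]_n) : R := \sum_(e <- E) `|dotr x e|.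
have SD x y : S (x + y) <= S x + S y.
  by rewrite /S -big_split; apply: ler_sum => e _; rewrite dotrDl ler_normD.
have SZ a x : S (a *: x) = `|a| * S x.
  by rewrite /S mulr_sumr; apply: eq_bigr => e _; rewrite dotrZl normrM.
have [M0 SM0] : exists M0, forall x, S x <= M0 * nrm x.
  exists (\sum_(e <- E) nrm e) => x; rewrite mulr_suml; apply: ler_sum => e _.
  by rewrite mulrC dotr_le_nrm.
have netx x : nrm x = 1 -> exists f, [/\ P f, nrm (x - lattice d f) <= 1 / 100 &
    9 / 10 <= dotr (lattice d f) (lattice d f)].
  move=> x1; have [f [hf xf yf]] := @lattice_approx n 100 m x n0 isT (leqnn _) x1.
  exists f; split; [by rewrite /P hf|by rewrite div1r|].
  have : nrm x <= nrm (x - lattice d f) + nrm (lattice d f) by rewrite -[in leLHS](subrK (lattice d f) x) nrmD.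
  rewrite x1 -sqr_nrm -/d; move: xf yf; rewrite -/d; set u := nrm _; set v := nrm _ => hu hv h.
  have : 99 / 100 <= v by lra.
  by nra.
pose A := [set S x | x in [set x | nrm x <= 1]].
have hA : has_sup A.
  split; first by exists (S 0); exists 0 => //=; rewrite nrm0.
  exists `|M0| => _ [x /= x1 <-]; apply: (le_trans (SM0 x)).
  apply: (@le_trans _ _ (`|M0| * nrm x)); first by rewrite ler_wpM2r ?nrm_ge0 ?ler_norm.
  by rewrite ler_piMr.
have Ssup x : S x <= sup A * nrm x.
  have [->|x0] := eqVneq x 0.
    by rewrite nrm0 mulr0 /S big1// => e _; rewrite dotr0l normr0.
  have := nrm_gt0 x0 => nx0; rewrite -ler_pdivrMr// mulrC -[_^-1]ger0_norm ?invr_ge0 ?nrm_ge0//.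
  rewrite -SZ; apply: sup_upper_bound => //; exists ((nrm x)^-1 *: x) => //=.
  by rewrite nrmZ ger0_norm ?invr_ge0 ?nrm_ge0// mulVf// gt_eqF.
have S1 x : nrm x = 1 -> S x <= 6 * (size E)%:R + sup A / 100.
  move=> /netx[f [Pf xf _]]; rewrite -(subrK (lattice d f) x) addrC.
  apply: (le_trans (SD _ _)); apply: lerD; first exact: net_up.
  apply: (le_trans (Ssup _)); rewrite ler_wpM2l//; last by lra.
  by apply: le_trans (sup_upper_bound hA _); last (exists 0 => //=; rewrite nrm0//);
     rewrite /S; apply: sumr_ge0.
have supA : sup A <= 7 * (size E)%:R.
  suff : sup A <= 6 * (size E)%:R + sup A / 100 by have := ler0n R (size E); lra.
  have sA0 : 0 <= sup A.
    by apply: le_trans (sup_upper_bound hA _); last (exists 0 => //=; rewrite nrm0//);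
     rewrite /S; apply: sumr_ge0.
  apply: ge_sup; first by case: hA.
  move=> _ [x /= x1 <-].
  have [->|x0] := eqVneq x 0.
    rewrite /S big1 ?addr_ge0 ?mulr_ge0 ?divr_ge0//.
    by move=> e _; rewrite dotr0l normr0.
  have nx0 := nrm_gt0 x0.
  have xE : x = nrm x *: ((nrm x)^-1 *: x) by rewrite scalerA mulfV ?scale1r// gt_eqF.
  rewrite xE SZ ger0_norm ?nrm_ge0//.
  apply: (@le_trans _ _ (1 * S ((nrm x)^-1 *: x))).
    by rewrite ler_wpM2r// /S; apply: sumr_ge0.
  rewrite mul1r; apply: S1.
  by rewrite nrmZ ger0_norm ?invr_ge0 ?nrm_ge0// mulVf// gt_eqF.
move=> x; apply/andP; split; last first.
  by apply: (le_trans (Ssup x)); rewrite ler_wpM2r ?nrm_ge0.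
have [->|x0] := eqVneq x 0.
  by rewrite nrm0 mulr0; apply: sumr_ge0.
have nx0 := nrm_gt0 x0.
have xE : x = nrm x *: ((nrm x)^-1 *: x) by rewrite scalerA mulfV ?scale1r// gt_eqF.
rewrite -/(S x) [in leRHS]xE SZ ger0_norm ?nrm_ge0// mulrC ler_pM2l//.
have u1 : nrm ((nrm x)^-1 *: x) = 1.
  by rewrite nrmZ ger0_norm ?invr_ge0 ?nrm_ge0// mulVf// gt_eqF.
move: ((nrm x)^-1 *: x) u1 => u u1.
have [f [Pf xf yf]] := netx _ u1.
have := net_low _ Pf yf; rewrite -/(S _).
have : S (lattice d f) <= S u + S (u - lattice d f).
  rewrite -{1}(subKr u (lattice d f)); apply: (le_trans (SD _ _)); rewrite lerD2l.
  by rewrite -scaleN1r SZ normrN1 mul1r.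
have : S (u - lattice d f) <= 7 * (size E)%:R * (1 / 100).
  apply: (le_trans (Ssup _)); apply: ler_pM => //; last exact: nrm_ge0.
  by apply: le_trans (sup_upper_bound hA _); last (exists 0 => //=; rewrite nrm0//);
     rewrite /S; apply: sumr_ge0.
lra.
Qed.
End kashin.

(** * An Urysohn inequality for sign vectors *)

Section urysohn.
Context (R : realType).
Local Notation T := (measurableTypeR R).
Local Notation leb := (@lebesgue_measure R).
Local Notation mu := (lebesgue_tuple R).
Implicit Types (n : nat).

Lemma rowt_consp1 n x (t : n.-tuple T) : rowt (consp (x, t)) = row1 x (rowt t).
Proof. exact: rowt_consp. Qed.

Lemma lvol_slices n (D : set 'rV[R]_n.+1) : mset D ->
  (lvol D = \int[mu n]_y leb [set x : T | D (row1 x (rowt y))])%E.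
Proof.
move=> mD; rewrite -integral_set// integral_cons2//; last exact: measurable_set_indic.
apply: eq_integral => y _.
under eq_integral do rewrite rowt_consp1.
have mS : measurable [set x : T | D (row1 x (rowt y))].
  have := measurable_consp1 y measurableT mD; rewrite setTI.
  by congr measurable; apply/seteqP; split => x /=; rewrite rowt_consp1.
by rewrite -[X in leb X]setIT -integral_indic.
Qed.

Lemma measurable_slices n (D : set 'rV[R]_n.+1) : mset D ->
  measurable_fun setT (fun y : n.-tuple T => leb [set x : T | D (row1 x (rowt y))]).
Proof.
move=> mD.
have := @measurable_integral_head R n (fun t => (\1_D (rowt t))%:E)
  (measurable_set_indic mD) (fun t => ltac:(by rewrite lee_fin)).
congr measurable_fun; apply/funext => y.
have mS : measurable [set x : T | D (row1 x (rowt y))].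
  have := measurable_consp1 y measurableT mD; rewrite setTI.
  by congr measurable; apply/seteqP; split => x /=; rewrite rowt_consp1.
under eq_integral do rewrite rowt_consp1.
by rewrite -[X in leb X]setIT -integral_indic.
Qed.

(** Otherwise A is included in a segment of length 2 s. *)
Lemma wide_set (A : set T) (s : R) : measurable A -> 0 <= s -> ((2 * s)%:E < leb A)%E ->
  exists t t', [/\ A t, A t' & 2 * s < t - t'].
Proof.
move=> mA s0 hA; apply: contrapT => nex.
have le2 t t' : A t -> A t' -> t - t' <= 2 * s.
  by move=> At At'; rewrite leNgt; apply/negP => h; apply: nex; exists t, t'.
have [A0|] := pselect (A !=set0); last first.
  by move=> /set0P/negP/negPn/eqP A0; move: hA; rewrite A0 measure0 lte_fin; lra.
have [t0 At0] := A0.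
have hs : has_sup A by split => //; exists (t0 + 2 * s) => t /(le2 _ _)/(_ At0); lra.
have AI : A `<=` `[sup A - 2 * s, sup A]%classic.
  move=> t At /=; rewrite in_itv /=; apply/andP; split; last exact: sup_upper_bound.
  rewrite lerBlDr; apply: ge_sup => // t' At'.
  by have := le2 _ _ At' At; lra.
have : (leb A <= leb `[(sup A - 2 * s)%R, sup A]%classic)%E.
  by apply: le_measure; rewrite ?inE//; exact: measurable_itv.
rewrite lebesgue_measure_itv/= lte_fin => h.
move: (lt_le_trans hA h); case: ifP => _.
  by rewrite -EFinD lte_fin; lra.
by rewrite lte_fin; lra.
Qed.

Lemma integral_simplex n (h : R) : 0 <= h ->
  (\int[leb]_(s in `[0%R, h]) (((2 * (h - s)) ^+ n / n`!%:R)%R)%:E =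
   ((2 * h) ^+ n.+1 / (n.+1)`!%:R / 2)%:E)%E.
Proof.
rewrite le_eqVlt => /predU1P[<-|h0].
  by rewrite set_itv1 integral_set1 mulr0 exprS !mul0r.
(* A primitive of the integrand that vanishes at h. *)
pose F (s : R) : R := - ((2 * (h - s)) ^+ n.+1 / (n.+1)`!%:R / 2).
have dF (s : R) : is_derive s 1 F ((2 * (h - s)) ^+ n / n`!%:R).
  have dg : is_derive s 1 (fun s : R => 2 * (h - s)) (- 2).
    rewrite (_ : (fun s : R => 2 * (h - s)) = 2 \*: (cst h - id)); last first.
      by apply/funext.
    rewrite (_ : - 2 = 2 *: (0 - 1) :> R); last by rewrite /GRing.scale /= sub0r mulrN1.
    exact: is_deriveZ.
  have := is_deriveZ (- ((n.+1)`!%:R * 2)%R^-1) (is_deriveX n.+1 dg).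
  rewrite (_ : _ \*: _ = F); last first.
    by apply/funext => x; rewrite /F /= exprfctE /GRing.scale /= mulNr invfM mulrC mulrA.
  congr is_derive; rewrite /GRing.scale /=.
  rewrite factS natrM.
  have n0 : n.+1%:R != 0 :> R by rewrite pnatr_eq0.
  have f0 : n`!%:R != 0 :> R by rewrite pnatr_eq0 -lt0n fact_gt0.
  by field; rewrite f0 addrC natr1 n0.
have cf : continuous (fun s : R => (2 * (h - s)) ^+ n / n`!%:R).
  move=> s; apply: cvgM; last exact: cvg_cst.
  apply: (@continuous_comp _ _ _ (fun s : R => 2 * (h - s)) (fun x => x ^+ n)).
    apply: cvgM; first exact: cvg_cst.
    by apply: cvgB; [exact: cvg_cst|exact: cvg_id].
  exact: exprn_continuous.
have cF : continuous F.
  by move=> s; apply: differentiable_continuous; apply/derivable1_diffP; have [] := dF s.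
rewrite (@continuous_FTC2 _ _ F)//.
- have -> : F h = 0 by rewrite /F subrr mulr0 exprS !mul0r oppr0.
  by rewrite -EFinB sub0r /F opprK subr0.
- exact: continuous_subspaceT.
- split.
  + by move=> s _; have [] := dF s.
  + by apply: cvg_at_right_filter; exact: cF.
  + by apply: cvg_at_left_filter; exact: cF.
- by move=> s _; rewrite derive1E; have [_ ->] := dF s.
Qed.

Lemma Es_ge0 n (D : set 'rV[R]_n) (H : 'rV[R]_n -> R) x : D x ->
  (forall x e, D x -> e \in signs R n -> dotr x e <= H e) -> 0 <= Es H.
Proof. by move=> Dx hD; rewrite -(Es_dotr x); apply: Es_le => e /hD; exact. Qed.

(** Induction on the dimension, by slicing D along its first coordinate.  If the
slice above x is longer than 2 s, it contains two numbers t and t' with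
t - t' > 2 s; adding the hypotheses at (t, x) with the sign 1 and at (t', x)
with the sign -1 shows that x satisfies the hypotheses for
H' e = (H (1, e) + H (-1, e)) / 2 - s, whose average is smaller by s than that
of H.  By induction these x form a set of volume at most (2 (h - s))^n / n!,
and the volume of D is twice the integral over s of these volumes. *)
Lemma sign_urysohn n (D : set 'rV[R]_n) (H : 'rV[R]_n -> R) : mset D ->
  (forall x e, D x -> e \in signs R n -> dotr x e <= H e) -> 0 <= Es H ->
  (lvol D <= ((2 * Es H) ^+ n / n`!%:R)%:E)%E.
Proof.
elim: n D H => [|n IH] D H mD hD H0.
  rewrite expr0 fact0 invr1 mulr1 /lvol /= diracE lee_fin.
  by case: (_ \in _).
set h := Es H in H0 *.
pose l (y : n.-tuple T) := leb [set x : T | D (row1 x (rowt y))].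
have ml : measurable_fun setT l by exact: measurable_slices.
have l0 y : (0 <= l y)%E by exact: measure_ge0.
pose G := [set p : T * n.-tuple T | 0 <= p.1 /\ ((2 * p.1)%:E < l p.2)%E].
have mG : measurable G.
  rewrite (_ : G = (fst @^-1` (`[0%R, +oo[%classic : set T)) `&`
      (setT `&` [set p | ((2 * p.1)%:E < l p.2)%E])); last first.
    rewrite setTI; apply/seteqP; split => -[s y] /=; rewrite in_itv/= andbT.
      by [].
    by [].
  apply: measurableI.
    by rewrite -[X in measurable X]setTI; apply: measurable_fst => //; exact: measurable_itv.
  apply: measurable_lte => //.
    apply/measurable_EFinP; apply: measurable_funM => //; exact: measurable_cst.
  by apply: measurableT_comp.
have mg : measurable_fun setT (fun p => (\1_G p)%:E : \bar R).
  by apply/measurable_EFinP; exact: measurable_indic.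
have inner2 y : (\int[leb]_s (\1_G (s, y))%:E = (2^-1)%:E * l y)%E.
  have mS : measurable [set s : T | 0 <= s /\ ((2 * s)%:E < l y)%E].
    have := measurable_ysection y mG; congr measurable.
    by apply/seteqP; split => s; rewrite /ysection /= inE.
  transitivity (leb [set s : T | 0 <= s /\ ((2 * s)%:E < l y)%E]).
    by rewrite -[X in leb X]setIT -integral_indic.
  have := l0 y; case: (l y) => [r r0|_|//].
    rewrite (_ : [set s | _] = `[0%R, r / 2[%classic); last first.
      apply/seteqP; split => s /=; rewrite in_itv/= lte_fin.
        by move=> [-> ?] /=; rewrite ltr_pdivlMr// mulrC.
      by move=> /andP[-> ?]; split => //; rewrite mulrC -ltr_pdivlMr.
    rewrite lebesgue_measure_itv/= lte_fin -EFinM; rewrite lee_fin in r0.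
    case: ifPn => [_|]; first by rewrite -EFinB subr0 mulrC.
    by rewrite -leNgt => hr; congr EFin; lra.
  rewrite (_ : [set s | _] = `[0%R, +oo[%classic); last first.
    apply/seteqP; split => s /=; rewrite in_itv/= andbT ?ltry//.
    by case.
  by rewrite lebesgue_measure_itv/= ltry gt0_muley// lte_fin invr_gt0.
have inner1 s : (\int[mu n]_y (\1_G (s, y))%:E <=
    (((2 * (h - s)) ^+ n / n`!%:R) * \1_(`[0%R, h]%classic : set R) s)%:E)%E.
  have [s0|s0] := ltP s 0.
    rewrite (eq_integral (fun=> 0%E)).
      rewrite integral0 lee_fin indicE memNset ?mulr0//=.
      by rewrite in_itv/= leNgt s0.
    by move=> y _; rewrite indicE memNset//= => -[]; rewrite leNgt s0.
  pose Ds := [set x : 'rV[R]_n | ((2 * s)%:E < l (tupr x))%E].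
  have mDs : mset Ds.
    have mm : measurable_fun [set: n.-tuple T] (fun=> (2 * s)%:E : \bar R) by exact: measurable_cst.
    have := measurable_lte measurableT mm ml; rewrite setTI.
    by congr measurable; apply/seteqP; split => y /=; rewrite /Ds /= rowtK.
  pose H' (e : 'rV[R]_n) := (H (row1 1 e) + H (row1 (-1) e)) / 2 - s.
  have EH' : Es H' = h - s.
    rewrite /H' EsB Es_cst; congr (_ - _); rewrite /h EsS -EsD -[RHS]mulrC -EsZ.
    by apply: Es_ext => e _; rewrite mulrC.
  have hDs x e : Ds x -> e \in signs R n -> dotr x e <= H' e.
    move=> Dsx es.
    have mS : measurable [set a : T | D (row1 a x)].
      have := measurable_consp1 (tupr x) measurableT mD; rewrite setTI.
      by congr measurable; apply/seteqP; split => a /=; rewrite rowt_consp1 tuprK.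
    have [|t [t' [Dt Dt' tt']]] := wide_set mS s0.
      by move: Dsx; rewrite /Ds /= /l tuprK.
    have h1 := hD _ (row1 1 e) Dt; have h2 := hD _ (row1 (-1) e) Dt'.
    rewrite !dotr_row1 in h1 h2.
    have {}h1 := h1 (ltac:(by rewrite mem_cat map_f)).
    have {}h2 := h2 (ltac:(by rewrite mem_cat (map_f (row1 (-1))) ?orbT)).
    by rewrite /H'; lra.
  have -> : (\int[mu n]_y (\1_G (s, y))%:E = lvol Ds)%E.
    rewrite -integral_set//; apply: eq_integral => y _; congr EFin.
    by rewrite !indicE; congr (_%:R); congr nat_of_bool; apply/idP/idP; rewrite !inE /Ds /G /= rowtK; [case|].
  have [sh|sh] := leP s h.
    rewrite indicE mem_set ?mulr1; last by rewrite /= in_itv/= s0.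
    by rewrite -EH'; apply: IH => //; rewrite EH' subr_ge0.
  rewrite (_ : Ds = set0).
    by rewrite /lvol measure0 lee_fin indicE memNset ?mulr0//= in_itv/= (leNgt s h) sh andbF.
  rewrite -subset0 => x Dsx; have := Es_ge0 Dsx hDs; rewrite EH'; lra.
rewrite lvol_slices//.
rewrite (_ : (\int[mu n]_y _ = \int[mu n]_y (2%:E * \int[leb]_s (\1_G (s, y))%:E))%E); last first.
  by apply: eq_integral => y _; rewrite inner2 muleA -EFinM mulfV// mul1e.
rewrite ge0_integralZl//; last 2 first.
- exact: (measurable_fun_fubini_tonelli_G (m1 := leb) (fun p => (\1_G p)%:E)).
- by move=> y _; apply: integral_ge0 => s _; rewrite lee_fin.
rewrite -(fubini_tonelli (fun p => (\1_G p)%:E))//.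
have -> : ((2 * h) ^+ n.+1 / (n.+1)`!%:R)%:E = (2%:E * ((2 * h) ^+ n.+1 / (n.+1)`!%:R / 2)%:E)%E.
  by rewrite -EFinM [in RHS]mulrC divfK.
rewrite lee_pmul2l// -integral_simplex//.
rewrite [leRHS]integral_mkcond; apply: ge0_le_integral => //.
- by move=> s _; apply: integral_ge0 => y _; rewrite lee_fin.
- exact: (measurable_fun_fubini_tonelli_F (m2 := mu n) (fun p => (\1_G p)%:E)).
- have mI : measurable (`[0%R, h]%classic : set T) by exact: measurable_itv.
  apply/(measurable_restrict _ mI) => //.
  rewrite setTI; apply/measurable_EFinP; apply: measurable_funTS.
  apply: continuous_measurable_fun.
  move=> s; apply: cvgM; last exact: cvg_cst.
  apply: (@continuous_comp _ _ _ (fun s : R => 2 * (h - s)) (fun x => x ^+ n)).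
    apply: cvgM; first exact: cvg_cst.
    by apply: cvgB; [exact: cvg_cst|exact: cvg_id].
  exact: exprn_continuous.
- move=> s _; apply: le_trans (inner1 s) _; rewrite patchE indicE.
  by case: ifP => _; rewrite ?mulr1 ?mulr0.
Qed.
End urysohn.

(** * Integrals of bounded functions with bounded support *)

Section bounded_integrals.
Context (R : realType).
Local Notation T := (measurableTypeR R).
Local Notation leb := (@lebesgue_measure R).
Local Notation mu := (lebesgue_tuple R).
Implicit Types (n : nat).

Definition mfun n (g : 'rV[R]_n -> R) := measurable_fun setT (fun t : n.-tuple T => g (rowt t)).

(** A convenient class of integrable functions: nonnegative, bounded, and zero
outside a box. *)
Definition tame n (g : 'rV[R]_n -> R) := [/\ mfun g, forall x, 0 <= g x &
  exists c r, [/\ 0 <= c, 0 <= r & forall x, g x <= c * \1_(box r) x]].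

Definition eint n (g : 'rV[R]_n -> R) : \bar R := (\int[mu n]_t (g (rowt t))%:E)%E.
Definition rint n (g : 'rV[R]_n -> R) : R := fine (eint g).

Lemma eint_ge0 n (g : 'rV[R]_n -> R) : (forall x, 0 <= g x) -> (0 <= eint g)%E.
Proof. by move=> g0; apply: integral_ge0 => t _; rewrite lee_fin. Qed.

Lemma le_eint n (f g : 'rV[R]_n -> R) : mfun f -> mfun g -> (forall x, 0 <= f x) ->
  (forall x, f x <= g x) -> (eint f <= eint g)%E.
Proof.
move=> mf mg f0 fg; apply: ge0_le_integral => //.
- by move=> t _; rewrite lee_fin.
- exact/measurable_EFinP.
- exact/measurable_EFinP.
- by move=> t _; rewrite lee_fin.
Qed.

Lemma tame_box n c r : 0 <= c -> 0 <= r -> tame (fun x : 'rV[R]_n => c * \1_(box r) x).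
Proof.
move=> c0 r0; split; last by exists c, r; split.
  have /measurable_EFinP := measurable_set_indic (@mset_box R n r).
  by move=> h; apply: measurable_funM => //; exact: measurable_cst.
by move=> x; rewrite mulr_ge0.
Qed.

Lemma eint_box n c r : 0 <= c -> 0 <= r ->
  eint (fun x : 'rV[R]_n => c * \1_(box r) x) = (c * (r + r) ^+ n)%:E.
Proof.
move=> c0 r0; rewrite /eint; under eq_integral do rewrite EFinM.
rewrite ge0_integralZl//.
  by rewrite integral_set; [rewrite lvol_box// -EFinM|exact: mset_box].
exact: (measurable_set_indic (@mset_box R n r)).
Qed.

Lemma rintE n (g : 'rV[R]_n -> R) : tame g -> eint g = (rint g)%:E.
Proof.
move=> [mg g0 [c [r [c0 r0 gc]]]]; rewrite /rint fineK//.
rewrite ge0_fin_numE ?eint_ge0//.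
have [mb b0 _] := tame_box n c0 r0.
by rewrite (le_lt_trans (le_eint mg mb g0 gc))// eint_box// ltry.
Qed.

Lemma le_rint n (f g : 'rV[R]_n -> R) : tame f -> tame g -> (forall x, f x <= g x) ->
  rint f <= rint g.
Proof.
move=> tf tg fg; rewrite -lee_fin -!rintE//.
by case: tf tg => mf f0 _ [mg _ _]; exact: le_eint.
Qed.

Lemma tameD n (f g : 'rV[R]_n -> R) : tame f -> tame g -> tame (fun x => f x + g x).
Proof.
move=> [mf f0 [c [r [c0 r0 fc]]]] [mg g0 [d [s [d0 s0 gd]]]]; split.
- exact: measurable_funD.
- by move=> x; rewrite addr_ge0.
exists (c + d), (Num.max r s); split; [exact: addr_ge0|by rewrite le_max r0|].
move=> x; rewrite mulrDl; apply: lerD.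
  apply: (le_trans (fc x)); rewrite ler_wpM2l// !indicE ler_nat.
  case: (boolP (x \in box r)) => //; rewrite inE => xr.
  by rewrite mem_set// => i; rewrite le_max xr.
apply: (le_trans (gd x)); rewrite ler_wpM2l// !indicE ler_nat.
case: (boolP (x \in box s)) => //; rewrite inE => xr.
by rewrite mem_set// => i; rewrite le_max xr orbT.
Qed.

Lemma tameZ n a (g : 'rV[R]_n -> R) : 0 <= a -> tame g -> tame (fun x => a * g x).
Proof.
move=> a0 [mg g0 [c [r [c0 r0 gc]]]]; split.
- by apply: measurable_funM => //; exact: measurable_cst.
- by move=> x; rewrite mulr_ge0.
exists (a * c), r; split => //; first by rewrite mulr_ge0.
by move=> x; rewrite -mulrA ler_wpM2l.
Qed.

Lemma tame0 n : tame (fun _ : 'rV[R]_n => 0).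
Proof.
split => //; first exact: measurable_cst.
by exists 0, 0; split => // x; rewrite mul0r.
Qed.

Lemma tame_sum n I (s : seq I) (g : I -> 'rV[R]_n -> R) : (forall i, tame (g i)) ->
  tame (fun x => \sum_(i <- s) g i x).
Proof.
move=> tg; elim: s => [|i s IH].
  by under eq_fun do rewrite big_nil; exact: tame0.
by under eq_fun do rewrite big_cons; exact: tameD.
Qed.

Lemma tame_le n (f g : 'rV[R]_n -> R) : tame g -> mfun f -> (forall x, 0 <= f x) ->
  (forall x, f x <= g x) -> tame f.
Proof.
move=> [mg g0 [c [r [c0 r0 gc]]]] mf f0 fg; split => //.
by exists c, r; split => // x; apply: le_trans (gc x).
Qed.

Lemma rintD n (f g : 'rV[R]_n -> R) : tame f -> tame g ->
  rint (fun x => f x + g x) = rint f + rint g.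
Proof.
move=> tf tg; apply: EFin_inj; rewrite EFinD -!rintE//; last exact: tameD.
case: tf tg => mf f0 _ [mg g0 _].
rewrite /eint -ge0_integralD//.
- by move=> t _; rewrite lee_fin.
- exact/measurable_EFinP.
- by move=> t _; rewrite lee_fin.
- exact/measurable_EFinP.
Qed.

Lemma rintZ n a (g : 'rV[R]_n -> R) : 0 <= a -> tame g ->
  rint (fun x => a * g x) = a * rint g.
Proof.
move=> a0 tg; apply: EFin_inj; rewrite EFinM -!rintE//; last exact: tameZ.
case: tg => mg g0 _; rewrite /eint -ge0_integralZl//.
- exact/measurable_EFinP.
- by move=> t _; rewrite lee_fin.
Qed.

Lemma rint0 n : rint (fun _ : 'rV[R]_n => 0) = 0.
Proof. by rewrite /rint /eint integral0. Qed.

Lemma rint_sum n I (s : seq I) (g : I -> 'rV[R]_n -> R) : (forall i, tame (g i)) ->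
  rint (fun x => \sum_(i <- s) g i x) = \sum_(i <- s) rint (g i).
Proof.
move=> tg; elim: s => [|i s IH].
  by under eq_fun do rewrite big_nil; rewrite rint0 big_nil.
under eq_fun do rewrite big_cons.
by rewrite big_cons -IH; apply: rintD => //; exact: tame_sum.
Qed.

Lemma mfun_shift n v (g : 'rV[R]_n -> R) : mfun g -> mfun (fun x => g (x + v)).
Proof.
move=> mg; rewrite /mfun.
have -> : (fun t : n.-tuple T => g (rowt t + v)) =
    (fun t => g (rowt t)) \o (fun t => tupr (rowt t + v)).
  by apply/funext => t /=; rewrite tuprK.
by apply: measurableT_comp mg _; exact: measurable_row_shift.
Qed.

Lemma tame_shift n v (g : 'rV[R]_n -> R) : tame g -> tame (fun x => g (x + v)).
Proof.
move=> [mg g0 [c [r [c0 r0 gc]]]]; split => //; first exact: mfun_shift.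
exists c, (r + `|v|); split => //; first by rewrite addr_ge0.
move=> x; apply: (le_trans (gc _)); rewrite ler_wpM2l// !indicE ler_nat.
case: (boolP (x + v \in box r)) => //; rewrite inE => xr.
rewrite mem_set// => i; rewrite -[x](addrK v) mxE [X in _ + X]mxE.
apply: (le_trans (ler_normD _ _)); apply: lerD; first exact: xr.
by rewrite normrN mx_coord_le.
Qed.

Lemma rint_shift n v (g : 'rV[R]_n -> R) : tame g -> rint (fun x => g (x + v)) = rint g.
Proof.
move=> [mg g0 _]; rewrite /rint /eint; congr fine.
rewrite -[RHS](integral_shift v)//.
- by apply: eq_integral => t _; rewrite tuprK.
- exact/measurable_EFinP.
- by move=> t; rewrite lee_fin.
Qed.

End bounded_integrals.

(** * Shadows and integration along a direction *)

Section fubini_direction.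
Context (R : realType).
Local Notation T := (measurableTypeR R).
Local Notation leb := (@lebesgue_measure R).
Local Notation mu := (lebesgue_tuple R).
Variables (m : nat) (xi : 'rV[R]_m.+1).
Hypothesis xi1 : sphere xi.
Let U : 'M[R]_(m, m.+1) := hyperplane_frame xi.

(** The orthonormal basis formed by xi and by the frame of its orthogonal
hyperplane. *)
Definition frame_mx : 'M[R]_m.+1 := (col_mx xi U : 'M[R]_(1 + m, m.+1)).

Lemma frame_orth : frame_mx *m frame_mx^T = 1%:M.
Proof.
have [UU Uxi] := hyperplane_frameP xi1.
rewrite /frame_mx (@tr_col_mx R 1 m) (@mul_col_row R 1 m m.+1 1 m) UU Uxi.
rewrite (_ : xi *m xi^T = 1%:M); last first.
  by apply/matrixP => i j; rewrite !ord1 [RHS]mxE; exact: xi1.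
rewrite (_ : xi *m U^T = 0); last first.
  by rewrite -[LHS]trmxK trmx_mul trmxK Uxi trmx0.
by rewrite -scalar_mx_block.
Qed.

Lemma frame_det : `|\det frame_mx| = 1.
Proof.
have := congr1 determinant frame_orth; rewrite det_mulmx det_tr det1 => h.
have : `|\det frame_mx| ^+ 2 = 1 by rewrite -normrX expr2 h normr1.
by move/eqP; rewrite sqrf_eq1 => /orP[/eqP//|/eqP h1]; have := normr_ge0 (\det frame_mx); rewrite h1; lra.
Qed.

Lemma frame_unit : frame_mx \in unitmx.
Proof. by rewrite unitmxE unitfE -normr_eq0 frame_det oner_neq0. Qed.

Lemma row1_frame a (y : 'rV[R]_m) : row1 a y *m frame_mx = a *: xi + y *m U.
Proof. by rewrite /row1 /frame_mx (@mul_row_col R 1 1 m) mul_scalar_mx. Qed.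

Lemma frame_decomp x : x = dotr x xi *: xi + (x *m U^T) *m U.
Proof.
have := mulmx1C frame_orth; rewrite /frame_mx (@tr_col_mx R 1 m) (@mul_row_col R _ 1 m) => h.
rewrite -[LHS]mulmx1 -h mulmxDr !mulmxA; congr (_ + _).
by rewrite [x *m xi^T]mx11_scalar mul_scalar_mx.
Qed.

Lemma frameE a (y : 'rV[R]_m) : dotr (a *: xi + y *m U) xi = a /\ (a *: xi + y *m U) *m U^T = y.
Proof.
have [UU Uxi] := hyperplane_frameP xi1; split.
  rewrite dotrDl dotrZl xi1 mulr1 dotr_mull (_ : xi *m U^T = 0) ?dotr0r ?addr0//.
  by rewrite -[LHS]trmxK trmx_mul trmxK Uxi trmx0.
rewrite mulmxDl -mulmxA UU mulmx1 -scalemxAl (_ : xi *m U^T = 0) ?scaler0 ?add0r//.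
by rewrite -[LHS]trmxK trmx_mul trmxK Uxi trmx0.
Qed.

(** The projection along xi, in the coordinates given by the frame. *)
Definition shadow (K : set 'rV[R]_m.+1) : set 'rV[R]_m := [set x *m U^T | x in K].

Lemma shadowP K y : shadow K y <-> exists a, K (a *: xi + y *m U).
Proof.
split; first by move=> [x Kx <-]; exists (dotr x xi); rewrite -frame_decomp.
by move=> [a Ka]; exists (a *: xi + y *m U) => //; exact: (frameE a y).2.
Qed.

Lemma hyperplane_volE K : hyperplane_vol xi (orth_proj xi K) = vol (shadow K).
Proof.
rewrite /hyperplane_vol; congr vol; apply/seteqP; split => y /=.
  move=> [x Kx hx]; apply/shadowP; exists (dotr x xi).
  by rewrite -/U -hx addrC subrK.
move/shadowP => [a Ka]; exists (a *: xi + y *m U) => //.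
by rewrite (frameE a y).1 addrC addKr.
Qed.

Lemma compact_shadow K : compact K -> compact (shadow K).
Proof.
move=> cK; apply: continuous_compact => //.
by apply: continuous_subspaceT => x; exact: continuous_mulmx.
Qed.

(** Rotate the first axis onto xi, then integrate along it first. *)
Lemma fubini_frame (g : 'rV[R]_m.+1 -> R) : mfun g -> (forall x, 0 <= g x) ->
  (eint g = \int[mu m]_y \int[leb]_a (g (a *: xi + rowt y *m U))%:E)%E.
Proof.
move=> mg g0; have mG : measurable_fun setT (fun t : m.+1.-tuple T => (g (rowt t))%:E).
  exact/measurable_EFinP.
have := change_of_var_unit frame_unit mG (fun t => ltac:(by rewrite lee_fin)).
rewrite frame_det invr1 mul1e -/(eint g) => <-.
under eq_integral do rewrite tuprK.
rewrite (integral_cons2 (F := fun t => (g (rowt t *m frame_mx))%:E)).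
- by apply: eq_integral => y _; apply: eq_integral => a _; rewrite rowt_consp1 row1_frame.
- have := measurableT_comp mG (measurable_row_mul frame_mx).
  by congr measurable_fun; apply/funext => t /=; rewrite tuprK.
- by move=> t; rewrite lee_fin.
Qed.

Lemma measurable_line_integral (g : 'rV[R]_m.+1 -> R) : mfun g -> (forall x, 0 <= g x) ->
  measurable_fun setT (fun y : m.-tuple T => \int[leb]_a (g (a *: xi + rowt y *m U))%:E)%E.
Proof.
move=> mg g0; have mG : measurable_fun setT (fun t : m.+1.-tuple T => (g (rowt t))%:E).
  exact/measurable_EFinP.
have := measurable_integral_head (F := fun t => (g (rowt t *m frame_mx))%:E) _
   (fun t => ltac:(by rewrite lee_fin)).
have mH : measurable_fun setT (fun t : m.+1.-tuple T => (g (rowt t *m frame_mx))%:E).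
  have := measurableT_comp mG (measurable_row_mul frame_mx).
  by congr measurable_fun; apply/funext => t /=; rewrite tuprK.
move=> /(_ mH); congr measurable_fun; apply/funext => y.
by apply: eq_integral => a _; rewrite rowt_consp1 row1_frame.
Qed.

Lemma continuous_line (g : 'rV[R]_m.+1 -> R) (y : 'rV[R]_m) : continuous g ->
  continuous (fun a : R => g (a *: xi + y *m U)).
Proof.
move=> cg a; apply: (@continuous_comp _ _ _ (fun a : R => a *: xi + y *m U) g); last exact: cg.
by apply: cvgD; [apply: cvgZr_tmp; exact: cvg_id|exact: cvg_cst].
Qed.

End fubini_direction.

(** * Shifts of quasiconcave functions on the line *)

Section line_integrals.
Context (R : realType).
Local Notation T := (measurableTypeR R).
Local Notation leb := (@lebesgue_measure R).
Implicit Types (h g : T -> R).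

Definition lint h : \bar R := (\int[leb]_a (h a)%:E)%E.

Lemma le_lint h g : measurable_fun setT h -> measurable_fun setT g ->
  (forall a, 0 <= h a) -> (forall a, h a <= g a) -> (lint h <= lint g)%E.
Proof.
move=> mh mg h0 hg; apply: ge0_le_integral => //.
- by move=> a _; rewrite lee_fin.
- exact/measurable_EFinP.
- exact/measurable_EFinP.
- by move=> a _; rewrite lee_fin.
Qed.

Lemma lintD h g : measurable_fun setT h -> measurable_fun setT g ->
  (forall a, 0 <= h a) -> (forall a, 0 <= g a) ->
  (lint (fun a => (h a + g a)%R) = lint h + lint g)%E.
Proof.
move=> mh mg h0 g0; rewrite /lint -ge0_integralD//.
- by move=> a _; rewrite lee_fin.
- exact/measurable_EFinP.
- by move=> a _; rewrite lee_fin.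
- exact/measurable_EFinP.
Qed.

Lemma measurable_fun_shift h s : measurable_fun setT h ->
  measurable_fun setT (fun a : T => h (a + s : R)).
Proof.
move=> mh; apply: (measurableT_comp mh).
apply: (@continuous_measurable_fun R (fun a => a + s)) => a.
by apply: cvgD; [exact: cvg_id|exact: cvg_cst].
Qed.

Lemma lint_shift h s : measurable_fun setT h -> (forall a, 0 <= h a) ->
  lint (fun a => h (a + s : R)) = lint h.
Proof.
move=> mh h0; have mH : measurable_fun setT (fun a => (h a)%:E : \bar R) by exact/measurable_EFinP.
have := integral_lebesgue_affine s (oner_neq0 R) mH (fun a => ltac:(by rewrite lee_fin)).
rewrite normr1 invr1 mul1e -/(lint h) => <-.
by apply: eq_integral => a _; rewrite mul1r.
Qed.

Lemma lint_indic (a b : R) : a <= b -> lint (\1_(`[a, b[%classic : set R)) = (b - a)%:E.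
Proof.
move=> ab; rewrite /lint integral_indic//.
rewrite setIT.
have := @lebesgue_measure_itv R `[a, b[; rewrite /= lte_fin => ->; case: ifPn => [_|].
  by rewrite EFinB.
by rewrite -leNgt => ba; congr EFin; lra.
Qed.

Lemma measurable_itv_indic (i : interval R) : measurable_fun setT (\1_([set` i] : set R) : T -> R).
Proof. by apply: measurable_indic; exact: measurable_itv. Qed.

(** By quasiconcavity, if h is maximal at t0, the maximum of [h (a + s)] and [h a]
is [h a] on the right of t0 and [h (a + s)] on the left of t0 - s; in between,
on a segment of length s, it is at most 1. *)
Lemma lint_max_le h s t0 : measurable_fun setT h -> 0 <= s ->
  (forall a, 0 <= h a <= 1) -> (forall a, h a <= h t0) ->
  (forall a b c, a <= b -> b <= c -> Num.min (h a) (h c) <= h b) ->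
  (lint (fun a => Num.max (h (a + s)%R) (h a)) <= lint h + s%:E)%E.
Proof.
move=> mh s0 h01 ht qc.
have h0 a : 0 <= h a by case/andP: (h01 a).
have h1 a : h a <= 1 by case/andP: (h01 a).
pose A : set R := `[t0, +oo[%classic; pose B : set R := `]-oo, t0[%classic.
pose hA a := h a * \1_A a; pose hB a := h a * \1_B a.
have mhA : measurable_fun setT hA by apply: measurable_funM => //; exact: measurable_itv_indic.
have mhB : measurable_fun setT hB by apply: measurable_funM => //; exact: measurable_itv_indic.
have hA0 a : 0 <= hA a by rewrite mulr_ge0.
have hB0 a : 0 <= hB a by rewrite mulr_ge0.
have -> : (lint h + s%:E = lint (fun a => (hA a + (hB (a + s) + \1_(`[t0 - s, t0[%classic : set R) a))%R))%E.
  rewrite lintD//; last 2 first.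
  - by apply: measurable_funD; [exact: measurable_fun_shift|exact: measurable_itv_indic].
  - by move=> a; rewrite addr_ge0.
  rewrite lintD//; last exact: measurable_fun_shift.
  rewrite lint_shift// lint_indic; last by lra.
  rewrite addeA -lintD// (_ : t0 - (t0 - s) = s); last by lra.
  congr (_ + _)%E; apply: eq_integral => a _; congr EFin; rewrite /hA /hB -mulrDr !indicE.
  have [ta|ta] := leP t0 a.
    rewrite mem_set /A /= ?in_itv/= ?andbT// memNset ?addr0 ?mulr1//.
    by rewrite /B /= in_itv/= ltNge ta.
  rewrite memNset; last by rewrite /A /= in_itv/= andbT leNgt ta.
  by rewrite mem_set ?add0r ?mulr1// /B /= in_itv.
apply: le_lint.
- by apply: measurable_maxr => //; exact: measurable_fun_shift.
- apply: measurable_funD => //.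
  by apply: measurable_funD; [exact: measurable_fun_shift|exact: measurable_itv_indic].
- by move=> a; rewrite le_max h0.
move=> a; have [ta|ta] := leP t0 a.
  have -> : Num.max (h (a + s)) (h a) = h a.
    apply/max_idPr; have := qc t0 a (a + s) ta (ltac:(by rewrite lerDl)).
    by rewrite (min_idPr (ht _)).
  rewrite /hA indicE mem_set /A /= ?in_itv/= ?ta// mulr1 lerDl.
  by rewrite addr_ge0.
have [ta'|ta'] := ltP (a + s) t0.
  have -> : Num.max (h (a + s)) (h a) = h (a + s).
    apply/max_idPl; have := qc a (a + s) t0 (ltac:(by rewrite lerDl)) (ltW ta').
    by rewrite (min_idPl (ht _)).
  rewrite /hB indicE mem_set /B /= ?in_itv/= ?ta'// mulr1 addrCA lerDl.
  by rewrite addr_ge0.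
rewrite [X in _ + (_ + X)]indicE mem_set; last by rewrite /= in_itv/= lerBlDr ta' ta.
rewrite (@le_trans _ _ 1)// ?ge_max ?h1//.
by rewrite addrA lerDr addr_ge0.
Qed.

(** Compare the maximum with [h (a + s)] on the left of t0, with 1 on a segment of
length s, and with [h a] further right. *)
Lemma lint_max_ge h s t0 : measurable_fun setT h -> 0 <= s -> (forall a, 0 <= h a) ->
  (forall a, t0 <= a < t0 + s -> h a = 1) ->
  (lint h + s%:E <= lint (fun a => Num.max (h (a + s)%R) (h a)))%E.
Proof.
move=> mh s0 h0 h1.
pose A : set R := `[t0, +oo[%classic; pose B : set R := `]-oo, t0 + s[%classic.
pose hA a := h a * \1_A a; pose hB a := h a * \1_B a.
have mhA : measurable_fun setT hA by apply: measurable_funM => //; exact: measurable_itv_indic.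
have mhB : measurable_fun setT hB by apply: measurable_funM => //; exact: measurable_itv_indic.
have hA0 a : 0 <= hA a by rewrite mulr_ge0.
have hB0 a : 0 <= hB a by rewrite mulr_ge0.
apply: (@le_trans _ _ (lint (fun a => (hA a + hB (a + s))%R))).
  rewrite lintD//; last exact: measurable_fun_shift.
  rewrite lint_shift// -lintD//.
  rewrite (_ : s = (t0 + s) - t0); last by lra.
  rewrite -lint_indic; last by lra.
  rewrite -lintD//.
  apply: le_lint.
  - by apply: measurable_funD => //; exact: measurable_itv_indic.
  - exact: measurable_funD.
  - by move=> a; rewrite addr_ge0.
  move=> a; rewrite /hA /hB !indicE.
  have [ta|ta] := leP t0 a.
    rewrite (mem_set (A := A)); last by rewrite /A /= in_itv/= ta.
    rewrite mulr1 lerD2l.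
    have [ta'|ta'] := ltP a (t0 + s).
      rewrite !mem_set /B /= ?in_itv/= ?ta ?ta'//.
      by rewrite h1 ?ta ?ta'// mul1r.
    rewrite memNset; last by rewrite /= in_itv/= (ltNge a) ta' andbF.
    by rewrite mulr_ge0.
  rewrite (memNset (A := `[t0, (t0 + s)%R[%classic)); last by rewrite /= in_itv/= (leNgt t0 a) ta.
  rewrite addr0 (mem_set (A := B)); last by rewrite /B /= in_itv/=; lra.
  by rewrite mulr1 lerDr mulr_ge0.
apply: le_lint.
- by apply: measurable_funD => //; exact: measurable_fun_shift.
- by apply: measurable_maxr => //; exact: measurable_fun_shift.
- by move=> a; rewrite addr_ge0.
move=> a; rewrite /hA /hB !indicE; have [ta|ta] := leP t0 a.
  rewrite (mem_set (A := A)); last by rewrite /A /= in_itv/= ta.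
  rewrite memNset; last by rewrite /B /= in_itv/= ltNge lerD2r ta.
  by rewrite mulr1 mulr0 addr0 le_max lexx orbT.
rewrite memNset; last by rewrite /A /= in_itv/= leNgt ta.
rewrite mem_set; last by rewrite /B /= in_itv/= ltrD2r.
by rewrite mulr1 mulr0 add0r le_max lexx.
Qed.

End line_integrals.

(** * A smooth substitute for the indicator function of a convex body *)

Section convex.
Context (R : realType).
Implicit Types (n : nat).

(** [convex_set] is phrased with an abstract interval type and with [conv]. *)
Definition cvx n (K : set 'rV[R]_n) :=
  forall x y (t : R), 0 <= t -> t <= 1 -> K x -> K y -> K (t *: x + (1 - t) *: y).

Lemma convex_setP n (K : set 'rV[R]_n) : @convex_set R 'rV[R]_n K <-> cvx K.
Proof.
split.
  move=> cK x y t t0 t1 Kx Ky.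
  have := cK x y (Itv01 t0 t1); rewrite !inE => /(_ Kx Ky).
  by rewrite /conv /=.
move=> cK x y l; rewrite !inE => Kx Ky; rewrite /conv /=.
exact: cK.
Qed.

Lemma dotr_sqD n (x y : 'rV[R]_n) : dotr (x + y) (x + y) = dotr x x + 2 * dotr x y + dotr y y.
Proof. by rewrite dotrDl !dotrDr (dotrC y x); ring. Qed.

Lemma continuous_nrm n : continuous (@nrm R n).
Proof.
apply: (@lipschitz_continuous _ _ _ _ (Num.sqrt n%:R)) => x y.
apply: le_trans (nrm_le_mxnorm _); rewrite ler_norml; apply/andP; split.
  by have h := nrmD (y - x) x; rewrite subrK -(opprB x y) nrmN in h; lra.
by rewrite lerBlDr; have := nrmD (x - y) y; rewrite subrK.
Qed.

(** The square of the positive part is differentiable with a 2-Lipschitz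
derivative. *)
Lemma sq_pos_part (a b : R) :
  0 <= Num.max 0 b ^+ 2 - Num.max 0 a ^+ 2 - 2 * Num.max 0 a * (b - a) <= (b - a) ^+ 2.
Proof.
have [a0|a0] := ltP 0 a; have [b0|b0] := ltP 0 b.
- by rewrite (_ : b ^+ 2 - a ^+ 2 - 2 * a * (b - a) = (b - a) ^+ 2) ?sqr_ge0 ?lexx//; ring.
- by apply/andP; split; nra.
- by apply/andP; split; nra.
- by rewrite expr0n mulr0 mul0r !subr0 lexx sqr_ge0.
Qed.

Section distance.
Variables (n : nat) (K : set 'rV[R]_n).
Hypotheses (cK : compact K) (vK : cvx K) (K0 : K !=set0).

Lemma ex_proj x : exists p, K p /\ forall y, K y -> dotr (x - p) (x - p) <= dotr (x - y) (x - y).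
Proof.
have [|p] := @EVT_min_rV R n (fun y => dotr (x - y) (x - y)) K K0 cK.
  apply: continuous_subspaceT => y.
  have cs : continuous (fun z : 'rV[R]_n => x - z).
    apply: (@lipschitz_continuous _ _ _ _ 1) => z w.
    by rewrite opprB addrC addrA subrK mul1r distrC.
  exact: continuous_dotr.
rewrite inE => Kp hp; exists p; split => // y Ky; apply: hp; exact/mem_set.
Qed.

(** The point of K nearest to x. *)
Definition proj x := sval (cid (ex_proj x)).

Lemma projK x : K (proj x).
Proof. by rewrite /proj; case: cid => p []. Qed.

Lemma proj_min x y : K y -> dotr (x - proj x) (x - proj x) <= dotr (x - y) (x - y).
Proof. by rewrite /proj; case: cid => p /= [_]; apply. Qed.

Lemma proj_le0 x y : K y -> dotr (x - proj x) (y - proj x) <= 0.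
Proof.
move=> Ky; rewrite leNgt; apply/negP => c0.
set c := dotr _ _ in c0; set p := proj x in c c0.
set q := dotr (y - p) (y - p).
have q0 : 0 <= q by exact: dotr_ge0.
pose t := c / (c + q).
have t0 : 0 < t by rewrite divr_gt0// ltr_wpDr.
have t1 : t <= 1 by rewrite ler_pdivrMr ?mul1r ?lerDl// ltr_wpDr.
have h := proj_min x (vK (ltW t0) t1 Ky (projK x)); rewrite -/p in h.
have E : x - (t *: y + (1 - t) *: p) = (x - p) + (- t) *: (y - p).
  by apply/rowP => i; rewrite !mxE; ring.
rewrite E [leRHS]dotr_sqD !dotrZr dotrZl -/c -/q in h.
suff : t * q < 2 * c by nra.
rewrite /t mulrAC ltr_pdivrMr; last by rewrite ltr_wpDr.
nra.
Qed.

(** The squared distance to K. *)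
Definition d2 x := dotr (x - proj x) (x - proj x).

Lemma d2_ge0 x : 0 <= d2 x. Proof. exact: dotr_ge0. Qed.

Lemma d2D_le x v : d2 (x + v) <= d2 x + 2 * dotr (x - proj x) v + dotr v v.
Proof.
rewrite -dotr_sqD [in leRHS]addrAC.
by rewrite /d2; apply: proj_min; exact: projK.
Qed.

(** Together with [d2D_le], this says that d2 is differentiable with gradient
2 (x - proj x), up to a quadratic error. *)
Lemma d2D_ge x v : d2 x + 2 * dotr (x - proj x) v <= d2 (x + v).
Proof.
rewrite /d2; set q := proj (x + v); set p := proj x.
rewrite (_ : x + v - q = (x - p) + (v + (p - q))); last first.
  by apply/rowP => i; rewrite !mxE; ring.
rewrite [leRHS]dotr_sqD [dotr _ (v + _)]dotrDr.
have := @proj_le0 x q (projK _); rewrite -/p -(opprB p q) dotrNr.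
have := dotr_ge0 (v + (p - q)); lra.
Qed.

Lemma d2_eq0 x : K x -> d2 x = 0.
Proof.
move=> Kx; apply/eqP; rewrite eq_le d2_ge0 andbT.
by have := proj_min x Kx; rewrite subrr dotr0l.
Qed.

Lemma continuous_d2 : continuous d2.
Proof.
have le_dist x y : nrm (x - proj x) <= nrm (x - y) + nrm (y - proj y).
  apply: (@le_trans _ _ (nrm (x - proj y))).
    by rewrite nrm_le ?nrm_ge0// sqr_nrm; apply: proj_min; exact: projK.
  by have := nrmD (x - y) (y - proj y); rewrite addrA subrK.
have cd : continuous (fun x : 'rV[R]_n => nrm (x - proj x)).
  apply: (@lipschitz_continuous _ _ _ _ (Num.sqrt n%:R)) => x y.
  apply: le_trans (nrm_le_mxnorm _); rewrite ler_norml; apply/andP; split.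
    by have h := le_dist y x; rewrite -(opprB x y) nrmN in h; lra.
  by have := le_dist x y; lra.
rewrite (_ : d2 = fun x => nrm (x - proj x) * nrm (x - proj x)); last first.
  by apply/funext => x; rewrite -expr2 sqr_nrm.
by move=> x; exact: (cvgM (cd x) (cd x)).
Qed.

(** By [d2D_ge], from any point of a line d2 is at least its value at that point
in one of the two directions. *)
Lemma d2_quasiconvex x w (a b c : R) : a <= b -> b <= c ->
  d2 (x + b *: w) <= Num.max (d2 (x + a *: w)) (d2 (x + c *: w)).
Proof.
move=> ab bc; set z := x + b *: w.
have h1 := d2D_ge z ((a - b) *: w); have h2 := d2D_ge z ((c - b) *: w).
rewrite dotrZr in h1; rewrite dotrZr in h2.
have ea : z + (a - b) *: w = x + a *: w by rewrite /z -addrA -scalerDl (addrC b) subrK.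
have ec : z + (c - b) *: w = x + c *: w by rewrite /z -addrA -scalerDl (addrC b) subrK.
rewrite ea in h1; rewrite ec in h2; rewrite le_max; apply/orP.
set g := dotr _ w in h1 h2.
have [g0|g0] := leP 0 g.
  by right; apply: le_trans h2; rewrite lerDl !mulr_ge0// subr_ge0.
by left; apply: le_trans h1; rewrite lerDl mulr_ge0// mulr_le0// ?subr_le0// ltW.
Qed.

Variables (dl : R).
Hypothesis dl0 : 0 < dl.

(** It equals 1 on K, vanishes at distance dl or more from K, is quasiconcave, and
has a locally Lipschitz gradient.  The first three properties make it as good as
the indicator function of K for integrals along lines, and the last one provides
a first order expansion with a locally uniform error. *)
Definition bump x : R := Num.max 0 (1 - d2 x / dl ^+ 2) ^+ 2.

Lemma bump_ge0 x : 0 <= bump x. Proof. by rewrite sqr_ge0. Qed.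

Lemma bump_le1 x : bump x <= 1.
Proof.
rewrite expr_le1// ?le_max ?lexx//.
by rewrite ge_max ler01 /= gerBl divr_ge0 ?d2_ge0// sqr_ge0.
Qed.

Lemma bump_eq1 x : K x -> bump x = 1.
Proof.
by move=> Kx; rewrite /bump d2_eq0// mul0r subr0 (max_idPr ler01) expr1n.
Qed.

Lemma bump_neq0 x : bump x != 0 -> nrm (x - proj x) <= dl.
Proof.
move=> fx; rewrite nrm_le; last exact: ltW.
rewrite -/(d2 x) leNgt; apply: contra fx => h.
rewrite /bump (max_idPl _) ?expr0n//.
by rewrite subr_le0 ler_pdivlMr ?exprn_gt0// mul1r ltW.
Qed.

Lemma continuous_bump : continuous bump.
Proof.
have c1 : continuous (fun x : 'rV[R]_n => 1 - d2 x / dl ^+ 2).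
  by move=> x; exact: (cvgB (cvg_cst _) (cvgM (@continuous_d2 x) (cvg_cst _))).
have c2 : continuous (fun x : 'rV[R]_n => Num.max 0 (1 - d2 x / dl ^+ 2)).
  by move=> x; exact: (continuous_max (@cst_continuous _ _ (0 : R) x) (c1 x)).
rewrite (_ : bump = fun x => Num.max 0 (1 - d2 x / dl ^+ 2) * Num.max 0 (1 - d2 x / dl ^+ 2)).
  by move=> x; exact: (cvgM (c2 x) (c2 x)).
by apply/funext => x; rewrite /bump expr2.
Qed.

Lemma bump_quasiconcave x w (a b c : R) : a <= b -> b <= c ->
  Num.min (bump (x + a *: w)) (bump (x + c *: w)) <= bump (x + b *: w).
Proof.
move=> ab bc; have anti u v : u <= v ->
    Num.max 0 (1 - v / dl ^+ 2) ^+ 2 <= Num.max 0 (1 - u / dl ^+ 2) ^+ 2.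
  move=> uv; apply: lerXn2r; [by rewrite nnegrE le_max lexx|by rewrite nnegrE le_max lexx|].
  rewrite ge_max !le_max lexx /=; apply/orP; right.
  by rewrite lerD2l lerN2 ler_pM2r// invr_gt0 exprn_gt0.
have := d2_quasiconvex x w ab bc; rewrite ge_min le_max => /orP[h|h]; apply/orP; [left|right]; exact: anti.
Qed.

Definition grad x := (- (4 * Num.max 0 (1 - d2 x / dl ^+ 2) / dl ^+ 2)) *: (x - proj x).

Lemma bump_smooth (R0 : R) x v : nrm (x - proj x) <= R0 -> nrm v <= 1 ->
  `|bump (x + v) - bump x - dotr (grad x) v| <=
    (2 / dl ^+ 2 + (2 * R0 + 1) ^+ 2 / dl ^+ 4) * nrm v ^+ 2.
Proof.
move=> xR v1; have R00 : 0 <= R0 by apply: le_trans xR; exact: nrm_ge0.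
have e0 : 0 < dl ^+ 2 by rewrite exprn_gt0.
rewrite (_ : dl ^+ 4 = (dl ^+ 2) ^+ 2); last by rewrite -exprM.
rewrite /bump /grad dotrZl; move: (dl ^+ 2) e0 => e e0.
have := d2D_le x v; have := d2D_ge x v; rewrite -sqr_nrm.
have : `|dotr (x - proj x) v| <= R0 * nrm v.
  by apply: (le_trans (dotr_le_nrm _ _)); rewrite ler_wpM2r ?nrm_ge0.
move: (nrm_ge0 v) v1 (d2_ge0 x) (d2_ge0 (x + v)).
move: (nrm v) (dotr (x - proj x) v) (d2 x) (d2 (x + v)) => N g u u' N0 N1 u0 u'0 hg h1 h2.
pose w := 1 - u / e; pose w' := 1 - u' / e.
have psi := sq_pos_part w w'.
have w1 : 0 <= Num.max 0 w <= 1.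
  rewrite le_max lexx ge_max ler01 /= /w.
  by rewrite gerBl divr_ge0// ltW.
rewrite -/w -/w'; move: psi w1; set W := Num.max 0 w; set W' := Num.max 0 w' => /andP[p1 p2] /andP[W0 W1].
have dw : w' - w = - ((u' - u) / e) by rewrite /w /w'; ring.
pose th := u' - u - 2 * g.
have th0 : 0 <= th by rewrite /th; lra.
have th1 : th <= N ^+ 2 by rewrite /th; lra.
have eq1 : W' ^+ 2 - W ^+ 2 - - (4 * W / e) * g =
   (W' ^+ 2 - W ^+ 2 - 2 * W * (w' - w)) - 2 * W * th / e.
  by rewrite dw /th; field; rewrite gt_eqF.
rewrite eq1.
have du : (w' - w) ^+ 2 <= (2 * R0 + 1) ^+ 2 / e ^+ 2 * N ^+ 2.
  rewrite dw sqrrN expr_div_n [leRHS]mulrAC; apply: ler_wpM2r.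
    by rewrite invr_ge0 exprn_ge0// ltW.
  rewrite -exprMn -real_normK ?num_real// ler_sqr ?nnegrE//; last first.
    by rewrite mulr_ge0// addr_ge0// mulr_ge0.
  rewrite (_ : u' - u = 2 * g + th); last by rewrite /th; ring.
  apply: (le_trans (ler_normD _ _)); rewrite normrM (ger0_norm th0) ger0_norm//.
  have N2 : N ^+ 2 <= N by nra.
  by lra.
have b2 : 2 * W * th / e <= 2 / e * N ^+ 2.
  rewrite [leRHS]mulrAC; apply: ler_wpM2r; first by rewrite invr_ge0 ltW.
  by have := ler_wpM2r th0 W1; lra.
have b2' : 0 <= 2 * W * th / e by rewrite divr_ge0 ?(ltW e0)// !mulr_ge0.
have c0 : 0 <= 2 / e * N ^+ 2 by rewrite mulr_ge0 ?sqr_ge0// divr_ge0// ltW.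
have c1 : 0 <= (w' - w) ^+ 2 by rewrite sqr_ge0.
rewrite ler_norml mulrDl; apply/andP; split; lra.
Qed.

End distance.
End convex.

(** * Averages of the volumes of shadows *)

Section transfer.
Context (R : realType).
Local Notation T := (measurableTypeR R).
Local Notation leb := (@lebesgue_measure R).
Local Notation mu := (lebesgue_tuple R).

Lemma box_nrm n (r : R) : 0 <= r -> exists2 M, 0 <= M & forall x : 'rV[R]_n, box r x -> nrm x <= M.
Proof.
move=> r0; exists (Num.sqrt (n%:R * r ^+ 2)); first exact: sqrtr_ge0.
move=> x xr; rewrite nrm_le ?sqrtr_ge0// sqr_sqrtr; last by rewrite mulr_ge0 ?sqr_ge0.
rewrite dotrE mulr_natl -[X in _ *+ X](card_ord n) -sumr_const.
by apply: ler_sum => i _; rewrite -expr2 -real_normK ?num_real// ler_sqr ?nnegrE.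
Qed.

Lemma compact_nrm n (K : set 'rV[R]_n) : compact K -> exists2 r, 0 <= r & forall x, K x -> nrm x <= r.
Proof.
move=> /compact_box[r r0 Kr]; have [M M0 hM] := box_nrm n r0.
by exists M => // x /Kr/hM.
Qed.

(** From E <x, e>^2 = |x|^2, by the inequality between arithmetic and geometric
means. *)
Lemma Es_abs_dotr n (x : 'rV[R]_n) : Es (fun e => `|dotr x e|) <= nrm x.
Proof.
have [->|x0] := eqVneq x 0.
  by rewrite nrm0 -(Es_cst n 0); apply: Es_le => e _; rewrite dotr0l normr0.
have nx0 := nrm_gt0 x0.
apply: (@le_trans _ _ (Es (fun e => (2 * nrm x)^-1 * dotr x e ^+ 2 + nrm x / 2))).
  apply: Es_le => e _; rewrite -[dotr x e ^+ 2]real_normK ?num_real//.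
  move: (nrm x) `|dotr x e| nx0 => v u v0; rewrite -subr_ge0.
  rewrite (_ : _ - _ = (u - v) ^+ 2 / (2 * v)); last by field; rewrite gt_eqF.
  by rewrite divr_ge0 ?sqr_ge0// mulr_ge0// ltW.
rewrite EsD Es_cst EsZ Es_dotr2 -sqr_nrm.
by rewrite le_eqVlt; apply/orP; left; apply/eqP; field; rewrite gt_eqF.
Qed.

Lemma compact_scale n (c : R) (K : set 'rV[R]_n) : compact K -> compact ((fun x => c *: x) @` K).
Proof.
move=> cK; rewrite (_ : (fun x => c *: x) = (fun x => x *m c%:M)); last first.
  by apply/funext => x; rewrite mul_mx_scalar.
by apply: continuous_compact => //; apply: continuous_subspaceT; exact: continuous_mulmx.
Qed.

Section body.
Variables (m : nat) (K : set 'rV[R]_m.+1) (r eta : R).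
Hypotheses (cK : compact K) (vK : cvx K) (K0 : K !=set0).
Hypotheses (r0 : 0 < r) (Kr : forall x, nrm x <= r -> K x).
Hypotheses (eta0 : 0 < eta) (eta1 : eta < 1).

Let dl := eta * r.
Let dl0 : 0 < dl. Proof. by rewrite mulr_gt0. Qed.
Let f := bump cK K0 dl.
Let f_ge0 x : 0 <= f x. Proof. exact: bump_ge0. Qed.
Let f_le1 x : f x <= 1. Proof. exact: bump_le1. Qed.
Let f_cont : continuous f. Proof. exact: continuous_bump. Qed.
Let f_meas : mfun f. Proof. exact: (measurable_continuous f_cont). Qed.

(** Since K contains the ball of radius r, the points at distance at most eta r
from K belong to (1 + eta) K. *)
Lemma bump_supp x : f x != 0 -> exists2 z, K z & x = (1 + eta) *: z.
Proof.
move=> /bump_neq0 -/(_ dl0) h; set p := proj _ _ _ in h.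
have e1 : 0 < 1 + eta by rewrite addr_gt0.
exists ((1 + eta)^-1 *: x); last by rewrite scalerA mulfV ?scale1r// gt_eqF.
have -> : (1 + eta)^-1 *: x = (1 + eta)^-1 *: p + (1 - (1 + eta)^-1) *: (eta^-1 *: (x - p)).
  apply/rowP => i; rewrite !mxE; field; apply/andP; split; rewrite gt_eqF//.
apply: vK.
- by rewrite invr_ge0 ltW.
- by rewrite invf_le1// lerDl ltW.
- exact: projK.
- apply: Kr; rewrite nrmZ ger0_norm ?invr_ge0 ?(ltW eta0)//.
  by rewrite mulrC ler_pdivrMr// mulrC.
Qed.

(** Since K contains the ball of radius r, the neighborhood of (1 - eta) K of
radius eta r is included in K. *)
Lemma shrink_nbhd z w : K z -> nrm w <= dl -> K ((1 - eta) *: z + w).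
Proof.
move=> Kz hw.
have -> : w = (1 - (1 - eta)) *: (eta^-1 *: w).
  by rewrite scalerA opprB addrC subrK mulfV ?scale1r// gt_eqF.
apply: vK => //; first by rewrite subr_ge0 ltW.
  by rewrite gerBl ltW.
by apply: Kr; rewrite nrmZ ger0_norm ?invr_ge0 ?(ltW eta0)// mulrC ler_pdivrMr// mulrC.
Qed.

Lemma bump_bounded : exists2 M, 0 <= M & forall x, f x != 0 -> nrm x <= M.
Proof.
have [r1 r10 hr1] := compact_nrm cK.
have e1 : 0 <= 1 + eta by rewrite addr_ge0// ltW.
exists ((1 + eta) * r1); first by rewrite mulr_ge0.
move=> x /bump_supp[z /hr1 hz ->].
by rewrite nrmZ ger0_norm// ler_wpM2l.
Qed.

Lemma tame_bump : tame f.
Proof.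
split => //; have [M M0 hM] := bump_bounded; exists 1, M; split => // x.
rewrite mul1r; have [fx|/hM fx] := eqVneq (f x) 0; first by rewrite fx.
rewrite indicE mem_set// => i; exact: le_trans (coord_le_nrm _ _) fx.
Qed.

Let tame_diff v : tame (fun x => `|f (x + v) - f x|).
Proof.
apply: (@tame_le _ _ _ (fun x => f (x + v) + f x)) => //.
- by apply: tameD; [exact: (tame_shift _ tame_bump)|exact: tame_bump].
- exact: (measurableT_comp (@normr_measurable _ setT) (measurable_funB (mfun_shift _ f_meas) f_meas)).
- by move=> x; rewrite (le_trans (ler_normB _ _))// !ger0_norm ?f_ge0.
Qed.

Section direction.
Variables (xi : 'rV[R]_m.+1) (s : R).
Hypotheses (xi1 : sphere xi) (s0 : 0 <= s).
Let U := hyperplane_frame xi.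
Let h := vol (shadow xi K).
Let g x := Num.max (f (x + s *: xi)) (f x).
Let phi (y : 'rV[R]_m) (a : T) : R := f (a *: xi + y *m U).

Let phi_meas y : measurable_fun setT (phi y).
Proof. apply: (@continuous_measurable_fun R (phi y)); exact: continuous_line. Qed.

Let phi_ge0 y : (0 <= lint (phi y))%E.
Proof. by apply: integral_ge0 => a _; rewrite lee_fin; exact: f_ge0. Qed.

Let g_meas : mfun g.
Proof. exact: (measurable_maxr (mfun_shift _ f_meas) f_meas). Qed.

Let g_ge0 x : 0 <= g x. Proof. by rewrite le_max f_ge0. Qed.

Let gE y (a : R) : g (a *: xi + y *m U) = Num.max (phi y (a + s : R)) (phi y a).
Proof. by rewrite /g /phi scalerDl addrAC. Qed.

Let shadow_fin (c : R) : 0 < c ->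
  lvol [set c *: x | x in shadow xi K] = (c ^+ m * h)%:E.
Proof.
move=> c0; have cS := compact_shadow (xi := xi) cK.
rewrite lvol_scale//; last exact: mset_compact.
by rewrite /h volE EFinM fineK// lvol_fin.
Qed.

Let add_indic (P : set 'rV[R]_m) : mset P ->
  (\int[mu m]_y (lint (phi (rowt y)) + (s * \1_P (rowt y))%:E) = eint f + s%:E * lvol P)%E.
Proof.
move=> mP; rewrite ge0_integralD//.
- congr (_ + _)%E; first by rewrite (fubini_frame xi1).
  under eq_integral do rewrite EFinM.
  rewrite ge0_integralZl//; [by rewrite integral_set|exact: measurable_set_indic].
- exact: measurable_line_integral.
- by move=> y _; rewrite lee_fin mulr_ge0.
- apply/measurable_EFinP; apply: measurable_funM; first exact: measurable_cst.
  by apply/measurable_EFinP; exact: measurable_set_indic.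
Qed.

Let measurable_rhs (P : set 'rV[R]_m) : mset P ->
  measurable_fun setT (fun y : m.-tuple T => (lint (phi (rowt y)) + (s * \1_P (rowt y))%:E)%E).
Proof.
move=> mP; apply: emeasurable_funD; first exact: measurable_line_integral.
apply/measurable_EFinP; apply: measurable_funM; first exact: measurable_cst.
by apply/measurable_EFinP; exact: measurable_set_indic.
Qed.

Let rhs_ge0 (P : set 'rV[R]_m) (y : 'rV[R]_m) : (0 <= lint (phi y) + (s * \1_P y)%:E)%E.
Proof.
by rewrite adde_ge0// lee_fin mulr_ge0.
Qed.

(** By Fubini in the direction xi: on each line the integral of the maximum
exceeds that of f by at most s ([lint_max_le]), and it does so only on the lines
that meet (1 + eta) K. *)
Lemma eint_max_le : (eint g <= eint f + (s * ((1 + eta) ^+ m * h))%:E)%E.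
Proof.
have e1 : 0 < 1 + eta by rewrite addr_gt0.
pose P := [set (1 + eta) *: x | x in shadow xi K].
have mP : mset P by apply: mset_compact; apply: compact_scale; exact: compact_shadow.
rewrite EFinM -(shadow_fin e1) -/P -add_indic// (fubini_frame xi1)//.
apply: ge0_le_integral => //.
- by move=> y _; apply: integral_ge0 => a _; rewrite lee_fin.
- exact: measurable_line_integral.
- exact: measurable_rhs.
move=> y _; under eq_integral do rewrite gE.
rewrite -[X in (X <= _)%E]/(lint (fun a => Num.max (phi (rowt y) (a + s)%R) (phi (rowt y) a))).
have [[a0 fa0]|nz] := pselect (exists a, phi (rowt y) a != 0); last first.
  have phi0 a : phi (rowt y) a = 0.
    by apply/eqP; apply: contrapT => /negP h1; apply: nz; exists a.
  rewrite (_ : (fun a => _) = fun=> 0); last first.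
    by apply/funext => a; rewrite !phi0 maxxx.
  by rewrite {1}/lint integral0; exact: rhs_ge0.
have Py : P (rowt y).
  have [z Kz hz] := bump_supp fa0.
  exists (z *m U^T); first by exists z.
  by rewrite scalemxAl -hz; exact: (frameE xi1 a0 (rowt y)).2.
rewrite indicE mem_set// mulr1.
have [M M0 hM] := bump_bounded.
have out a : ~~ (- M <= a <= M) -> phi (rowt y) a = 0.
  move=> aM; apply/eqP; apply: contraNT aM => /hM h1.
  rewrite -ler_norml -[a](frameE xi1 a (rowt y)).1.
  apply: (le_trans (dotr_le_nrm _ _)).
  by rewrite (_ : nrm xi = 1) ?mulr1// /nrm xi1 sqrtr1.
have [||c cM hc] := @EVT_max R (phi (rowt y)) (- M) M.
- lra.
- by apply: continuous_subspaceT; exact: continuous_line.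
refine (lint_max_le (t0 := c) (phi_meas _) s0 _ _ _).
- by move=> a; rewrite /phi f_ge0 f_le1.
- move=> a; have [aM|aM] := boolP (- M <= a <= M).
    by apply: hc; rewrite in_itv.
  by rewrite (out _ aM); exact: f_ge0.
- move=> a b d ab bd; rewrite /phi !(addrC (_ *: xi)).
  exact: bump_quasiconcave.
Qed.

(** By Fubini in the direction xi: each line that meets (1 - eta) K contains a
segment of length s on which f equals 1 ([lint_max_ge]). *)
Lemma eint_max_ge : s <= dl -> (eint f + (s * ((1 - eta) ^+ m * h))%:E <= eint g)%E.
Proof.
move=> sdl; have e1 : 0 < 1 - eta by rewrite subr_gt0.
pose P := [set (1 - eta) *: x | x in shadow xi K].
have mP : mset P by apply: mset_compact; apply: compact_scale; exact: compact_shadow.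
rewrite EFinM -(shadow_fin e1) -/P -add_indic// (fubini_frame xi1 g_meas)//.
apply: ge0_le_integral => //.
- by apply: measurable_rhs.
- exact: measurable_line_integral.
move=> y _; under [leRHS]eq_integral do rewrite gE.
rewrite -[X in (_ <= X)%E]/(lint (fun a => Num.max (phi (rowt y) (a + s)%R) (phi (rowt y) a))).
have [Py|nPy] := pselect (P (rowt y)); last first.
  rewrite indicE memNset// mulr0 adde0; apply: le_lint => //.
  - by apply: measurable_maxr => //; exact: measurable_fun_shift.
  - by move=> a; exact: f_ge0.
  - by move=> a; move: (phi (rowt y) (a + s)) (phi (rowt y) a) => v u; rewrite le_max lexx orbT.
rewrite indicE mem_set// mulr1.
have [z /shadowP -/(_ xi1)[b Kb] hy] := Py.
apply: (@lint_max_ge _ _ _ ((1 - eta) * b)) => //.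
  by move=> a; exact: f_ge0.
move=> a /andP[ab1 ab2]; rewrite /phi; apply: bump_eq1.
rewrite -hy -scalemxAl.
have -> : a *: xi + (1 - eta) *: (z *m U) =
   (1 - eta) *: (b *: xi + z *m U) + (a - (1 - eta) * b) *: xi.
  by rewrite scalerDr scalerA addrAC -scalerDl [_ * b + _]addrC subrK.
apply: shrink_nbhd => //; rewrite nrmZ (_ : nrm xi = 1) ?mulr1; last by rewrite /nrm xi1 sqrtr1.
by rewrite ger0_norm ?subr_ge0//; lra.
Qed.

Let tame_g : tame g.
Proof.
apply: (@tame_le _ _ _ (fun x => f (x + s *: xi) + f x)) => //.
  by apply: tameD; [exact: (tame_shift _ tame_bump)|exact: tame_bump].
by move=> x; rewrite ge_max lerDl lerDr !f_ge0.
Qed.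

(** As |u - v| = 2 max(u, v) - u - v and the integral is invariant under shifts,
this follows from the bounds on the integral of the maximum: the L^1 norm of
a small difference of f is about 2 s times the volume of the shadow. *)
Lemma rint_diff_bounds :
  rint (fun x => `|f (x + s *: xi) - f x|) <= 2 * (s * ((1 + eta) ^+ m * h)) /\
  (s <= dl -> 2 * (s * ((1 - eta) ^+ m * h)) <= rint (fun x => `|f (x + s *: xi) - f x|)).
Proof.
have E : rint (fun x => `|f (x + s *: xi) - f x|) + (rint f + rint f) = 2 * rint g.
  rewrite -{1}(rint_shift (s *: xi) tame_bump) -rintD; [|exact: tame_shift tame_bump|exact: tame_bump].
  rewrite -rintD//; last by apply: tameD; [exact: (tame_shift _ tame_bump)|exact: tame_bump].
  rewrite -rintZ//; congr rint; apply/funext => x; rewrite /g.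
  have [h1|h1] := leP (f (x + s *: xi)) (f x).
    by rewrite ler0_norm ?subr_le0//; ring.
  by rewrite gtr0_norm ?subr_gt0//; ring.
split.
  have := eint_max_le; rewrite !rintE//; try exact: tame_bump; rewrite -EFinD lee_fin; lra.
move=> /eint_max_ge; rewrite !rintE//; try exact: tame_bump; rewrite -EFinD lee_fin; lra.
Qed.

End direction.

Let q : R := Num.sqrt m.+1%:R.
Let q0 : 0 < q. Proof. by rewrite sqrtr_gt0. Qed.

Let unit_sign e : e \in signs R m.+1 -> sphere (q^-1 *: e).
Proof. exact: sphere_sign. Qed.

(** To the first order, the difference is s <g, e> for g the gradient of f at x.
The average of |<g, e>| over all signs is at most |g|, which the hypothesis
bounds by a multiple of the average over E.  The second order errors are uniform and
supported in a fixed box. *)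
Lemma sign_differences (E : seq 'rV[R]_m.+1) (c : R) : 0 < c -> (0 < size E)%N ->
  {subset E <= signs R m.+1} ->
  (forall x, c * (size E)%:R * nrm x <= \sum_(e <- E) `|dotr x e|) ->
  exists C b, [/\ 0 <= C, 0 <= b & forall s, 0 < s -> s * q <= 1 -> forall x,
    Es (fun e => `|f (x + s *: e) - f x|) <=
    (c * (size E)%:R)^-1 * (\sum_(e <- E) `|f (x + s *: e) - f x|) +
    C * s ^+ 2 * \1_(box b) x].
Proof.
move=> c0 sE Esub hE.
have N0 : 0 < (size E)%:R :> R by rewrite ltr0n.
have [M M0 hM] := bump_bounded.
have [r1 r10 hr1] := compact_nrm cK.
have [r2 r20 hr2] := box_nrm m.+1 (addr_ge0 M0 ler01).
pose C0 := (2 / dl ^+ 2 + (2 * (r2 + r1) + 1) ^+ 2 / dl ^+ 4) * q ^+ 2.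
have C00 : 0 <= C0 by rewrite mulr_ge0 ?sqr_ge0// addr_ge0// divr_ge0 ?exprn_ge0 ?(ltW dl0)// ?addr_ge0// mulr_ge0// addr_ge0.
exists (C0 * (1 + c^-1)), (M + 1); split.
- by rewrite mulr_ge0// addr_ge0// invr_ge0 ltW.
- by rewrite addr_ge0.
move=> s s0 sq x.
have nrm_se e : e \in signs R m.+1 -> nrm (s *: e) = s * q.
  by move=> /signs_nrm he; rewrite nrmZ he ger0_norm// ltW.
have k0 : 0 < c * (size E)%:R by rewrite mulr_gt0.
have rhs0 : 0 <= (c * (size E)%:R)^-1 * (\sum_(e <- E) `|f (x + s *: e) - f x|).
  by rewrite mulr_ge0 ?invr_ge0 ?(ltW k0)// sumr_ge0.
have [xb|xb] := pselect (box (M + 1) x); last first.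
  rewrite indicE memNset// mulr0 addr0; apply: le_trans rhs0.
  rewrite -(Es_cst m.+1 0); apply: Es_le => e eS.
  have nx : M + 1 < nrm x.
    rewrite ltNge; apply/negP => h; apply: xb => i.
    exact: le_trans (coord_le_nrm _ _) h.
  have fx : f x = 0.
    by apply/eqP; apply: contrapT => /negP/hM h; move: nx; lra.
  have fxe : f (x + s *: e) = 0.
    apply/eqP; apply: contrapT => /negP/hM h.
    have := nrmB (x + s *: e) (s *: e); rewrite addrK nrm_se//.
    by move=> h'; move: h h' nx sq; lra.
  by rewrite fx fxe subrr normr0.
rewrite indicE mem_set// mulr1.
pose G := grad cK K0 dl x.
have smooth e : e \in signs R m.+1 ->
    `|f (x + s *: e) - f x - s * dotr G e| <= C0 * s ^+ 2.
  move=> eS; rewrite -dotrZr /C0 -mulrA [q ^+ 2 * _]mulrC -exprMn -(nrm_se e)//.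
  apply: bump_smooth => //; last by rewrite nrm_se.
  by apply: (le_trans (nrmB _ _)); apply: lerD; [exact: hr2|exact: (hr1 _ (projK _ _ _))].
have up : Es (fun e => `|f (x + s *: e) - f x|) <= s * nrm G + C0 * s ^+ 2.
  apply: (@le_trans _ _ (Es (fun e => s * `|dotr G e| + C0 * s ^+ 2))).
    apply: Es_le => e /smooth h.
    have -> : s * `|dotr G e| = `|s * dotr G e| by rewrite normrM (ger0_norm (ltW s0)).
    by rewrite -lerBlDl; apply: le_trans h; exact: lerB_dist.
  rewrite EsD Es_cst EsZ lerD2r ler_wpM2l ?(ltW s0)//.
  exact: Es_abs_dotr.
apply: (le_trans up).
have low : s * nrm G <= (c * (size E)%:R)^-1 *
    (\sum_(e <- E) (`|f (x + s *: e) - f x| + C0 * s ^+ 2)).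
  rewrite ler_pdivlMl// mulrCA.
  apply: (@le_trans _ _ (s * \sum_(e <- E) `|dotr G e|)).
    by rewrite ler_wpM2l ?(ltW s0).
  rewrite mulr_sumr big_seq [leRHS]big_seq; apply: ler_sum => e /Esub/smooth h.
  have -> : s * `|dotr G e| = `|s * dotr G e| by rewrite normrM (ger0_norm (ltW s0)).
  rewrite -lerBlDl; apply: le_trans h.
  by rewrite [leRHS]distrC; exact: lerB_dist.
apply: (le_trans (lerD low (lexx _))).
rewrite big_split/= big_const_seq count_predT iter_addr_0 mulrDr -addrA lerD2l.
rewrite le_eqVlt; apply/orP; left; apply/eqP; rewrite -mulr_natr; field.
by rewrite !gt_eqF.
Qed.

(** Integrate [sign_differences], apply [rint_diff_bounds] on both sides, divide
by s and let s tend to 0. *)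
Lemma avg_shadow_le_eta (E : seq 'rV[R]_m.+1) (c A : R) : 0 < c -> (0 < size E)%N ->
  {subset E <= signs R m.+1} ->
  (forall x, c * (size E)%:R * nrm x <= \sum_(e <- E) `|dotr x e|) ->
  (forall e, e \in E -> vol (shadow (q^-1 *: e) K) <= A) ->
  (1 - eta) ^+ m * Es (fun e => vol (shadow (q^-1 *: e) K)) <= (1 + eta) ^+ m * (A / c).
Proof.
move=> c0 sE Esub hE hA.
have N0 : 0 < (size E)%:R :> R by rewrite ltr0n.
have k0 : 0 < c * (size E)%:R by rewrite mulr_gt0.
have e1 : 0 < 1 + eta by rewrite addr_gt0.
have [C [b [C0 b0 hC]]] := sign_differences c0 sE Esub hE.
pose V := C * (b + b) ^+ m.+1.
have V0 : 0 <= V by rewrite mulr_ge0// exprn_ge0// addr_ge0.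
pose I s e := rint (fun x => `|f (x + s *: e) - f x|).
have main s : 0 < s -> s * q <= 1 -> Es (I s) <=
    (c * (size E)%:R)^-1 * (\sum_(e <- E) I s e) + s ^+ 2 * V.
  move=> s0 sq.
  have ik : 0 <= (c * (size E)%:R)^-1 by rewrite invr_ge0 ltW.
  have i2 : 0 <= (2 ^+ m.+1)^-1 :> R by rewrite invr_ge0 exprn_ge0.
  have T1 : tame (fun x => Es (fun e => `|f (x + s *: e) - f x|)).
    by rewrite /Es; apply: tameZ => //; apply: tame_sum => e; exact: tame_diff.
  have T2 : tame (fun x => (c * (size E)%:R)^-1 * (\sum_(e <- E) `|f (x + s *: e) - f x|)).
    by apply: tameZ => //; apply: tame_sum => e; exact: tame_diff.
  have Cs0 : 0 <= C * s ^+ 2 by rewrite mulr_ge0 ?sqr_ge0.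
  have T3 := @tame_box R m.+1 _ _ Cs0 b0.
  have -> : Es (I s) = rint (fun x => Es (fun e => `|f (x + s *: e) - f x|)).
    rewrite /Es rintZ//; last by apply: tame_sum => e; exact: tame_diff.
    by rewrite (rint_sum _ (fun e => tame_diff (s *: e))).
  have -> : \sum_(e <- E) I s e = rint (fun x => \sum_(e <- E) `|f (x + s *: e) - f x|).
    by rewrite (rint_sum _ (fun e => tame_diff (s *: e))).
  rewrite -rintZ//; last by apply: tame_sum => e; exact: tame_diff.
  have -> : s ^+ 2 * V = rint (fun x : 'rV[R]_m.+1 => C * s ^+ 2 * \1_(box b) x).
    by rewrite /rint eint_box//= /V; ring.
  rewrite -rintD//; apply: le_rint => //; first exact: tameD.
  exact: hC.
have IE s e : I s e = rint (fun x => `|f (x + (s * q) *: (q^-1 *: e)) - f x|).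
  by rewrite scalerA mulfK ?gt_eqF.
have key s : 0 < s -> s * q <= 1 -> s * q <= dl ->
  (1 - eta) ^+ m * Es (fun e => vol (shadow (q^-1 *: e) K)) <=
  (1 + eta) ^+ m * (A / c) + s * (V / (2 * q)).
  move=> s0 sq sdl; have sq0 : 0 < s * q by rewrite mulr_gt0.
  have low : 2 * (s * q) * ((1 - eta) ^+ m * Es (fun e => vol (shadow (q^-1 *: e) K))) <= Es (I s).
    rewrite [leLHS]mulrA -EsZ.
    apply: (@Es_le R m.+1 (fun e => 2 * (s * q) * (1 - eta) ^+ m * vol (shadow (q^-1 *: e) K)) (I s)).
    move=> e /unit_sign eS; rewrite IE.
    have [_ /(_ sdl)] := rint_diff_bounds eS (ltW sq0).
    by rewrite -!mulrA.
  have up : (c * (size E)%:R)^-1 * (\sum_(e <- E) I s e) <= 2 * (s * q) * ((1 + eta) ^+ m * (A / c)).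
    rewrite ler_pdivrMl//.
    apply: (@le_trans _ _ (\sum_(e <- E) 2 * (s * q) * ((1 + eta) ^+ m * A))).
      rewrite big_seq [leRHS]big_seq; apply: ler_sum => e eE; rewrite IE.
      have [+ _] := rint_diff_bounds (unit_sign (Esub _ eE)) (ltW sq0).
      move=> /le_trans; apply; rewrite -!mulrA ler_pM2l// !ler_pM2l ?exprn_gt0//.
      exact: hA.
    rewrite big_const_seq count_predT iter_addr_0 -mulr_natr.
    by rewrite le_eqVlt; apply/orP; left; apply/eqP; field; rewrite gt_eqF.
  have := main s s0 sq; move: low up.
  set X := (1 - eta) ^+ m * _; set Y := (1 + eta) ^+ m * _ => low up h.
  rewrite -(@ler_pM2l _ (2 * (s * q))) ?mulr_gt0// mulrDr.
  have -> : 2 * (s * q) * (s * (V / (2 * q))) = s ^+ 2 * V by field; rewrite gt_eqF.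
  by apply: (le_trans low); apply: (le_trans h); rewrite lerD2r.
apply/ler_addgt0Pr => e e0.
pose W := V / (2 * q) + 1.
have W0 : 0 < W by rewrite ltr_wpDl// divr_ge0// mulr_ge0// ltW.
pose s := Num.min (e / W) (Num.min (1 / q) (dl / q)).
have s0 : 0 < s by rewrite !lt_min !divr_gt0.
have s1 : s * q <= 1 by rewrite -ler_pdivlMr// !ge_min lexx orbT.
have s2 : s * q <= dl by rewrite -ler_pdivlMr// !ge_min lexx !orbT.
apply: (le_trans (key s s0 s1 s2)); rewrite lerD2l.
apply: (@le_trans _ _ (s * W)); first by rewrite ler_pM2l// lerDl.
by rewrite -ler_pdivlMr// ge_min lexx.
Qed.

End body.

Lemma bernoulli (m : nat) (x : R) : 0 <= x <= 1 -> 1 - m%:R * x <= (1 - x) ^+ m.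
Proof.
move=> /andP[x0 x1]; elim: m => [|m IH]; first by rewrite mul0r subr0 expr0.
have h : 0 <= 1 - x by rewrite subr_ge0.
rewrite exprS; apply: le_trans (ler_wpM2l h IH); rewrite -natr1.
have : 0 <= m%:R * (x * x) by rewrite !mulr_ge0.
by move: (m%:R) => k; rewrite -subr_ge0 (_ : _ * _ - _ = k * (x * x)) //; ring.
Qed.

(** [avg_shadow_le_eta] with eta = 1 / (2 (m + 1)), for which the powers of
1 + eta and of 1 - eta are bounded by constants. *)
Lemma avg_shadow_le m (K : set 'rV[R]_m.+1) (r : R) (E : seq 'rV[R]_m.+1) (c A : R) :
  let h e := vol (shadow ((Num.sqrt m.+1%:R)^-1 *: e) K) in
  compact K -> cvx K -> 0 < r -> (forall x, nrm x <= r -> K x) ->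
  0 < c -> (0 < size E)%N -> {subset E <= signs R m.+1} ->
  (forall x, c * (size E)%:R * nrm x <= \sum_(e <- E) `|dotr x e|) ->
  (forall e, e \in E -> h e <= A) ->
  Es h <= 4 * (A / c).
Proof.
move=> h cK vK r0 Kr c0 sE Esub hE hA.
have K0 : K !=set0 by exists 0; apply: Kr; rewrite nrm0 ltW.
have A0 : 0 <= A.
  case: E sE Esub hE hA => // e E _ _ _ hA.
  by apply: le_trans (hA e (mem_head _ _)); rewrite fine_ge0// lvol_ge0.
pose eta : R := (2 * m.+1%:R)^-1.
have m0 : 0 < m.+1%:R :> R by rewrite ltr0n.
have eta0 : 0 < eta by rewrite invr_gt0 mulr_gt0.
have etam : m%:R * eta <= 1 / 2.
  rewrite /eta ler_pdivrMr ?mulr_gt0//.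
  have : m%:R <= m.+1%:R :> R by rewrite ler_nat.
  by move: (m%:R : R) (m.+1%:R : R) => k l; lra.
have eta1 : eta < 1.
  have : 1 <= m.+1%:R :> R by rewrite ler1n.
  by rewrite /eta invf_lt1 ?mulr_gt0//; move: m.+1%:R => k; lra.
have := avg_shadow_le_eta cK vK K0 r0 Kr eta0 eta1 c0 sE Esub hE hA.
have lo : 1 / 2 <= (1 - eta) ^+ m.
  apply: le_trans (bernoulli m _); last by rewrite !ltW.
  by lra.
have up : (1 + eta) ^+ m <= 2.
  have e1 : 0 < 1 + eta by rewrite addr_gt0.
  have : (1 + eta) ^+ m * (1 - eta) ^+ m <= 1.
    rewrite -exprMn (_ : _ * _ = 1 - eta * eta); last by ring.
    have e2 : eta * eta <= 1 by rewrite mulr_ile1// ltW.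
    by rewrite exprn_ile1// ?subr_ge0// gerBl mulr_ge0// ltW.
  move=> h1; have : (1 + eta) ^+ m * (1 / 2) <= 1.
    by apply: le_trans h1; rewrite ler_wpM2l// exprn_ge0// ltW.
  lra.
move=> H; have Es0 : 0 <= Es h.
  rewrite -(Es_cst m.+1 0); apply: Es_le => e _.
  by rewrite fine_ge0// lvol_ge0.
have Ac : 0 <= A / c by rewrite divr_ge0// ltW.
have := ler_wpM2r Es0 lo; have := ler_wpM2r Ac up; rewrite -/h in H.
by move: H; set X := Es h; set Y := A / c; lra.
Qed.
End transfer.

(** * Symmetric bodies, support functions and coverings *)

Section symmetric_bodies.
Context (R : realType).

Lemma continuous_dotl n (e : 'rV[R]_n) : continuous (fun x : 'rV[R]_n => dotr x e).
Proof.
apply: (@lipschitz_continuous _ _ _ _ (Num.sqrt n%:R * nrm e)) => x y.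
rewrite -dotrBl; apply: (le_trans (dotr_le_nrm _ _)).
rewrite mulrAC ler_wpM2r ?nrm_ge0//; exact: nrm_le_mxnorm.
Qed.

Lemma closed_le_fun n (g : 'rV[R]_n -> R) c : continuous g -> closed [set x | g x <= c].
Proof. by move=> cg; apply: (closed_comp (f := g) (D := [set r | r <= c])); [move=> x _; exact: cg|exact: closed_le]. Qed.

Lemma compact_nrm_le n (K : set 'rV[R]_n) (r : R) : closed K -> (forall x, K x -> nrm x <= r) -> compact K.
Proof.
move=> clK Kr; apply: bounded_closed_compact => //.
exists r; split; first by rewrite num_real.
move=> M rM x Kx; apply: le_trans (ltW rM); apply: le_trans (Kr x Kx).
exact: mxnorm_le_nrm.
Qed.

Lemma interior_ball n (K : set 'rV[R]_n) (r : R) : 0 < r -> (forall x, nrm x <= r -> K x) -> K° !=set0.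
Proof.
move=> r0 Kr; exists 0; apply/nbhs_ballP.
exists (r / (Num.sqrt n%:R + 1)) => /=; first by rewrite divr_gt0// ltr_wpDl ?sqrtr_ge0.
move=> y; rewrite -ball_normE/= sub0r normrN => hy; apply: Kr.
apply: (le_trans (nrm_le_mxnorm y)).
have s0 : 0 <= Num.sqrt n%:R :> R := sqrtr_ge0 _.
apply: (@le_trans _ _ ((Num.sqrt n%:R + 1) * `|y|)).
  by rewrite ler_wpM2r// lerDl.
by rewrite mulrC -ler_pdivlMr ?ltW// ltr_wpDl.
Qed.

Lemma symN n (K : set 'rV[R]_n) x : origin_symmetric K -> K x -> K (- x).
Proof. by move=> sK Kx; rewrite sK; exists x. Qed.

(** If K contains the ball of center x0 and radius e, it contains the opposite
ball, hence the midpoints of the two. *)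
Lemma symmetric_ball n (K : set 'rV[R]_n) : cvx K -> origin_symmetric K -> K° !=set0 ->
  exists2 r, 0 < r & forall x, nrm x <= r -> K x.
Proof.
move=> vK sK [x0 /nbhs_ballP[e /= e0 he]]; exists (e / 2); first by rewrite divr_gt0.
move=> z nz; have ze : `|z| < e.
  by apply: (le_lt_trans (mxnorm_le_nrm z)); apply: (le_lt_trans nz); lra.
have K1 : K (x0 + z) by apply: he; rewrite -ball_normE/= opprD addNKr normrN.
have K2 : K (z - x0).
  rewrite -opprB; apply: symN => //.
  by apply: he; rewrite -ball_normE/= subKr.
have -> : z = 2^-1 *: (x0 + z) + (1 - 2^-1) *: (z - x0).
  by apply/rowP => i; rewrite !mxE; field.
by apply: vK => //; rewrite ?invr_ge0//; lra.
Qed.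

Lemma compact_support n (D : set 'rV[R]_n) x : compact D -> has_ubound [set dotr x y | y in D].
Proof.
move=> /compact_nrm[r r0 hr]; exists (nrm x * r) => _ [y Dy <-].
by apply: (le_trans (ler_norm _)); apply: (le_trans (dotr_le_nrm _ _)); rewrite ler_wpM2l ?nrm_ge0// hr.
Qed.

Lemma le_support n (D : set 'rV[R]_n) x y : compact D -> D y -> dotr x y <= support_fun D x.
Proof. by move=> cD Dy; apply: ub_le_sup; [exact: compact_support|exists y]. Qed.

Lemma support_le n (D : set 'rV[R]_n) x c : D !=set0 -> (forall y, D y -> dotr x y <= c) ->
  support_fun D x <= c.
Proof.
move=> [y Dy] h; apply: ge_sup; first by exists (dotr x y), y.
by move=> _ [z /h hz <-].
Qed.

(** Remove the pieces of the covering one after the other. *)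
Lemma lvol_cover n (I : eqType) (s : seq I) (A : I -> set 'rV[R]_n) (B : set 'rV[R]_n) c :
  mset B -> (forall i, mset (A i)) -> (forall i, lvol (A i) <= c%:E)%E ->
  (forall x, B x -> exists2 i, i \in s & A i x) ->
  (lvol B <= ((size s)%:R * c)%:E)%E.
Proof.
move=> mB mA cA; elim: s B mB => [|i s IH] B mB hB.
  rewrite mul0r (_ : B = set0); first by rewrite /lvol measure0.
  by rewrite -subset0 => x /hB[].
have mBA : mset (B `\` A i) by rewrite /mset; exact: (measurableD mB (mA i)).
have mU : mset (A i `|` (B `\` A i)) by rewrite /mset; exact: (measurableU _ _ (mA i) mBA).
apply: (@le_trans _ _ (lvol (A i `|` (B `\` A i)))).
  by apply: le_lvol => // x Bx; have [?|?] := pselect (A i x); [left|right].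
apply: (@le_trans _ _ (lvol (A i) + lvol (B `\` A i))%E).
  exact: (@measureU2 _ _ _ (lebesgue_tuple R n) _ _ (mA i) mBA).
rewrite -natr1 addrC mulrDl mul1r EFinD leeD//; apply: IH => // x [Bx nA].
by have [j] := hB x Bx; rewrite inE => /orP[/eqP -> //|js Aj]; exists j.
Qed.

(** By induction, as (1 + 1/n)^n <= exp 1 <= 4. *)
Lemma fact_lower n : n%:R ^+ n <= 4 ^+ n * n`!%:R :> R.
Proof.
elim: n => [|n IH]; first by rewrite !expr0 fact0 mulr1.
have h : n.+1%:R ^+ n <= 4 * n%:R ^+ n :> R.
  case: n {IH} => [|n]; first by rewrite !expr0; lra.
  have n0 : 0 < n.+1%:R :> R by rewrite ltr0n.
  have -> : n.+2%:R = n.+1%:R * (1 + n.+1%:R^-1) :> R.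
    by rewrite -[in LHS]natr1 mulrDr mulr1 mulfV ?gt_eqF.
  rewrite exprMn mulrC ler_wpM2r ?exprn_ge0//.
  apply: (@le_trans _ _ (expR (n.+1%:R^-1) ^+ n.+1)).
    rewrite lerXn2r ?nnegrE ?expR_ge0 ?addr_ge0 ?invr_ge0//.
    exact: expR_ge1Dx.
  rewrite -expRM_natl mulfV ?gt_eqF//.
  have : 1 - 1 / 2 <= expR (- (1 / 2)) :> R by exact: expR_ge1Dx.
  rewrite expRN => h1.
  have e0 : 0 < expR (1 / 2) :> R by exact: expR_gt0.
  have e2 : expR (1 / 2) <= 2 :> R.
    have : expR (1 / 2) * (1 / 2) <= 1 :> R.
      rewrite -[leRHS](mulfV (lt0r_neq0 e0)); apply: ler_wpM2l; first exact: ltW.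
      lra.
    by lra.
  have -> : expR 1 = expR (1 / 2) * expR (1 / 2) :> R by rewrite -expRD; congr expR; lra.
  have -> : 4 = 2 * 2 :> R by lra.
  by apply: ler_pM => //; exact: ltW.
rewrite factS natrM exprS [4 ^+ _]exprS.
apply: (le_trans (ler_wpM2l (ler0n _ _) h)).
have -> : 4 * 4 ^+ n * (n.+1%:R * n`!%:R) = n.+1%:R * (4 * (4 ^+ n * n`!%:R)) :> R by ring.
by rewrite !ler_wpM2l.
Qed.

End symmetric_bodies.

(** * The lower bound *)

Section lower_bound.
Context (R : realType).

Definition slab_body n (E : seq 'rV[R]_n) : set 'rV[R]_n :=
  [set x | forall e, e \in E -> `|dotr x e| <= Num.sqrt n%:R].

Section slab.
Variables (m : nat) (E : seq 'rV[R]_m.+1) (c : R).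
Local Notation n := m.+1.
Local Notation q := (Num.sqrt n%:R : R).
Hypothesis sE : (0 < size E)%N.
Hypothesis Esub : {subset E <= signs R n}.
Hypothesis c0 : 0 < c.
Hypothesis hE : forall x, c * (size E)%:R * nrm x <= \sum_(e <- E) `|dotr x e| <= 7 * (size E)%:R * nrm x.

Let q0 : 0 < q. Proof. by rewrite sqrtr_gt0 ltr0n. Qed.
Let N0 : 0 < (size E)%:R :> R. Proof. by rewrite ltr0n. Qed.

Lemma slab_bounded x : slab_body E x -> nrm x <= q / c.
Proof.
move=> hx; have /andP[h _] := hE x.
have : \sum_(e <- E) `|dotr x e| <= \sum_(e <- E) q.
  by rewrite big_seq [leRHS]big_seq; apply: ler_sum => e /hx.
rewrite big_const_seq count_predT iter_addr_0 -[_ *+ size E]mulr_natr => /(le_trans h).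
rewrite [c * _ * _]mulrAC ler_pM2r// mulrC.
by rewrite ler_pdivlMr.
Qed.

Lemma slab_ball x : nrm x <= 1 -> slab_body E x.
Proof.
move=> x1 e /Esub/signs_nrm he; apply: (le_trans (dotr_le_nrm _ _)).
by rewrite he -[leRHS]mul1r ler_wpM2r// ltW.
Qed.

Lemma slab_convex_body : convex_body (slab_body E).
Proof.
split.
- apply: (compact_nrm_le (r := q / c)) slab_bounded.
  rewrite (_ : slab_body E = \bigcap_(e in [set e | e \in E]) [set x | `|dotr x e| <= q]); last first.
    by apply/seteqP; split => x h e eE; exact: h.
  apply: closed_bigI => e _; apply: closed_le_fun.
  by move=> x; exact: (cvg_norm (@continuous_dotl R n e x)).
- apply/convex_setP => x y t t0 t1 hx hy e eE.
  rewrite dotrDl !dotrZl; apply: (le_trans (ler_normD _ _)).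
  rewrite !normrM (ger0_norm t0) (@ger0_norm _ (1 - t)) ?subr_ge0//.
  have := ler_wpM2l t0 (hx e eE).
  have t1' : 0 <= 1 - t by rewrite subr_ge0.
  by have := ler_wpM2l t1' (hy e eE); lra.
- exact: interior_ball ltr01 slab_ball.
Qed.

Lemma slab_sym : origin_symmetric (slab_body E).
Proof.
apply/seteqP; split => x.
  by move=> hx; exists (- x); rewrite ?opprK// => e eE; rewrite dotrNl normrN; exact: hx.
by move=> [y hy <-] e eE; rewrite dotrNl normrN; exact: hy.
Qed.

(** Pigeonhole: for x in the cube, record the sign of <x, e> and the integer part
of |<x, e>| / sqrt n for each e in E.  Two points with the same record differ by
a point of the slab body.  By the upper bound on the sum of the |<x, e>|, the
integer parts sum up to at most 7 N, so that [card_cells] bounds the number of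
records. *)
Lemma slab_vol : 2 ^+ n <= 2 ^+ (9 * size E) * vol (slab_body E).
Proof.
set N := size E; have cL : compact (slab_body E) by case: slab_convex_body.
have mL := mset_compact cL.
pose cell (x : 'rV[R]_n) : cells N (7 * N).+1 :=
  [ffun i : 'I_N => (0 <= dotr x (tnth (in_tuple E) i),
     inord (Num.truncn (`|dotr x (tnth (in_tuple E) i)| / q)))].
pose ht (x : 'rV[R]_n) i := Num.truncn (`|dotr x (tnth (in_tuple E) i)| / q).
have ht_ge x i : ((ht x i)%:R : R) * q <= `|dotr x (tnth (in_tuple E) i)| < (ht x i).+1%:R * q.
  have := @truncn_itv R (`|dotr x (tnth (in_tuple E) i)| / q) (ltac:(by rewrite divr_ge0// ltW)).
  by rewrite ler_pdivlMr// ltr_pdivrMr.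
have ht_sum x : box 1 x -> (\sum_(i < N) ht x i <= 7 * N)%N.
  move=> bx; rewrite -(ler_nat R) natr_sum -(ler_pM2r q0) mulr_suml.
  apply: (@le_trans _ _ (\sum_(i < N) `|dotr x (tnth (in_tuple E) i)|)).
    by apply: ler_sum => i _; case/andP: (ht_ge x i).
  rewrite -(big_tuple _ _ (in_tuple E) xpredT (fun e => `|dotr x e|)) /=.
  have /andP[_] := hE x; move=> /le_trans; apply.
  rewrite natrM ler_wpM2l ?mulr_ge0//.
  apply: (le_trans (nrm_le_mxnorm x)); rewrite -[leRHS]mulr1 ler_wpM2l ?(ltW q0)//.
  by apply: mx_norm_leP => // i j; rewrite ord1; exact: bx.
have ht_max x i : box 1 x -> (ht x i < (7 * N).+1)%N.
  move=> /ht_sum; rewrite ltnS (bigD1 i)//= => /(leq_trans _); apply; exact: leq_addr.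
have cell2 x i : box 1 x -> (cell x i).2 = ht x i :> nat.
  by move=> bx; rewrite ffunE /= inordK// ht_max.
pose S := [seq f <- enum {: cells N (7 * N).+1} | (height f <= 7 * N)%N].
(* A point of the cube with record f, if there is one. *)
pose rep (f : cells N (7 * N).+1) : 'rV[R]_n := xget 0 [set x | box 1 x /\ cell x = f].
pose A f := [set x | slab_body E (x - rep f)].
have mA f : mset (A f).
  have := mset_preim 1%:M (- rep f) mL.
  by congr mset; apply/funext => x; rewrite /A/= mulmx1.
have vA f : (lvol (A f) <= (vol (slab_body E))%:E)%E.
  by rewrite /A lvol_preim_shift// volE fineK// lvol_fin.
have cov x : box 1 x -> exists2 f, f \in S & A f x.
  move=> bx; exists (cell x).
    rewrite mem_filter mem_enum andbT /height.
    rewrite (eq_bigr (fun i => ht x i)); first exact: ht_sum.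
    by move=> i _; exact: cell2.
  have [by_ cy] : box 1 (rep (cell x)) /\ cell (rep (cell x)) = cell x.
    by apply: (xgetPex 0 (P := [set y | box 1 y /\ cell y = cell x])); exists x.
  set y := rep (cell x) in by_ cy *.
  move=> e /(tnthP (in_tuple E))[i ->]; rewrite dotrBl.
  have hxy : ht y i = ht x i by rewrite -!cell2// cy.
  have sxy : (0 <= dotr y (tnth (in_tuple E) i)) = (0 <= dotr x (tnth (in_tuple E) i)).
    by have := congr1 (fun f : cells _ _ => (f i).1) cy; rewrite !ffunE.
  have := ht_ge x i; have := ht_ge y i; rewrite hxy -!natr1 mulrDl mul1r.
  move: sxy; move: (dotr y _) (dotr x _) ((ht x i)%:R * q) => u v w.
  have [u0|u0] := leP 0 u => /esym sv.
    by rewrite (ger0_norm u0) (ger0_norm sv) => /andP[? ?] /andP[? ?]; rewrite ler_norml; lra.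
  have v0 : v < 0 by rewrite ltNge sv.
  by rewrite (ltr0_norm u0) (ltr0_norm v0) => /andP[? ?] /andP[? ?]; rewrite ler_norml; lra.
have := lvol_cover (@mset_box R n 1) mA vA cov.
rewrite lvol_box// lee_fin => /le_trans; apply.
rewrite ler_wpM2r ?fine_ge0 ?lvol_ge0//.
have -> : (size S)%:R = #|[pred f : cells N (7 * N).+1 | (height f <= 7 * N)%N]|%:R :> R.
  by rewrite cardE /enum_mem -enumT; congr ((size _)%:R); apply: eq_filter.
apply: (le_trans (card_cells R _ _ _)).
have -> : (9 * N = 7 * N + 2 * N)%N by lia.
have e4 : 4 = 2 ^+ 2 :> R by rewrite expr2; lra.
by rewrite e4 -exprM -exprD.
Qed.

(** The support function of D is at most 1 at the normalized vectors of E because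
D is included in the slabs.  [avg_shadow_le] propagates this to the average
over all the sign vectors, and [sign_urysohn] applies. *)
Lemma slab_projection_body D : D `<=` slab_body E -> projection_body D ->
  vol D <= (32 / c / q) ^+ n.
Proof.
move=> DL [K [[cK /convex_setP vK K0] sK [cD vD D0] sD hD]].
have [r r0 Kr] := symmetric_ball vK sK K0.
have [y0 Dy0] : D !=set0 by have [y /interior_subset Dy] := D0; exists y.
pose h e := vol (shadow (q^-1 *: e) K).
have unit_sign e : e \in signs R n -> sphere (q^-1 *: e) by exact: sphere_sign.
have hh e : e \in signs R n -> h e = support_fun D (q^-1 *: e).
  by move=> /unit_sign eS; rewrite hD// hyperplane_volE.
have hA e : e \in E -> h e <= 1.
  move=> eE; rewrite hh ?Esub//; apply: support_le; first by exists y0.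
  move=> y /DL/(_ e eE) hy; rewrite dotrZl ler_pdivrMl// mulr1 dotrC.
  exact: le_trans (ler_norm _) hy.
have Esh : Es h <= 4 * (1 / c).
  by apply: (avg_shadow_le cK vK r0 Kr c0 sE Esub) => // x; case/andP: (hE x).
have Dh x e : D x -> e \in signs R n -> dotr x e <= q * h e.
  move=> Dx eS; rewrite hh// dotrC.
  have -> : dotr e x = q * dotr (q^-1 *: e) x by rewrite dotrZl mulrA mulfV ?gt_eqF// mul1r.
  by rewrite ler_pM2l//; exact: le_support.
have Es0 := Es_ge0 Dy0 Dh.
have := sign_urysohn (mset_compact cD) Dh Es0.
rewrite -[lvol D]fineK ?lvol_fin// lee_fin -volE => /le_trans; apply.
have n0 : 0 < n%:R :> R by rewrite ltr0n.
have f0 : 0 < n`!%:R :> R by rewrite ltr0n fact_gt0.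
rewrite ler_pdivrMr//.
apply: (@le_trans _ _ ((32 / c / q) ^+ n * ((n%:R / 4) ^+ n))); last first.
  rewrite ler_wpM2l//; first by rewrite exprn_ge0// !divr_ge0// ltW.
  by rewrite exprMn exprVn ler_pdivrMr ?exprn_gt0// mulrC fact_lower.
have qq : n%:R = q * q :> R by rewrite -expr2 sqr_sqrtr.
have e (u v : R) : 0 < u -> v = u * u -> 32 / c / u * (v / 4) = 2 * (u * (4 * (1 / c))).
  by move=> u0 ->; field; rewrite !gt_eqF.
rewrite -exprMn EsZ (e _ _ q0 qq).
have main : 2 * (q * Es h) <= 2 * (q * (4 * (1 / c))) by rewrite ler_pM2l// ler_pM2l.
have lhs0 : 0 <= 2 * (q * Es h) by rewrite mulr_ge0// -EsZ.
by rewrite lerXn2r// nnegrE// (le_trans lhs0).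
Qed.

End slab.

Lemma lower_bound : exists2 a : R, 0 < a & forall n, (0 < n)%N ->
  exists L : set 'rV[R]_n, [/\ convex_body L, origin_symmetric L &
   forall D, D `<=` L -> projection_body D ->
     a * Num.sqrt n%:R <= (vol L / vol D) `^ n%:R^-1].
Proof.
have [C C0 hC] := kashin_signs R.
pose a0 : R := 2 / 2 ^+ (9 * C); have a00 : 0 < a0 by rewrite divr_gt0// exprn_gt0.
have [c c0 hc] : exists2 c : R, 0 < c & c = 3 / 100 by exists (3 / 100); rewrite // divr_gt0.
rewrite -hc in hC; pose k := 32 / c; have k0 : 0 < k by rewrite divr_gt0.
exists (a0 / k); first by rewrite !divr_gt0.
case=> [//|m] /hC[E [sE Esub hE]].
have sE0 : (0 < size E)%N by rewrite sE muln_gt0 C0.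
exists (slab_body E); split; [exact: (slab_convex_body sE0 Esub c0 hE)|exact: slab_sym|].
move=> D DL pD; have := slab_projection_body sE0 Esub c0 hE DL pD; rewrite -/k.
have vD : 0 < vol D by case: pD => K [_ _ [cD _ D0] _ _]; exact: vol_gt0.
have vL : a0 ^+ m.+1 <= vol (slab_body E).
  have := slab_vol sE0 Esub c0 hE.
  rewrite sE mulnA exprM /a0 exprMn exprVn => h.
  by rewrite ler_pdivrMr ?exprn_gt0 ?exprn_gt0// mulrC.
have q0 : 0 < Num.sqrt m.+1%:R :> R by rewrite sqrtr_gt0 ltr0n.
set q := Num.sqrt _ in q0 *; move=> vDq.
have b0 : 0 < a0 / k * q by rewrite mulr_gt0 ?divr_gt0.
have h : (a0 / k * q) ^+ m.+1 <= vol (slab_body E) / vol D.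
  rewrite ler_pdivlMr//; apply: le_trans vL.
  apply: (@le_trans _ _ ((a0 / k * q) ^+ m.+1 * (k / q) ^+ m.+1)).
    by rewrite ler_wpM2l// exprn_ge0// ltW.
  by rewrite -exprMn (_ : a0 / k * q * (k / q) = a0)//; field; rewrite !gt_eqF.
have -> : a0 / k * q = ((a0 / k * q) ^+ m.+1) `^ m.+1%:R^-1.
  by rewrite -powR_mulrn ?ltW// -powRrM mulfV ?powRr1 ?ltW.
apply: ge0_ler_powR; rewrite ?nnegrE ?invr_ge0//.
  by rewrite exprn_ge0// ltW.
by apply: le_trans h; rewrite exprn_ge0// ltW.
Qed.

End lower_bound.

(** * Ellipsoids and the stretching argument of John *)

Section ellipsoids.
Context (R : realType).

Definition unit_ball n : set 'rV[R]_n := [set x | nrm x <= 1].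
Definition ellipsoid m n (T : 'M[R]_(m, n)) : set 'rV[R]_n := [set x *m T | x in @unit_ball m].

Lemma compact_unit_ball n : compact (@unit_ball n).
Proof.
apply: (compact_nrm_le (r := 1)) => //.
apply: closed_le_fun; exact: continuous_nrm.
Qed.

Lemma compact_ellipsoid m n (T : 'M[R]_(m, n)) : compact (ellipsoid T).
Proof.
apply: continuous_compact; last exact: compact_unit_ball.
by apply: continuous_subspaceT; exact: continuous_mulmx.
Qed.

Lemma nrm_mulmx m n (T : 'M[R]_(m, n)) : exists2 C, 0 < C & forall x, nrm (x *m T) <= C * nrm x.
Proof.
have [r r0 hr] := compact_nrm (@compact_ellipsoid m n T).
exists (r + 1); first by rewrite ltr_wpDl.
move=> x; have [->|x0] := eqVneq x 0; first by rewrite mul0mx !nrm0 mulr0.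
have nx := nrm_gt0 x0.
have : nrm (((nrm x)^-1 *: x) *m T) <= r.
  apply: hr; exists ((nrm x)^-1 *: x) => //.
  by rewrite /unit_ball/= nrmZ ger0_norm ?invr_ge0 ?(ltW nx)// mulVf ?gt_eqF.
rewrite -scalemxAl nrmZ ger0_norm ?invr_ge0 ?(ltW nx)// ler_pdivrMl// mulrC => /le_trans; apply.
by rewrite ler_wpM2r ?(ltW nx)// lerDl.
Qed.

Lemma unit_ball_convex_body n : convex_body (@unit_ball n).
Proof.
split; [exact: compact_unit_ball| |exact: interior_ball ltr01 (fun x h => h)].
apply/convex_setP => x y t t0 t1 x1 y1; apply: (le_trans (nrmD _ _)).
have t1' : 0 <= 1 - t by rewrite subr_ge0.
rewrite !nrmZ (ger0_norm t0) (ger0_norm t1').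
by have := ler_wpM2l t0 x1; have := ler_wpM2l t1' y1; rewrite !mulr1; lra.
Qed.

Lemma vol_unit_ball_gt0 n : 0 < vol (@unit_ball n).
Proof. by have [c _ i] := unit_ball_convex_body n; exact: vol_gt0. Qed.

Lemma vol_ellipsoid n (T : 'M[R]_n) : T \in unitmx ->
  vol (ellipsoid T) = `|\det T| * vol (@unit_ball n).
Proof.
move=> Tu; rewrite !volE lvol_image//; last exact: mset_compact (@compact_unit_ball n).
by rewrite -[lvol (@unit_ball n)]fineK// lvol_fin//; exact: compact_unit_ball.
Qed.

Lemma ellipsoid_sym n (T : 'M[R]_n) : origin_symmetric (ellipsoid T).
Proof.
apply/seteqP; split => _ [x x1 <-].
  exists (- (x *m T)); last by rewrite opprK.
  by exists (- x); rewrite ?mulNmx// /unit_ball/= nrmN.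
by case: x1 => y y1 <-; exists (- y); rewrite ?mulNmx// /unit_ball/= nrmN.
Qed.

Lemma ellipsoid_convex_body n (T : 'M[R]_n) : T \in unitmx -> convex_body (ellipsoid T).
Proof.
move=> Tu; split; first exact: compact_ellipsoid.
  apply/convex_setP => _ _ t t0 t1 [x x1 <-] [y y1 <-].
  exists (t *: x + (1 - t) *: y); last by rewrite mulmxDl -!scalemxAl.
  have [_ /convex_setP h _] := unit_ball_convex_body n; exact: h.
have [C C0 hC] := nrm_mulmx (invmx T).
apply: (@interior_ball _ _ _ C^-1); first by rewrite invr_gt0.
move=> x hx; exists (x *m invmx T); last by rewrite mulmxKV.
rewrite /unit_ball/=; apply: (le_trans (hC x)).
by rewrite mulrC -ler_pdivlMr// mul1r.
Qed.

(** By the Cauchy-Schwarz inequality and its equality case. *)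
Lemma support_ellipsoid n (T : 'M[R]_n) xi : support_fun (ellipsoid T) xi = nrm (xi *m T^T).
Proof.
set v := xi *m T^T.
have E0 : ellipsoid T 0 by exists 0; rewrite ?mul0mx// /unit_ball/= nrm0.
apply/eqP; rewrite eq_le; apply/andP; split.
  apply: support_le; first by exists 0.
  move=> _ [x x1 <-]; rewrite dotrC dotr_mull -/v dotrC; apply: (le_trans (ler_norm _)).
  by apply: (le_trans (dotr_le_nrm _ _)); rewrite -[leRHS]mulr1 ler_wpM2l ?nrm_ge0.
have [v0|v0] := eqVneq v 0.
  by rewrite v0 nrm0; have := le_support xi (@compact_ellipsoid n n T) E0; rewrite dotr0r.
have nv := nrm_gt0 v0.
have -> : nrm v = dotr xi (((nrm v)^-1 *: v) *m T).
  rewrite dotrC dotr_mull -/v dotrZl -sqr_nrm expr2 mulrA mulVf ?mul1r// gt_eqF//.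
apply: le_support; first exact: compact_ellipsoid.
exists ((nrm v)^-1 *: v) => //.
by rewrite /unit_ball/= nrmZ ger0_norm ?invr_ge0 ?(ltW nv)// mulVf ?gt_eqF.
Qed.

Section frame.
Variables (m : nat) (e : 'rV[R]_m.+1).
Hypothesis e1 : sphere e.
Let U := hyperplane_frame e.

Lemma frame_norm c y : dotr (c *: e + y *m U) (c *: e + y *m U) = c ^+ 2 + dotr y y.
Proof.
have [h1 h2] := frameE e1 c y.
rewrite [in LHS]dotrDr dotrZr h1 expr2; congr (_ + _).
by rewrite dotrC dotr_mull h2.
Qed.

Lemma shadow_unit_ball : shadow e (@unit_ball m.+1) = @unit_ball m.
Proof.
apply/seteqP; split => y /=.
  move=> /shadowP -/(_ e1)[a]; rewrite /unit_ball/= !nrm_le// frame_norm.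
  by apply: le_trans; rewrite lerDr sqr_ge0.
move=> y1; apply/shadowP => //; exists 0; move: y1.
by rewrite /unit_ball/= !nrm_le// frame_norm expr0n add0r.
Qed.

(** In the orthonormal basis of [frame_mx], the diagonal matrix with entries
a, b, ..., b. *)
Lemma stretch (a b : R) : 0 <= a -> 0 <= b -> exists2 A : 'M[R]_m.+1, `|\det A| = a * b ^+ m &
  forall c y, (c *: e + y *m U) *m A = (a * c) *: e + (b *: y) *m U.
Proof.
move=> a0 b0; pose D : 'M[R]_m.+1 := (block_mx a%:M 0 0 b%:M : 'M[R]_(1 + m, 1 + m)).
exists ((frame_mx e)^T *m D *m frame_mx e).
  rewrite !det_mulmx det_tr !normrM frame_det// mul1r mulr1.
  by rewrite (@det_lblock R 1 m) !det_scalar expr1 normrM !ger0_norm// exprn_ge0.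
move=> c y; rewrite -!row1_frame !mulmxA -[_ *m frame_mx e *m _]mulmxA frame_orth// mulmx1.
congr (_ *m _); rewrite /row1 /D (@mul_row_block R 1 1 m 1 m) !mulmx0 addr0 add0r.
by rewrite -scalar_mxM mul_mx_scalar mulrC.
Qed.

End frame.

(** Put e = z / |z|, stretch the ball by a factor a > 1 along e and shrink it by a
factor b < 1 orthogonally to e.  A point of the resulting ellipsoid is either in
the unit ball or on a segment from z, or from - z, to a point v of the unit
ball.  With a^2 = 1 + ep (|z|^2 - 1) and b^2 = 1 - ep, this last fact amounts
to (a - |z| c)^2 >= 0, where c is the coordinate along e of the original
point. *)
Lemma john_step m (K : set 'rV[R]_m.+1) z : (0 < m)%N -> cvx K -> origin_symmetric K ->
  (forall x, nrm x <= 1 -> K x) -> K z -> 5 * m.+1%:R < nrm z ^+ 2 ->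
  exists2 A : 'M[R]_m.+1, 3 / 2 <= (\det A) ^+ 2 & forall x, nrm x <= 1 -> K (x *m A).
Proof.
move=> m0 vK sK K1 Kz hz; set n1 : R := m.+1%:R in hz.
have n2 : 2 <= n1 by rewrite /n1 ler_nat.
set rho := nrm z in hz; have rho0 : 0 <= rho by exact: nrm_ge0.
have rho1 : 1 < rho ^+ 2 by lra.
have rho_gt1 : 1 < rho by rewrite -ltr_sqr ?nnegrE// expr1n.
have rho_gt0 : 0 < rho by lra.
pose e := rho^-1 *: z.
have ze : z = rho *: e by rewrite scalerA mulfV ?scale1r// gt_eqF.
have e1 : sphere e.
  rewrite /sphere/= -sqr_nrm nrmZ -/rho ger0_norm ?invr_ge0//.
  by rewrite mulVf ?expr1n// gt_eqF.
(* With ep = 1 / (4 n), the squared determinant a^2 b^(2 (n - 1)) is at least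
   (1 + 5/4 - 1/8) * 3/4 > 3/2. *)
pose ep := (4 * n1)^-1; have ep0 : 0 < ep by rewrite invr_gt0; lra.
have epn : ep * (4 * n1) = 1 by rewrite mulVf// gt_eqF//; lra.
have ep1 : ep <= 1 / 8.
  by rewrite /ep -[_^-1]mul1r ler_pdivrMr; lra.
have A0 : 1 <= 1 + ep * (rho ^+ 2 - 1) by rewrite lerDl mulr_ge0 ?(ltW ep0)//; lra.
pose a := Num.sqrt (1 + ep * (rho ^+ 2 - 1)); pose b := Num.sqrt (1 - ep).
have a2 : a ^+ 2 = 1 + ep * (rho ^+ 2 - 1) by rewrite sqr_sqrtr//; lra.
have b2 : b ^+ 2 = 1 - ep by rewrite sqr_sqrtr//; lra.
have a0 : 0 <= a by exact: sqrtr_ge0.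
have b0 : 0 <= b by exact: sqrtr_ge0.
clearbody a b e.
have a1 : 1 <= a by rewrite -ler_sqr ?nnegrE// expr1n a2.
have a_rho : a < rho.
  rewrite -ltr_sqr ?nnegrE// a2 -subr_gt0.
  have -> : rho ^+ 2 - (1 + ep * (rho ^+ 2 - 1)) = (1 - ep) * (rho ^+ 2 - 1) by ring.
  by rewrite mulr_gt0; lra.
have [A detA hA] := stretch e1 a0 b0; exists A.
  rewrite -real_normK ?num_real// detA exprMn a2 -exprM mulnC exprM b2.
  have lo : 3 / 4 <= (1 - ep) ^+ m.
    apply: le_trans (bernoulli m _); last by apply/andP; split; lra.
    have mn : m%:R <= n1 by rewrite ler_nat.
    have : m%:R * ep <= n1 * ep by rewrite ler_wpM2r// ltW.
    by move: epn; lra.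
  have up : 17 / 8 <= 1 + ep * (rho ^+ 2 - 1).
    have : ep * (5 * n1 - 1) <= ep * (rho ^+ 2 - 1) by rewrite ler_wpM2l ?(ltW ep0)//; lra.
    by move: epn; lra.
  have : 17 / 8 * (3 / 4) <= (1 + ep * (rho ^+ 2 - 1)) * (1 - ep) ^+ m by apply: ler_pM => //; lra.
  by lra.
have claim c y : 0 <= c -> c ^+ 2 + dotr y y <= 1 ->
    K ((a * c) *: e + (b *: y) *m hyperplane_frame e).
  move=> c0 cy; have Y0 := dotr_ge0 y; set Y := dotr y y in cy Y0.
  have c1 : c <= 1 by rewrite -(expr_le1 (n := 2))//; lra.
  have by2 k : dotr (k *: y) (k *: y) = k ^+ 2 * Y by rewrite dotrZl dotrZr mulrA.
  have [h|h] := leP (a * c * rho) 1.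
    apply: K1; rewrite nrm_le// frame_norm// by2 b2 expr1n.
    have h2 : (a * c * rho) ^+ 2 <= 1 by rewrite expr_le1// !mulr_ge0.
    have h3 : (c * rho) ^+ 2 <= 1.
      apply: le_trans h2; rewrite ler_sqr ?nnegrE ?mulr_ge0// -mulrA.
      by rewrite -[leLHS]mul1r ler_wpM2r// mulr_ge0.
    have : (1 - ep) * Y <= (1 - ep) * (1 - c ^+ 2) by rewrite ler_wpM2l; lra.
    have : ep * (c * rho) ^+ 2 <= ep by rewrite -[leRHS]mulr1 ler_wpM2l// ltW.
    have -> : (a * c) ^+ 2 = (1 - ep) * c ^+ 2 + ep * (c * rho) ^+ 2 by rewrite exprMn a2; ring.
    move: ((c * rho) ^+ 2) (c ^+ 2) => u v; lra.
  have ac : a * c < rho by apply: le_lt_trans a_rho; rewrite -[leRHS]mulr1 ler_wpM2l.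
  pose q := rho ^+ 2 - 1; have q0 : 0 < q by rewrite /q; lra.
  (* The barycentric coordinate of z for which v has 1 / rho as a coordinate
     along e, as the tangent points from z to the unit sphere have. *)
  pose la := (a * c * rho - 1) / q.
  have mu : 1 - la = rho * (rho - a * c) / q.
    by rewrite /la /q; field; rewrite gt_eqF.
  have d0 : 0 < rho - a * c by lra.
  have mu0 : 0 < 1 - la by rewrite mu divr_gt0// mulr_gt0.
  pose v := rho^-1 *: e + ((b / (1 - la)) *: y) *m hyperplane_frame e.
  have -> : (a * c) *: e + (b *: y) *m hyperplane_frame e = la *: z + (1 - la) *: v.
    rewrite ze scalerA /v scalerDr !scalerA scalemxAl scalerA addrA -scalerDl.
    rewrite [(1 - la) * (b / _)]mulrCA mulfV ?gt_eqF// mulr1; congr (_ *: e + _).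
    rewrite mu /la /q; field; rewrite !gt_eqF//.
  apply: vK => //.
  - by rewrite divr_ge0//; lra.
  - lra.
  apply: K1; rewrite nrm_le// frame_norm// by2 expr1n.
  have h1 : b ^+ 2 * Y * q <= (rho - a * c) ^+ 2.
    apply: (@le_trans _ _ (b ^+ 2 * (1 - c ^+ 2) * q)).
      by rewrite ler_wpM2r ?(ltW q0)// ler_wpM2l ?sqr_ge0//; lra.
    rewrite -subr_ge0 (_ : _ - _ = (a - rho * c) ^+ 2) ?sqr_ge0//.
    have bq : b ^+ 2 * q = rho ^+ 2 - a ^+ 2 by rewrite b2 a2 /q; ring.
    by rewrite mulrAC bq; ring.
  rewrite mu; have -> : (b / (rho * (rho - a * c) / q)) ^+ 2 * Y =
     (b ^+ 2 * Y * q) * (q / (rho ^+ 2 * (rho - a * c) ^+ 2)).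
    by field; rewrite !gt_eqF.
  have w0 : 0 <= q / (rho ^+ 2 * (rho - a * c) ^+ 2).
    by rewrite divr_ge0 ?(ltW q0)// mulr_ge0// sqr_ge0.
  apply: (le_trans (lerD (lexx _) (ler_wpM2r w0 h1))).
  rewrite le_eqVlt; apply/orP; left; apply/eqP.
  by rewrite /q; field; rewrite !gt_eqF.
move=> x; rewrite nrm_le// expr1n (frame_decomp e1 x).
set c := dotr x e; set y := x *m _; rewrite frame_norm// hA => h.
have [c0|c0] := leP 0 c; first exact: claim.
rewrite -[X in K X]opprK; apply: symN => //.
rewrite opprD -scaleNr -mulNmx -mulrN -scalerN; apply: claim; first by lra.
by rewrite sqrrN dotrNl dotrNr opprK.
Qed.

End ellipsoids.

(** * The upper bound *)

Section upper_bound.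
Context (R : realType).

(** Put w = xi S^-1.  The map x |-> x S U^T, for U the frame of the hyperplane
orthogonal to xi, kills w; hence the shadow is the image of the unit ball of
the hyperplane orthogonal to w by W S U^T, for W the frame of this hyperplane.
In the orthonormal bases completing W and U, the matrix S is block triangular
with diagonal blocks |w|^-1 and W S U^T, whence the determinant of the
latter. *)
Lemma vol_shadow_ellipsoid m (S : 'M[R]_m.+1) (xi : 'rV[R]_m.+1) : S \in unitmx -> sphere xi ->
  vol (shadow xi (ellipsoid S)) = vol (@unit_ball R m) * (`|\det S| * nrm (xi *m invmx S)).
Proof.
move=> Su xi1; set U := hyperplane_frame xi; set w := xi *m invmx S.
have wS : w *m S = xi by rewrite mulmxKV.
have w0 : w != 0.
  apply: contra_eq_neq xi1 => w0.
  by rewrite -wS w0 mul0mx dotr0l eq_sym oner_eq0.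
have nw := nrm_gt0 w0; pose z := (nrm w)^-1 *: w.
have z1 : sphere z.
  rewrite /sphere/= -sqr_nrm nrmZ ger0_norm ?invr_ge0 ?(ltW nw)//.
  by rewrite mulVf ?expr1n// gt_eqF.
set W := hyperplane_frame z.
have [UU Uxi] := hyperplane_frameP xi1.
have xiU : xi *m U^T = 0 by rewrite -[LHS]trmxK trmx_mul trmxK Uxi trmx0.
have zSU : z *m S *m U^T = 0 by rewrite -scalemxAl wS -scalemxAl xiU scaler0.
pose M := W *m S *m U^T.
have detM : `|\det M| = `|\det S| * nrm w.
  have : `|\det (frame_mx z *m S *m (frame_mx xi)^T)| = `|\det S|.
    by rewrite !det_mulmx det_tr !normrM !frame_det// mul1r mulr1.
  rewrite /frame_mx -/U -/W (@tr_col_mx R 1 m) (@mul_col_mx R 1 m).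
  rewrite (@mul_col_row R 1 m m.+1 1 m) zSU (@det_lblock R 1 m) normrM.
  have -> : z *m S *m xi^T = (nrm w)^-1%:M.
    rewrite -scalemxAl wS -scalemxAl [xi *m xi^T]mx11_scalar.
    have -> : (xi *m xi^T) 0 0 = 1 by exact: xi1.
    by rewrite scale_scalar_mx mulr1.
  rewrite det_scalar1 -/M ger0_norm ?invr_ge0 ?(ltW nw)// => <-.
  by rewrite mulrAC mulVf ?mul1r// gt_eqF.
have Mu : M \in unitmx.
  rewrite unitmxE unitfE -normr_gt0 detM mulr_gt0// normr_gt0.
  by move: Su; rewrite unitmxE unitfE.
clearbody z.
have key (x : 'rV[R]_m.+1) : x *m S *m U^T = x *m W^T *m M.
  by rewrite {1}(frame_decomp z1 x) -/W !mulmxDl -!scalemxAl zSU scaler0 add0r /M !mulmxA.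
have -> : shadow xi (ellipsoid S) = ellipsoid M.
  apply/seteqP; split => y.
    move=> [_ [x x1 <-] <-]; exists (x *m W^T); last by rewrite -key.
    by rewrite -(shadow_unit_ball z1); exists x.
  move=> [x x1 <-]; rewrite -(shadow_unit_ball z1) in x1; case: x1 => u u1 <-.
  by exists (u *m S); [exists u|rewrite key].
by rewrite vol_ellipsoid// detM mulrC.
Qed.

(** By [vol_shadow_ellipsoid] the image of the ball by a multiple of the inverse
transpose of T has the required shadows, up to a factor that is adjusted by the
choice of the multiple. *)
Lemma ellipsoid_projection_body m (T : 'M[R]_m.+1) : (0 < m)%N -> T \in unitmx ->
  projection_body (ellipsoid T).
Proof.
move=> m0 Tu; set k := vol (@unit_ball R m).
have k0 : 0 < k := vol_unit_ball_gt0 R m.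
have d0 : 0 < `|\det T| by rewrite normr_gt0; move: Tu; rewrite unitmxE unitfE.
pose s := (`|\det T| / k) `^ m%:R^-1.
have s0 : 0 < s by rewrite powR_gt0// divr_gt0.
have sm : s ^+ m = `|\det T| / k.
  rewrite -powR_mulrn ?(ltW s0)// -powRrM mulVf ?powRr1// ?divr_ge0// ?ltW//.
  by rewrite pnatr_eq0 -lt0n.
pose S := s *: invmx T^T.
have TTu : T^T \in unitmx by rewrite unitmx_tr.
have Su : S \in unitmx.
  by rewrite /S unitmxZ ?unitmx_inv// unitfE gt_eqF.
have iS : invmx S = s^-1 *: T^T.
  by rewrite /S invmxZ ?invmxK.
exists (ellipsoid S); split; [exact: ellipsoid_convex_body|exact: ellipsoid_sym|
  exact: ellipsoid_convex_body|exact: ellipsoid_sym|].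
move=> xi xi1; rewrite hyperplane_volE// vol_shadow_ellipsoid// support_ellipsoid -/k.
rewrite iS -scalemxAr nrmZ (ger0_norm (_ : 0 <= s^-1)) ?invr_ge0 ?(ltW s0)//.
rewrite /S detZ det_inv det_tr normrM normfV (ger0_norm (_ : 0 <= s ^+ _)) ?exprn_ge0 ?(ltW s0)//.
rewrite exprS sm; field; rewrite !gt_eqF//.
Qed.

(** The volume of an ellipsoid is proportional to the absolute value of the
determinant, which is thus bounded for the ellipsoids included in L. *)
Lemma almost_max_ellipsoid m (L : set 'rV[R]_m.+1) : convex_body L -> origin_symmetric L ->
  exists2 T : 'M[R]_m.+1, T \in unitmx /\ ellipsoid T `<=` L &
    forall T', ellipsoid T' `<=` L -> 9 / 10 * `|\det T'| <= `|\det T|.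
Proof.
move=> [cL /convex_setP vL iL] sL.
have [r r0 Lr] := symmetric_ball vL sL iL.
pose P := [set T : 'M[R]_m.+1 | ellipsoid T `<=` L].
pose X := [set `|\det T| | T in P].
have Pr : P (r%:M).
  move=> _ [x x1 <-]; apply: Lr; rewrite mul_mx_scalar nrmZ ger0_norm ?(ltW r0)//.
  by rewrite -[leRHS]mulr1 ler_wpM2l ?(ltW r0).
have Xr : X (r ^+ m.+1).
  by exists r%:M => //; rewrite det_scalar ger0_norm// exprn_ge0// ltW.
have kpos := vol_unit_ball_gt0 R m.+1.
have ubX : has_ubound X.
  exists (vol L / vol (@unit_ball R m.+1)) => _ [T PT <-].
  have [Tu|Tu] := boolP (T \in unitmx); last first.
    move: Tu; rewrite unitmxE unitfE negbK => /eqP ->.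
    by rewrite normr0 divr_ge0 ?(ltW kpos)// fine_ge0// lvol_ge0.
  rewrite ler_pdivlMr// -vol_ellipsoid// !volE fine_le ?lvol_fin//.
    exact: compact_ellipsoid.
  by apply: le_lvol => //; apply: mset_compact => //; exact: compact_ellipsoid.
have supX T : P T -> `|\det T| <= sup X by move=> PT; apply: ub_le_sup => //; exists T.
have sup0 : 0 < sup X.
  by apply: lt_le_trans (ub_le_sup ubX Xr); rewrite exprn_gt0.
have [_ [T PT <-] hT] : exists2 t, X t & 9 / 10 * sup X < t.
  by apply: sup_gt; [by exists (r ^+ m.+1)|lra].
exists T.
  split => //; rewrite unitmxE unitfE -normr_gt0; apply: le_lt_trans hT.
  by rewrite mulr_ge0// ?divr_ge0// ltW.
move=> T' /supX h; apply: ltW; apply: le_lt_trans hT; rewrite ler_wpM2l// divr_ge0.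
Qed.

(** Apply [john_step] to the preimage of L by T: a point of norm greater than
sqrt (5 n) would give an ellipsoid included in L with a determinant larger by a
factor of at least 6/5, contradicting almost maximality. *)
Lemma upper_bound m (L : set 'rV[R]_m.+1) : (0 < m)%N -> convex_body L -> origin_symmetric L ->
  exists D, [/\ D `<=` L, projection_body D &
   (vol L / vol D) `^ m.+1%:R^-1 <= 3 * Num.sqrt m.+1%:R].
Proof.
move=> m0 bL sL; have [T [Tu TL] hT] := almost_max_ellipsoid bL sL.
have [cL /convex_setP vL iL] := bL.
exists (ellipsoid T); split => //; first exact: ellipsoid_projection_body.
set n1 : R := m.+1%:R; have n0 : 0 < n1 by rewrite ltr0n.
have dT : 0 < `|\det T| by rewrite normr_gt0; move: Tu; rewrite unitmxE unitfE.
pose K := [set x : 'rV[R]_m.+1 | L (x *m T)].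
have cover x : L x -> nrm (x *m invmx T) ^+ 2 <= 5 * n1.
  move=> Lx; rewrite leNgt; apply/negP => big.
  have vK : cvx K.
    move=> u v t t0 t1 Ku Kv; rewrite /K/= mulmxDl -!scalemxAl; exact: vL.
  have sK : origin_symmetric K.
    apply/seteqP; split => u.
      by move=> Ku; exists (- u); rewrite ?opprK// /K/= mulNmx; exact: symN.
    by move=> [v Kv <-]; rewrite /K/= mulNmx; exact: symN.
  have K1 u : nrm u <= 1 -> K u by move=> u1; apply: TL; exists u.
  have Kx : K (x *m invmx T) by rewrite /K/= mulmxKV.
  have [A dA hA] := john_step m0 vK sK K1 Kx big.
  have AL : ellipsoid (A *m T) `<=` L by move=> _ [u u1 <-]; rewrite mulmxA; exact: hA.
  have := hT _ AL; rewrite det_mulmx normrM.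
  have A1 : 6 / 5 <= `|\det A|.
    rewrite -ler_sqr ?nnegrE ?divr_ge0// real_normK ?num_real//.
    by apply: le_trans dA; lra.
  have : 6 / 5 * `|\det T| <= `|\det A| * `|\det T| by rewrite ler_pM2r.
  by move: dT; lra.
pose q := Num.sqrt n1; have q0 : 0 < q by rewrite sqrtr_gt0.
have q2 : q ^+ 2 = n1 by rewrite sqr_sqrtr// ltW.
have cE := @compact_ellipsoid R _ _ T.
have LE : L `<=` (fun x => (3 * q) *: x) @` ellipsoid T.
  move=> x Lx; have c0 : 0 < 3 * q by rewrite mulr_gt0.
  exists ((3 * q)^-1 *: x); last by rewrite scalerA mulfV ?scale1r ?gt_eqF.
  exists ((3 * q)^-1 *: (x *m invmx T)); last by rewrite -scalemxAl mulmxKV.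
  rewrite /unit_ball/= nrmZ ger0_norm ?invr_ge0 ?(ltW c0)// ler_pdivrMl// mulr1.
  rewrite -ler_sqr ?nnegrE ?nrm_ge0 ?(ltW c0)//; apply: (le_trans (cover _ Lx)).
  by rewrite exprMn q2 ler_pM2r//; lra.
have vE : 0 < vol (ellipsoid T) by have [? _ ?] := ellipsoid_convex_body Tu; exact: vol_gt0.
have h : vol L / vol (ellipsoid T) <= (3 * q) ^+ m.+1.
  rewrite ler_pdivrMr// -lee_fin EFinM !volE !fineK ?lvol_fin//.
  rewrite -lvol_scale ?mulr_gt0//; last exact: mset_compact.
  by apply: le_lvol LE; apply: mset_compact => //; exact: compact_scale.
have -> : 3 * q = ((3 * q) ^+ m.+1) `^ n1^-1.
  by rewrite -powR_mulrn ?mulr_ge0 ?(ltW q0)// -powRrM mulfV ?powRr1 ?mulr_ge0 ?(ltW q0)// gt_eqF.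
apply: ge0_ler_powR; rewrite ?nnegrE ?invr_ge0 ?(ltW n0)//.
  by rewrite divr_ge0 ?(ltW vE)// fine_ge0// lvol_ge0.
by rewrite exprn_ge0// mulr_ge0// ltW.
Qed.

End upper_bound.

Theorem mainTheorem12 (R : realType) :
  exists a b : R, [/\ 0 < a, 0 < b &
    forall n : nat, (2 <= n)%N ->
      ((a * Num.sqrt n%:R)%:E <=
        ereal_sup [set vr_dist L (@projection_body R n) |
                   L in [set L | convex_body L /\ origin_symmetric L]])%E /\
      (ereal_sup [set vr_dist L (@projection_body R n) |
                  L in [set L | convex_body L /\ origin_symmetric L]] <=
        (b * Num.sqrt n%:R)%:E)%E].
Proof.
have [a a0 ha] := lower_bound R.
exists a, 3; split => // -[//|[//|m]] _; split.
  have [L [bL sL hL]] := ha m.+2 isT.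
  apply: (@le_trans _ _ (vr_dist L (@projection_body R m.+2))); last first.
    by apply: ereal_sup_ubound; exists L.
  by apply: le_ereal_inf_tmp => _ [D [DL pD] <-]; rewrite lee_fin; exact: hL.
apply: ge_ereal_sup => _ [L [bL sL] <-].
have [D [DL pD hD]] := upper_bound (isT : (0 < m.+1)%N) bL sL.
apply: (@le_trans _ _ ((vol L / vol D) `^ m.+2%:R^-1)%:E); last by rewrite lee_fin.
by apply: ereal_inf_lbound; exists D.
Qed.
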